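(* Let $q$ be a power of an odd prime $p$ and $n\ge 1$. Let $F$ be a field of characteristic $2$ containing a primitive $p$-th root of unity, and let $I$ be the Steinberg module for $\mathrm{Sp}_{2n}(q)$ over $F$. Let $S$ be the socle of $I$, which affords the trivial representation of $\mathrm{Sp}_{2n}(q)$. Then $I/S$ contains, as irreducible submodules, the two non-isomorphic Weil modules for $\mathrm{Sp}_{2n}(q)$ over $F$ of degree $(q^n-1)/2$.
   Context: Groups. Let $F_q$ be a field with $q$ elements and $V$ a $2n$-dimensional $F_q$-space with a non-degenerate alternating form $\langle\ ,\ \rangle$; $\mathrm{Sp}=\mathrm{Sp}_{2n}(q)$ is the group of all $g\in\mathrm{GL}(V)$ preserving the form. Fix a symplectic basis $u_1,\dots,u_n,v_1,\dots,v_n$: $\langle u_i,v_j\rangle=\delta_{ij}$, $\langle u_i,u_j\rangle=\langle v_i,v_j\rangle=0$. Put $M=\mathrm{span}\{u_i\}$, $N=\mathrm{span}\{v_i\}$. $\mathrm{Sp}^M$ is the pointwise stabilizer of $M$ in $\mathrm{Sp}$, $\mathrm{Sp}_{M,N}$ is the subgroup preserving both $M$ and $N$, and $\mathrm{Sp}_M=\mathrm{Sp}^M\rtimes\mathrm{Sp}_{M,N}$ is the global stabilizer of $M$ (a maximal subgroup of $\mathrm{Sp}$). $T$ is the group of $g\in\mathrm{Sp}_{M,N}$ whose matrix on $M$ relative to $u_1,\dots,u_n$ is upper triangular with 1's on the diagonal; $U=T\,\mathrm{Sp}^M$ (a Sylow $p$-subgroup); $H$ is the group of $g\in\mathrm{Sp}_{M,N}$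 having all $u_i,v_j$ as eigenvectors; $B=UH$. Steinberg module. Let $w_i$ ($1\le i<n$) be the element of $\mathrm{Sp}$ permuting the basis as $(u_i,u_{i+1})(v_i,v_{i+1})$, and $c_j$ ($1\le j\le n$) the element with $c_ju_j=v_j$, $c_jv_j=-u_j$ fixing all other basis vectors. Let $W_2=\langle w_1,\dots,w_{n-1},c_1,\dots,c_n\rangle$, which normalizes $H$; $W=W_2H/H$ is the Weyl group, with length function $\ell$ relative to the generators $w_1H,\dots,w_{n-1}H,c_nH$. For $w\in W$ choose $n_w\in W_2$ with $n_wH=w$. Put $e=\big(\sum_{w\in W}(-1)^{\ell(w)}n_w\big)\sum_{b\in B}b\in F\,\mathrm{Sp}$. The (left) Steinberg module is $I=F\,\mathrm{Sp}\cdot e$. Weil modules (for $p$ odd, $F$ a field of characteristic $l\ne p$ with a primitive $p$-th root of unity). Let $\lambda:F_q^+\to F^*$ be a non-trivial linear character and $Y=Y_\lambda$ an $F$-space with basis $(\epsilon_v)_{v\in N}$. The Weil representation of type $\lambda$ is the representation $P:\mathrm{Sp}\to\mathrm{GL}(Y)$ determined by $$P(sa)\epsilon_v=\theta(a)^n\lambda(\langle sav,av\rangle)\epsilon_{av}\quad(s\in\mathrm{Sp}^M,\ a\in\mathrm{Sp}_{M,N}),$$ $$P(\rho)\epsilon_v=\Big(\sum_{\alpha\in F_q}\lambda(\alpha^2)\Big)^{-1}\sum_{\alpha\in F_q}\lambda(\alpha^2)\epsilon_{v+\alpha v_n},$$ where $\theta(a)=1\in F$ if $\det a|_N$ is a square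 in $F_q^*$ and $\theta(a)=-1\in F$ otherwise, and $\rho\in\mathrm{Sp}$ is the transvection $\rho(v)=v-\langle v_n,v\rangle v_n$. The Weil module of type $\lambda$ and degree $(q^n-1)/2$ is the $\mathrm{Sp}$-submodule $Y^-_\lambda$ of $Y$ spanned by the vectors $\epsilon_v-\epsilon_{-v}$, $0\ne v\in N$. As $\lambda$ runs over all non-trivial linear characters of $F_q^+$ there are exactly two isomorphism types: $\lambda$ and $\lambda[\kappa]:\alpha\mapsto\lambda(\kappa\alpha)$ give isomorphic modules if and only if $\kappa\in F_q^*$ is a square. *)

(* Defs.v *)
From HB Require Import structures.
From mathcomp Require Import all_boot all_order all_algebra all_fingroup.
From mathcomp Require Import all_character.
From mathcomp Require Import ring.

Set Implicit Arguments.
Unset Strict Implicit.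
Unset Printing Implicit Defensive.

Import GRing.Theory.
Local Open Scope group_scope.
Local Open Scope ring_scope.

(* MathComp's matrix representations are right modules of row vectors, while
   the modules here are left modules.  A representation rG is read as the left
   module with action  g . y = y *m rG g^-1.  This dictionary does not change
   submodules, quotients, socles, simplicity or isomorphism. *)
Definition lact (F : fieldType) (gT : finGroupType) (G : {group gT}) (d : nat)
    (rG : mx_representation F G d) (g : gT) (y : 'rV[F]_d) : 'rV[F]_d :=
  y *m rG g^-1%g.

Section LeftRegular.

Variables (F : fieldType) (gT : finGroupType) (G : {group gT}).

(* The element h of G, seen in the group algebra FG. *)
Definition gelt (h : gT) : 'rV[F]_#|G| := delta_mx 0 (gring_index G h).

Definition lreg_mx (x : gT) : 'M[F]_#|G| :=
  \matrix_i gelt (x^-1 * enum_val i)%g.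

Lemma lreg_mx_repr : mx_repr G lreg_mx.
Proof.
split=> [|x y Gx Gy]; apply/row_matrixP=> i; rewrite !rowK.
  by rewrite row1 invg1 mul1g /gelt gring_valK.
rewrite row_mul rowK -rowE rowK gring_indexK; last first.
  by rewrite groupM ?groupV ?enum_valP.
by rewrite invMg mulgA.
Qed.

Definition lreg_repr : mx_representation F G #|G| :=
  MxRepresentation lreg_mx_repr.

Lemma lact_lreg g h :
  g \in G -> h \in G -> lact lreg_repr g (gelt h) = gelt (g * h)%g.
Proof.
by move=> Gg Gh; rewrite /lact /= -rowE rowK gring_indexK // invgK.
Qed.

End LeftRegular.

Definition iso_submod (F : fieldType) (gT : finGroupType) (G : {group gT})
    (d1 d2 : nat) (r1 : mx_representation F G d1) (U1 : 'M[F]_d1)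
    (r2 : mx_representation F G d2) (U2 : 'M[F]_d2) : Prop :=
  exists (modU1 : mxmodule r1 U1) (modU2 : mxmodule r2 U2),
    mx_rsim (submod_repr modU1) (submod_repr modU2).

(* The rank is n.+1 >= 1, and indices are shifted by one: u_1, ..., u_(n+1)
   are sp_u 0, ..., sp_u ord_max. *)
Section Symplectic.

Variables (K : finFieldType) (n : nat).

Local Notation gT := {'GL_(n.+1 + n.+1)[K]}.
Local Notation V := 'cV[K]_(n.+1 + n.+1).

Definition sp_act (g : gT) (x : V) : V := GLval g *m x.

Definition sp_form (x y : V) : K :=
  \sum_(i < n.+1) (x (lshift n.+1 i) 0 * y (rshift n.+1 i) 0
                   - x (rshift n.+1 i) 0 * y (lshift n.+1 i) 0).

Definition sp_u (i : 'I_n.+1) : V := delta_mx (lshift n.+1 i) 0.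
Definition sp_v (i : 'I_n.+1) : V := delta_mx (rshift n.+1 i) 0.

Definition Sp_set : {set gT} :=
  [set g | [forall x, forall y, sp_form (sp_act g x) (sp_act g y) == sp_form x y]].

Lemma sp_actM g h x : sp_act (g * h)%g x = sp_act g (sp_act h x).
Proof. by rewrite /sp_act mulmxA. Qed.

Lemma sp_act1 x : sp_act 1%g x = x.
Proof. by rewrite /sp_act mul1mx. Qed.

Lemma Sp_group_set : group_set Sp_set.
Proof.
apply/group_setP; split=> [|g h].
  by rewrite inE; apply/'forall_forallP=> x y; rewrite !sp_act1.
rewrite !inE => /'forall_forallP Sg /'forall_forallP Sh.
apply/'forall_forallP=> x y.
by rewrite !sp_actM (eqP (Sg _ _)) (eqP (Sh _ _)).
Qed.

Definition Sp : {group gT} := Group Sp_group_set.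

Definition spanM : {set V} :=
  [set x | [exists a : {ffun 'I_n.+1 -> K}, x == \sum_i a i *: sp_u i]].
Definition spanN : {set V} :=
  [set x | [exists a : {ffun 'I_n.+1 -> K}, x == \sum_i a i *: sp_v i]].

Definition Sp_fixM : {set gT} := [set s in Sp | [forall x in spanM, sp_act s x == x]].

Definition Sp_stabMN : {set gT} :=
  [set a in Sp | [forall x in spanM, sp_act a x \in spanM]
                 && [forall x in spanN, sp_act a x \in spanN]].

(* The matrix of g on M has entry (i, j) equal to the u_i-coordinate of
   g u_j. *)
Definition sp_T : {set gT} :=
  [set g in Sp_stabMN | [forall i : 'I_n.+1, forall j : 'I_n.+1,
    (j <= i)%N ==> (sp_act g (sp_u j) (lshift n.+1 i) 0 == (i == j)%:R)]].

Definition sp_U : {set gT} := (sp_T * Sp_fixM)%g.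

Definition sp_H : {set gT} :=
  [set h in Sp_stabMN | [forall i, [exists c : K, sp_act h (sp_u i) == c *: sp_u i]]
                   && [forall i, [exists c : K, sp_act h (sp_v i) == c *: sp_v i]]].

Definition sp_B : {set gT} := (sp_U * sp_H)%g.

(* The singleton of the element w_i permuting u_i, u_j and v_i, v_j, when
   j = i + 1. *)
Definition swap_elt (i j : 'I_n.+1) : {set gT} :=
  [set g in Sp | [forall k, (sp_act g (sp_u k) == sp_u (tperm i j k))
                            && (sp_act g (sp_v k) == sp_v (tperm i j k))]].

Definition w_elts : {set gT} :=
  \bigcup_(i : 'I_n.+1) \bigcup_(j : 'I_n.+1 | j == i.+1 :> nat) swap_elt i j.

(* The singleton of the element c_j. *)
Definition c_elt (j : 'I_n.+1) : {set gT} :=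
  [set g in Sp | [&& sp_act g (sp_u j) == sp_v j, sp_act g (sp_v j) == - sp_u j &
    [forall k, (k != j) ==> (sp_act g (sp_u k) == sp_u k) && (sp_act g (sp_v k) == sp_v k)]]].

Definition W2 : {set gT} := <<w_elts :|: \bigcup_j c_elt j>>%g.

Definition Weyl : {set coset_of sp_H} := (W2 / sp_H)%g.

Definition Weyl_gens : {set coset_of sp_H} :=
  [set coset sp_H g | g in w_elts :|: c_elt ord_max].

(* The least k such that w is a product of k generators; such a k always
   exists below #|Weyl|. *)
Definition Weyl_length (w : coset_of sp_H) : nat :=
  find (fun k => w \in (Weyl_gens ^+ k)%g) (iota 0 #|Weyl|).

Definition Weyl_lift (nw : coset_of sp_H -> gT) : Prop :=
  {in Weyl, forall w, nw w \in W2 /\ coset sp_H (nw w) = w}.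

Variable F : fieldType.

Section Steinberg.

Variable nw : coset_of sp_H -> gT.

Definition steinberg_e : 'rV[F]_#|Sp| :=
  \sum_(w in Weyl) \sum_(b in sp_B)
    (-1) ^+ Weyl_length w *: gelt F Sp (nw w * b)%g.

Definition steinberg_mx : 'M[F]_#|Sp| :=
  cyclic_mx (lreg_repr F Sp) steinberg_e.

Definition steinberg_repr : mx_representation F Sp (\rank steinberg_mx) :=
  submod_repr (cyclic_mx_module (lreg_repr F Sp) steinberg_e).

End Steinberg.

Definition nontrivial_char (lam : K -> F) : Prop :=
  [/\ lam 0 = 1, {morph lam : a b / a + b >-> a * b}
    & exists a, lam a != 1].

Definition detN (a : gT) : K :=
  \det (\matrix_(i < n.+1, j < n.+1) sp_act a (sp_v j) (rshift n.+1 i) 0).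

Definition theta (a : gT) : F :=
  if [exists c : K, detN a == c ^+ 2] then 1 else -1.

Lemma spanN0 : 0 \in spanN.
Proof.
rewrite inE; apply/existsP; exists [ffun=> 0]; rewrite eq_sym; apply/eqP.
by apply: big1 => i _; rewrite ffunE scale0r.
Qed.

(* Meaningful only for x in N. *)
Definition eps (x : V) : 'rV[F]_#|spanN| := delta_mx 0 (enum_rank_in spanN0 x).

Definition rho_transvection (r : gT) : Prop :=
  forall x : V, sp_act r x = x - sp_form (sp_v ord_max) x *: sp_v ord_max.

Definition weil_repr (lam : K -> F) (P : mx_representation F Sp #|spanN|) :
    Prop :=
  (forall s a x, s \in Sp_fixM -> a \in Sp_stabMN -> x \in spanN ->
     lact P (s * a)%g (eps x) =
       theta a ^+ n.+1 * lam (sp_form (sp_act (s * a)%g x) (sp_act a x))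
         *: eps (sp_act a x))
  /\ (forall r x, r \in Sp -> rho_transvection r -> x \in spanN ->
     lact P r (eps x) =
       (\sum_(c : K) lam (c ^+ 2))^-1 *:
         \sum_(c : K) lam (c ^+ 2) *: eps (x + c *: sp_v ord_max)).

Definition weil_minus : 'M[F]_#|spanN| :=
  (\sum_(x in spanN | x != 0%R) <<eps x - eps (- x)>>)%MS.

End Symplectic.

(* The elements rho, w_i and c_j described by their action do exist; as they
   are given on a basis, they are unique. *)
Section Existence.

Variables (K : finFieldType) (n : nat).
Local Notation gT := {'GL_(n.+1 + n.+1)[K]}.
Local Notation V := 'cV[K]_(n.+1 + n.+1).

Lemma sp_form_u (i : 'I_n.+1) (x : V) : sp_form (sp_u K i) x = x (rshift n.+1 i) 0.
Proof.
rewrite /sp_form (bigD1 i) //= big1 ?addr0 => [|j /negPf ne].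
  by rewrite !mxE !eqxx eq_rlshift /= mul0r subr0 mul1r.
by rewrite !mxE eq_rlshift (inj_eq (@lshift_inj _ _)) ne /= !mul0r subr0.
Qed.
Lemma sp_form_v (i : 'I_n.+1) (x : V) : sp_form (sp_v K i) x = - x (lshift n.+1 i) 0.
Proof.
rewrite /sp_form (bigD1 i) //= big1 ?addr0 => [|j /negPf ne].
  by rewrite !mxE !eqxx eq_lrshift /= mul0r sub0r mul1r.
by rewrite !mxE eq_lrshift (inj_eq (@rshift_inj _ _)) ne /= !mul0r subr0.
Qed.

Lemma Sp_of_fun (f : V -> V) : linear f ->
  (forall x y, sp_form (f x) (f y) = sp_form x y) ->
  exists2 g : gT, g \in Sp K n & forall x, sp_act g x = f x.
Proof.
move=> lf ff.
pose A : 'M[K]_(n.+1 + n.+1) := \matrix_(a, b) f (delta_mx b 0) a 0.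
have fZ a x : f (a *: x) = a *: f x.
  have f0 : f 0 = 0 by have := lf (-1) 0 0; rewrite scaler0 addr0 scaleN1r addNr.
  by have := lf a x 0; rewrite f0 !addr0.
have fD x y : f (x + y) = f x + f y by have := lf 1 x y; rewrite !scale1r.
have f0 : f 0 = 0 by have := fZ 0 0; rewrite !scale0r.
have Af x : A *m x = f x.
  have {2}->: x = \sum_b x b 0 *: delta_mx b 0.
    by rewrite [LHS]matrix_sum_delta; apply: eq_bigr => b _; rewrite big_ord1.
  rewrite (big_morph f fD f0); apply/colP=> a; rewrite mxE summxE.
  by apply: eq_bigr => b _; rewrite fZ !mxE mulrC.
have uA : A \in unitmx.
  rewrite unitmxE -det_tr unitfE; apply/negP=> /det0P [w nz] wA.
  case/eqP: nz; apply: trmx_inj; rewrite trmx0.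
  have: f w^T = 0 by rewrite -Af -(trmxK A) -trmx_mul wA trmx0.
  move=> fw0; apply/colP=> a; rewrite [RHS]mxE.
  have F0 x : sp_form x w^T = 0.
    by rewrite -ff fw0 /sp_form big1 // => i _; rewrite !mxE !mulr0 subr0.
  case: (split_ordP a) => i ->; last by rewrite -sp_form_u F0.
  by apply: oppr_inj; rewrite -sp_form_v F0 oppr0.
exists (FinRing.unit 'M[K]_(n.+1 + n.+1) uA : gT); last by move=> x; exact: Af.
by rewrite inE; apply/'forall_forallP=> x y; rewrite /sp_act !Af ff.
Qed.

Lemma rho_transvection_exists :
  exists2 r : gT, r \in Sp K n & rho_transvection r.
Proof.
apply: (@Sp_of_fun (fun x => x - sp_form (sp_v K ord_max) x *: sp_v K ord_max)).
  by move=> a x y; rewrite !sp_form_v; apply/colP=> i; rewrite !mxE; ring.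
move=> x y; rewrite !sp_form_v /sp_form; apply: eq_bigr => i _.
rewrite !mxE !eq_lrshift !(inj_eq (@rshift_inj _ _)) /=.
by case: (eqVneq i ord_max) => [->|_] /=; ring.
Qed.

Lemma swap_elt_neq0 (i j : 'I_n.+1) : swap_elt K i j != set0.
Proof.
have [|x y|g Sg Eg] := @Sp_of_fun (fun x => \col_a
  match split a with inl k => x (lshift n.+1 (tperm i j k)) 0
                   | inr k => x (rshift n.+1 (tperm i j k)) 0 end).
- move=> a x y; apply/colP=> b; rewrite !mxE; case: (split b) => k; rewrite !mxE //.
- rewrite /sp_form [RHS](reindex_inj (@perm_inj _ (tperm i j))).
  by apply: eq_bigr => k _; rewrite !mxE !(unsplitK (inl k)) !(unsplitK (inr k)).
apply/set0Pn; exists g; rewrite inE Sg; apply/forallP=> k; rewrite !Eg.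
apply/andP; split; apply/eqP/colP=> b; rewrite !mxE !andbT; case: (split_ordP b) => m ->;
  rewrite ?(unsplitK (inl m)) ?(unsplitK (inr m)) ?mxE ?eq_lrshift ?eq_rlshift //= ?andbT.
  by rewrite !(inj_eq (@lshift_inj _ _)) (can2_eq (tpermK i j) (tpermK i j)).
by rewrite !(inj_eq (@rshift_inj _ _)) (can2_eq (tpermK i j) (tpermK i j)).
Qed.

Lemma c_elt_neq0 (j : 'I_n.+1) : c_elt K j != set0.
Proof.
have [|x y|g Sg Eg] := @Sp_of_fun (fun x => \col_a
  match split a with
  | inl k => if k == j then - x (rshift n.+1 k) 0 else x (lshift n.+1 k) 0
  | inr k => if k == j then x (lshift n.+1 k) 0 else x (rshift n.+1 k) 0 end).
- move=> a x y; apply/colP=> b; rewrite !mxE; case: (split b) => k;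
    case: eqP=> _; rewrite !mxE //; ring.
- rewrite /sp_form.
  apply: eq_bigr => k _; rewrite !mxE !(unsplitK (inl k)) !(unsplitK (inr k)).
  by case: eqP => // _; ring.
apply/set0Pn; exists g; rewrite inE Sg /=.
have lE := inj_eq (@lshift_inj n.+1 n.+1).
have rE := inj_eq (@rshift_inj n.+1 n.+1).
apply/and3P; split; last (apply/forallP=> k; apply/implyP=> /negPf ne; apply/andP; split);
 rewrite Eg; apply/eqP/colP=> b; rewrite !mxE !andbT; case: (split_ordP b) => m ->;
  rewrite ?(unsplitK (inl m)) ?(unsplitK (inr m)) ?mxE ?eq_lrshift ?eq_rlshift ?lE ?rE //= ?andbT;
  case: (eqVneq m j) => [?|_]; try subst m; rewrite ?eqxx ?oppr0 ?(eq_sym j) ?ne //=.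
by rewrite oppr0.
Qed.

End Existence.

(* Main.v *)
Require Import Defs.
From mathcomp Require Import all_boot all_order all_algebra all_fingroup.
From mathcomp Require Import all_solvable all_character all_field.
From mathcomp Require Import ring zify.

Set Implicit Arguments.
Unset Strict Implicit.
Unset Printing Implicit Defensive.

Import GRing.Theory.
Local Open Scope ring_scope.

(** In characteristic 2 all signs disappear, and the Steinberg module becomes a space of
functions on the chambers of the building, that is on the cosets g B (equivalently, on
the flags of totally isotropic subspaces). The element e is the indicator function of
the standard apartment W B. A panel is a flag with one member missing; it is contained
in q + 1 chambers, and it meets an apartment in 0 or 2 of them. So the sum of e over
every panel is 0, and the same holds for all elements of I. Conversely, a function whose
panel sums vanish is determined by its values on the chambers opposite to B
([cell_vanish]: by the Bruhat decomposition, a panel sum expresses the value on a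
chamber through values on chambers of larger cells). These are the u w0 B with u in the
unipotent group U, and u w0 B is the only opposite chamber in the apartment u W B
([apart_cell]). Hence I is exactly the space of functions with vanishing panel sums
([panel_space_steinberg]).

As q + 1 is even, the constant function 1 is in I. Let J be a nonzero submodule, and
take f in J that is nonzero at the standard chamber. The average of f over U is still
nonzero there, since |U| is odd; being U-invariant, it is constant on the opposite
chambers, so it is a multiple of 1. Thus every nonzero submodule of I contains 1, and
the socle is the line of constant functions ([ones_sub_module], [socle_ones]).

A sum over a set with an involution reduces, in characteristic 2, to the fixed points
([sum_involution]). In particular the Gauss sums and theta are equal to 1. This makes it
possible to construct the Weil representation without any choice of normalization: the
Heisenberg group of V acts on Y, the vector eps_0 spans the line fixed by M, and the
operator of g sends eps_0 to the sum of its translates under gM ([weil_op], [weil_opM]).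
Conversely, the formulas of the definition determine a representation on generators
([Sp_ind]).

Let iota be the operator of -1 in Sp, which permutes the basis by v |-> -v. In
characteristic 2, Y^- is the image of 1 + iota, and the kernel Y^+ of 1 + iota is the
sum of Y^- and the line of eps_0 ([ker_diff]), so Y/Y^+ is isomorphic to Y^-. This
module is simple: the Siegel radical Sp^M acts on eps_v by a character that determines v
up to sign, which allows one to isolate a single eps_v + eps_(-v) in any submodule, and
the Levi subgroup permutes the nonzero v transitively ([diff_simple]).

The coordinate of index 0 is a linear form on Y that is invariant under the Siegel
parabolic subgroup, hence under B. So y gives the function g |-> (coordinate 0 of g^-1
y) on chambers, and its panel sums vanish ([orbit_panel]): for a panel of short root
type, all chambers lie over one Lagrangian, and there are q + 1 of them; for the long
root, averaging the character lambda kills all the terms but two equal ones. This is a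
homomorphism from Y to I. It sends Y^+ to the constants ([orbit_mx_sym]) but not all of
Y; so it induces a nonzero map from Y/Y^+ to I/S, injective by simplicity, and its image
is a copy of Y^- in I/S ([weil_minus_embed]).

Finally, eps_v |-> eps_(c v) intertwines the representations of types lambda[c^2] and
lambda, and every nontrivial character is a twist of a given one; so there are at most
two types. For a nonsquare kappa the weights of the Siegel radical on the two modules
differ, and so the modules are not isomorphic ([weil_minus_not_iso]). *)

(** * Cosets and subgroups of the general linear group *)

Section Cosets.

Variable gT : finGroupType.
Implicit Types (G : {group gT}) (x y : gT).

Lemma repr_lcoset_mem G x : (x^-1 * repr (x *: G))%g \in G.
Proof. by rewrite -mem_lcoset; apply: (mem_repr x); exact: lcoset_refl. Qed.

Lemma lcoset_eq_mem G x y : (x *: G = y *: G)%g -> (x^-1 * y)%g \in G.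
Proof. by rewrite -mem_lcoset => ->; exact: lcoset_refl. Qed.

Lemma coset_eq_mem G x y : x \in 'N(G)%g -> y \in 'N(G)%g ->
  coset G x = coset G y -> (x^-1 * y)%g \in G.
Proof.
move=> Nx Ny /esym/rcoset_kercosetP => /(_ Ny Nx).
by rewrite norm_rlcoset // mem_lcoset.
Qed.

Lemma mulVg_comm x y : (x * y = y * x -> x^-1 * y = y * x^-1)%g.
Proof. by move=> xy; apply: (mulgI x); rewrite mulKVg mulgA xy mulgK. Qed.

Lemma mulsg_ex (A B : {set gT}) x : x \in (A * B)%g ->
  exists y z, [/\ y \in A, z \in B & x = (y * z)%g].
Proof. by case/mulsgP=> y z Ay Bz ->; exists y, z. Qed.

End Cosets.

(** Facts about abstract finite groups, read in the general linear group, where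
multiplication is the product of matrices. *)
Section GLSubgroups.

Variables (K : finFieldType) (m : nat).
Local Notation gT := {'GL_m[K]}.
Implicit Types (G : {group gT}) (x y : gT).

Lemma glM G x y : x \in G -> y \in G -> (x * y)%g \in G.
Proof. exact_no_check (@groupM gT G x y). Qed.

Lemma glV G x : (x^-1%g \in G) = (x \in G).
Proof. exact_no_check (@groupV gT G x). Qed.

Lemma glVr G x : x \in G -> x^-1%g \in G.
Proof. by rewrite glV. Qed.

Lemma gl_repr_lcoset G x : (x^-1 * repr (x *: G))%g \in G.
Proof. exact_no_check (@repr_lcoset_mem gT G x). Qed.

Lemma gl_lcoset_eq G x y : (x *: G = y *: G)%g -> (x^-1 * y)%g \in G.
Proof. exact_no_check (@lcoset_eq_mem gT G x y). Qed.

Lemma gl_coset_eq G x y : x \in 'N(G)%g -> y \in 'N(G)%g ->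
  coset G x = coset G y -> (x^-1 * y)%g \in G.
Proof. exact_no_check (@coset_eq_mem gT G x y). Qed.

Lemma gl_mulsg (A B : {set gT}) x : x \in (A * B)%g ->
  exists y z : gT, [/\ y \in A, z \in B & x = (y * z)%g].
Proof. exact_no_check (@mulsg_ex gT A B x). Qed.

Lemma gl_invK x : (x^-1^-1 = x)%g.
Proof. exact_no_check (@invgK gT x). Qed.

Lemma gl_mulVg_comm x y : (x * y = y * x -> x^-1 * y = y * x^-1)%g.
Proof. exact_no_check (@mulVg_comm gT x y). Qed.

Lemma gl_invM x y : ((x * y)^-1 = y^-1 * x^-1)%g.
Proof. exact_no_check (@invMg gT x y). Qed.

Lemma gl_lactE (F : fieldType) G k (rG : mx_representation F G k) x (y : 'rV_k) :
  lact rG x y = y *m rG x^-1%g.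
Proof. exact_no_check (erefl (lact rG x y)). Qed.

Lemma gl_reprM (F : fieldType) G k (rG : mx_representation F G k) x y :
  x \in G -> y \in G -> rG (x * y)%g = rG x *m rG y.
Proof. exact_no_check (@repr_mxM F _ G k rG x y). Qed.

Lemma gl_mulKV x y : (x * (x^-1 * y) = y)%g.
Proof. exact: mulKVg. Qed.

End GLSubgroups.

(** * Symplectic linear algebra *)

Section SymplecticForm.

Variables (K : finFieldType) (n : nat).
Local Notation N := n.+1.
Local Notation gT := {'GL_(n.+1 + n.+1)[K]}.
Local Notation V := 'cV[K]_(n.+1 + n.+1).
Local Notation Sp := (Sp K n).
Implicit Types (x y : V) (g h : gT) (b c : 'I_(N + N)) (i j : 'I_N).

Lemma sp_formE x y : sp_form x y =
  ((usubmx x)^T *m dsubmx y - (dsubmx x)^T *m usubmx y) 0 0.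
Proof.
rewrite !mxE -sumrB; apply: eq_bigr => i _; rewrite !mxE; ring.
Qed.

Lemma sp_formDr x y y' : sp_form x (y + y') = sp_form x y + sp_form x y'.
Proof. by rewrite /sp_form -big_split; apply: eq_bigr => i _; rewrite !mxE /=; ring. Qed.

Lemma sp_formZr a x y : sp_form x (a *: y) = a * sp_form x y.
Proof. by rewrite /sp_form mulr_sumr; apply: eq_bigr => i _; rewrite !mxE /=; ring. Qed.

Lemma sp_formC x y : sp_form y x = - sp_form x y.
Proof. by rewrite /sp_form -sumrN; apply: eq_bigr => i _; rewrite /=; ring. Qed.

Lemma sp_formDl x x' y : sp_form (x + x') y = sp_form x y + sp_form x' y.
Proof. by rewrite sp_formC sp_formDr opprD -!(sp_formC y). Qed.

Lemma sp_formZl a x y : sp_form (a *: x) y = a * sp_form x y.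
Proof. by rewrite sp_formC sp_formZr -mulrN -sp_formC. Qed.

Lemma sp_form0r x : sp_form x 0 = 0.
Proof. by rewrite -(scale0r x) sp_formZr mul0r. Qed.

Lemma sp_form0l x : sp_form 0 x = 0.
Proof. by rewrite -(scale0r x) sp_formZl mul0r. Qed.

Lemma sp_formNr x y : sp_form x (- y) = - sp_form x y.
Proof. by rewrite -scaleN1r sp_formZr mulN1r. Qed.

Lemma sp_formNl x y : sp_form (- x) y = - sp_form x y.
Proof. by rewrite -scaleN1r sp_formZl mulN1r. Qed.

Lemma sp_form_xx x : sp_form x x = 0.
Proof. by rewrite /sp_form big1 // => i _; ring. Qed.

Definition e_ b : V := delta_mx b 0.

Definition dual b : 'I_(N + N) :=
  match split b with inl i => rshift N i | inr i => lshift N i end.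

Definition sgn b : K := if split b is inl _ then 1 else -1.

(** The place of a basis vector in the list u_0, ..., u_n, v_n, ..., v_0, for which the
Borel subgroup is upper triangular. *)
Definition lvl b : nat :=
  match split b with inl i => i | inr i => (N + N).-1 - i end.

Lemma split_lshift i : split (lshift N i : 'I_(N + N)) = inl i.
Proof. exact: (unsplitK (inl i)). Qed.
Lemma split_rshift i : split (rshift N i : 'I_(N + N)) = inr i.
Proof. exact: (unsplitK (inr i)). Qed.

Lemma dual_l i : dual (lshift N i) = rshift N i.
Proof. by rewrite /dual split_lshift. Qed.
Lemma dual_r i : dual (rshift N i) = lshift N i.
Proof. by rewrite /dual split_rshift. Qed.
Lemma sgn_l i : sgn (lshift N i) = 1.
Proof. by rewrite /sgn split_lshift. Qed.
Lemma sgn_r i : sgn (rshift N i) = -1.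
Proof. by rewrite /sgn split_rshift. Qed.
Lemma lvl_l i : lvl (lshift N i) = i.
Proof. by rewrite /lvl split_lshift. Qed.
Lemma lvl_r i : lvl (rshift N i) = ((N + N).-1 - i)%N.
Proof. by rewrite /lvl split_rshift. Qed.
Lemma e_l i : e_ (lshift N i) = sp_u K i. Proof. by []. Qed.
Lemma e_r i : e_ (rshift N i) = sp_v K i. Proof. by []. Qed.

Lemma dualK : involutive dual.
Proof. by move=> b; case: (split_ordP b) => i ->; rewrite ?(dual_l, dual_r). Qed.

Lemma dual_inj : injective dual. Proof. exact: inv_inj dualK. Qed.

Lemma sgn_sq b : sgn b * sgn b = 1.
Proof. by rewrite /sgn; case: split => _; ring. Qed.

Lemma sgn_dual b : sgn (dual b) = - sgn b.
Proof.
by case: (split_ordP b) => i ->; rewrite ?(dual_l, dual_r) ?(sgn_l, sgn_r) ?opprK.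
Qed.

Lemma lvl_dual b : (lvl (dual b) + lvl b)%N = (N + N).-1.
Proof.
by case: (split_ordP b) => i ->; rewrite ?(dual_l, dual_r) ?(lvl_l, lvl_r);
   have := ltn_ord i; lia.
Qed.

Lemma lvl_inj : injective lvl.
Proof.
move=> b c; case: (split_ordP b) => i ->; case: (split_ordP c) => j ->;
rewrite ?(lvl_l, lvl_r) => E; have := ltn_ord i; have := ltn_ord j => lj li;
(try by exfalso; lia); congr (_ _ _); apply: val_inj => /=; lia.
Qed.

Lemma lvl_lt b : (lvl b < N + N)%N.
Proof. by have := lvl_dual b; lia. Qed.

Lemma coordD x y b : (x + y) b 0 = x b 0 + y b 0. Proof. exact: mxE. Qed.
Lemma coordZ a x b : (a *: x) b 0 = a * x b 0. Proof. exact: mxE. Qed.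

Lemma coordN x b : (- x) b 0 = - x b 0. Proof. exact: mxE. Qed.

Lemma e_E b c : e_ b c 0 = (c == b)%:R.
Proof. by rewrite mxE eqxx andbT. Qed.

Lemma sp_form_e b x : sp_form (e_ b) x = sgn b * x (dual b) 0.
Proof.
case: (split_ordP b) => i ->; rewrite ?(dual_l, dual_r, sgn_l, sgn_r).
  by rewrite mul1r -sp_form_u.
by rewrite mulN1r -sp_form_v.
Qed.

Lemma coordE x b : x b 0 = sgn b * sp_form x (e_ (dual b)).
Proof. by rewrite sp_formC sp_form_e dualK sgn_dual !(mulrN, mulNr) opprK mulrA sgn_sq mul1r. Qed.

Lemma sp_form_inj x y : (forall c, sp_form (e_ c) x = sp_form (e_ c) y) -> x = y.
Proof.
move=> E; apply/colP=> b; rewrite !coordE; congr (_ * _).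
by rewrite sp_formC E -sp_formC.
Qed.

Lemma sum_e x : x = \sum_b x b 0 *: e_ b.
Proof. by rewrite [LHS]matrix_sum_delta; apply: eq_bigr => b _; rewrite big_ord1. Qed.

Lemma sp_actD g x y : sp_act g (x + y) = sp_act g x + sp_act g y.
Proof. exact: mulmxDr. Qed.
Lemma sp_actZ g a x : sp_act g (a *: x) = a *: sp_act g x.
Proof. by rewrite /sp_act scalemxAr. Qed.
Lemma sp_act0 g : sp_act g (0 : V) = 0.
Proof. exact: mulmx0. Qed.
Lemma sp_actN g x : sp_act g (- x) = - sp_act g x.
Proof. exact: mulmxN. Qed.
Lemma sp_act_sum g (I : finType) (P : pred I) (f : I -> V) :
  sp_act g (\sum_(i | P i) f i) = \sum_(i | P i) sp_act g (f i).
Proof. exact: mulmx_sumr. Qed.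

Lemma sp_actK g : cancel (sp_act g) (sp_act g^-1 : V -> V).
Proof. by move=> x; rewrite -sp_actM mulVg sp_act1. Qed.
Lemma sp_actVK g : cancel (sp_act g^-1) (sp_act g : V -> V).
Proof. by move=> x; rewrite -sp_actM mulgV sp_act1. Qed.
Lemma sp_act_inj g : injective (sp_act g : V -> V).
Proof. exact: can_inj (sp_actK g). Qed.

Lemma sp_act_eqP g h : (forall b, sp_act g (e_ b) = sp_act h (e_ b)) -> g = h.
Proof.
move=> E; apply: val_inj; apply/matrixP => a b.
by have /colP/(_ a) := E b; rewrite /sp_act /e_ -!colE !mxE.
Qed.

Lemma SpP g : reflect (forall x y, sp_form (sp_act g x) (sp_act g y) = sp_form x y)
                (g \in Sp).
Proof.
rewrite inE; apply: (iffP 'forall_forallP) => [E x y|E x y]; first exact/eqP.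
by rewrite E.
Qed.

Lemma Sp_form g x y : g \in Sp ->
  sp_form (sp_act g x) (sp_act g y) = sp_form x y.
Proof. by move=> Gg; exact: (SpP _ Gg). Qed.

Lemma Sp_formV g x y : g \in Sp ->
  sp_form (sp_act g x) y = sp_form x (sp_act g^-1 y).
Proof. by move=> Gg; rewrite -[y in LHS](sp_actVK g) Sp_form. Qed.

(** A symplectic map sending the basis vector e_b to any y with coordinate 1 at b and
changing the other basis vectors as little as the form allows. These maps are the
elementary operations of a symplectic Gaussian elimination. *)
Lemma sp_elim b y : y b 0 = 1 ->
  exists t, [/\ t \in Sp, sp_act t (e_ b) = y &
    forall c, c != b -> sp_act t (e_ c) =
      e_ c + (sgn b * sp_form (e_ c) (y - e_ b)) *: e_ (dual b)].
Proof.
move=> yb.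
have [z defz zb] : exists2 z, z = y - e_ b & z b 0 = 0.
  by exists (y - e_ b); rewrite // !mxE yb !eqxx subrr.
rewrite -defz.
pose be x := sgn b * sp_form x z - x b 0 * z (dual b) 0.
pose f x := x + x b 0 *: z + be x *: e_ (dual b).
have [|x x'|t Gt Et] := @Sp_of_fun K n f.
- move=> a x x'; rewrite /f /be sp_formDl sp_formZl.
  by apply/colP=> c; rewrite !mxE; ring.
- have fE u : sp_form u (e_ (dual b)) = sgn b * u b 0.
    by rewrite coordE mulrA sgn_sq mul1r.
  have fE' u : sp_form (e_ (dual b)) u = - (sgn b * u b 0) by rewrite sp_formC fE.
  rewrite /f !(sp_formDl, sp_formDr, sp_formZl, sp_formZr) !sp_form_xx.
  rewrite !fE !fE' zb mulr0 /be (sp_formC x' z) /sgn.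
  by case: (split b) => _; ring.
exists t; split=> // [|c neq]; rewrite Et /f /be.
- rewrite e_E eqxx !scale1r !mul1r sp_form_e mulrA sgn_sq mul1r subrr scale0r addr0.
  by rewrite defz addrC subrK.
by rewrite e_E eq_sym (negPf neq) scale0r mul0r subr0 addr0.
Qed.

End SymplecticForm.


(** * The Lagrangians M and N and their stabilizers *)

Section Borel.

Variables (K : finFieldType) (n : nat).
Local Notation N := n.+1.
Local Notation gT := {'GL_(n.+1 + n.+1)[K]}.
Local Notation V := 'cV[K]_(n.+1 + n.+1).
Local Notation Sp := (Sp K n).
Local Notation e_ := (@e_ K n).
Local Notation u_ := (@sp_u K n).
Local Notation v_ := (@sp_v K n).
Implicit Types (x y : V) (g h : gT) (b c : 'I_(N + N)) (i j : 'I_N).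

Lemma in_spanM x : (x \in spanM K n) = (dsubmx x == 0).
Proof.
rewrite inE; apply/existsP/eqP => [[a /eqP->]|d0].
  apply/colP=> i; rewrite !mxE summxE big1 // => j _.
  by rewrite !mxE eq_rlshift mulr0.
exists [ffun i => x (lshift N i) 0]; apply/eqP.
rewrite [LHS]sum_e big_split_ord /= [X in _ + X]big1 ?addr0 => [|i _].
  by apply: eq_bigr => i _; rewrite ffunE.
by move/colP/(_ i): d0; rewrite !mxE => ->; rewrite scale0r.
Qed.

Lemma in_spanN x : (x \in spanN K n) = (usubmx x == 0).
Proof.
rewrite inE; apply/existsP/eqP => [[a /eqP->]|d0].
  apply/colP=> i; rewrite !mxE summxE big1 // => j _.
  by rewrite !mxE eq_lrshift mulr0.
exists [ffun i => x (rshift N i) 0]; apply/eqP.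
rewrite [LHS]sum_e big_split_ord /= [X in X + _]big1 ?add0r => [|i _].
  by apply: eq_bigr => i _; rewrite ffunE.
by move/colP/(_ i): d0; rewrite !mxE => ->; rewrite scale0r.
Qed.

Lemma spanM_coord x i : x \in spanM K n -> x (rshift N i) 0 = 0.
Proof. by rewrite in_spanM => /eqP/colP/(_ i); rewrite !mxE. Qed.

Lemma spanN_coord x i : x \in spanN K n -> x (lshift N i) 0 = 0.
Proof. by rewrite in_spanN => /eqP/colP/(_ i); rewrite !mxE. Qed.

Lemma u_spanM i : u_ i \in spanM K n.
Proof. by rewrite in_spanM; apply/eqP/colP=> j; rewrite !mxE eq_rlshift. Qed.

Lemma v_spanN i : v_ i \in spanN K n.
Proof. by rewrite in_spanN; apply/eqP/colP=> j; rewrite !mxE eq_lrshift. Qed.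

Lemma spanN_D x y : x \in spanN K n -> y \in spanN K n -> x + y \in spanN K n.
Proof. by rewrite !in_spanN => /eqP Ex /eqP Ey; rewrite raddfD /= Ex Ey addr0. Qed.
Lemma spanN_Z a x : x \in spanN K n -> a *: x \in spanN K n.
Proof. by rewrite !in_spanN => /eqP Ex; rewrite linearZ /= Ex scaler0. Qed.
Lemma spanN_N x : x \in spanN K n -> - x \in spanN K n.
Proof. by rewrite !in_spanN => /eqP Ex; rewrite raddfN /= Ex oppr0. Qed.
Lemma spanM_D x y : x \in spanM K n -> y \in spanM K n -> x + y \in spanM K n.
Proof. by rewrite !in_spanM => /eqP Ex /eqP Ey; rewrite raddfD /= Ex Ey addr0. Qed.
Lemma spanM_Z a x : x \in spanM K n -> a *: x \in spanM K n.
Proof. by rewrite !in_spanM => /eqP Ex; rewrite linearZ /= Ex scaler0. Qed.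
Lemma spanM_N x : x \in spanM K n -> - x \in spanM K n.
Proof. by rewrite !in_spanM => /eqP Ex; rewrite raddfN /= Ex oppr0. Qed.

Lemma sp_form_MM x y : x \in spanM K n -> y \in spanM K n -> sp_form x y = 0.
Proof.
by rewrite !in_spanM sp_formE => /eqP-> /eqP->; rewrite trmx0 mulmx0 mul0mx subrr mxE.
Qed.

Lemma sp_form_NN x y : x \in spanN K n -> y \in spanN K n -> sp_form x y = 0.
Proof.
by rewrite !in_spanN sp_formE => /eqP-> /eqP->; rewrite trmx0 mulmx0 mul0mx subrr mxE.
Qed.

Lemma Sp_fixMP g :
  reflect (g \in Sp /\ forall i, sp_act g (u_ i) = u_ i) (g \in Sp_fixM K n).
Proof.
apply: (iffP setIdP) => -[Gg E]; split=> //.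
  by move=> i; apply/eqP; move/forall_inP: E => /(_ _ (u_spanM i)).
apply/forall_inP=> x; rewrite inE => /existsP[a /eqP->].
by rewrite sp_act_sum; apply/eqP; apply: eq_bigr => i _; rewrite sp_actZ E.
Qed.

Lemma Sp_fixM_act g x : g \in Sp_fixM K n -> x \in spanM K n -> sp_act g x = x.
Proof. by case/setIdP=> _ /forall_inP E /E/eqP. Qed.

Lemma Sp_stabMNP g :
  reflect [/\ g \in Sp, forall i, sp_act g (u_ i) \in spanM K n
            & forall i, sp_act g (v_ i) \in spanN K n] (g \in Sp_stabMN K n).
Proof.
apply: (iffP setIdP) => [[Gg /andP[E E']]|[Gg E E']]; split=> //; last (apply/andP; split).
- by move=> i; move/forall_inP: E => /(_ _ (u_spanM i)).
- by move=> i; move/forall_inP: E' => /(_ _ (v_spanN i)).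
- apply/forall_inP=> x; rewrite inE => /existsP[a /eqP->]; rewrite sp_act_sum.
  by elim/big_ind: _ => [|y z|i _]; [rewrite in_spanM raddf0|exact: spanM_D|rewrite sp_actZ spanM_Z].
- apply/forall_inP=> x; rewrite inE => /existsP[a /eqP->]; rewrite sp_act_sum.
  by elim/big_ind: _ => [|y z|i _]; [rewrite in_spanN raddf0|exact: spanN_D|rewrite sp_actZ spanN_Z].
Qed.

Lemma stab_M g x : g \in Sp_stabMN K n -> x \in spanM K n -> sp_act g x \in spanM K n.
Proof. by case/setIdP=> _ /andP[/forall_inP E _] /E. Qed.

Lemma stab_N g x : g \in Sp_stabMN K n -> x \in spanN K n -> sp_act g x \in spanN K n.
Proof. by case/setIdP=> _ /andP[_ /forall_inP E] /E. Qed.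

Lemma stab_Sp g : g \in Sp_stabMN K n -> g \in Sp.
Proof. by case/Sp_stabMNP. Qed.

Lemma fixM_Sp g : g \in Sp_fixM K n -> g \in Sp.
Proof. by case/Sp_fixMP. Qed.

Lemma one_fixM : 1%g \in Sp_fixM K n.
Proof. by apply/Sp_fixMP; split=> [|i]; rewrite ?group1 ?sp_act1. Qed.

Lemma one_stab : 1%g \in Sp_stabMN K n.
Proof.
by apply/Sp_stabMNP; split=> [|i|i]; rewrite ?group1 ?sp_act1 ?u_spanM ?v_spanN.
Qed.

(** GL(M) acts on V through the contragredient action on N. *)
Lemma sp_levi (A : 'M[K]_N) : A \in unitmx ->
  exists2 a, a \in Sp_stabMN K n &
    forall x, sp_act a x = col_mx (A *m usubmx x) ((invmx A)^T *m dsubmx x).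
Proof.
move=> uA; have [|x y|a Ga Ea] := @Sp_of_fun K n
    (fun x => col_mx (A *m usubmx x) ((invmx A)^T *m dsubmx x)).
- by move=> k x y; rewrite !linearP /= scale_col_mx add_col_mx.
- rewrite !sp_formE !col_mxKu !col_mxKd !trmx_mul trmxK.
  by rewrite !mulmxA -(mulmxA _ A^T) -trmx_mul mulVmx // -(mulmxA _ (invmx A)) mulVmx // trmx1 !mulmx1.
exists a => //; apply/Sp_stabMNP; split=> // i; rewrite Ea.
  rewrite in_spanM col_mxKd.
  have /eqP-> := etrans (esym (in_spanM _)) (u_spanM i).
  by rewrite mulmx0.
rewrite in_spanN col_mxKu.
have /eqP-> := etrans (esym (in_spanN _)) (v_spanN i).
by rewrite mulmx0.
Qed.

(** The Siegel radical, the pointwise stabilizer of M, is the additive group of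
symmetric matrices. *)
Lemma sp_siegel (S : 'M[K]_N) : S^T = S ->
  exists2 s, s \in Sp_fixM K n &
    forall x, sp_act s x = col_mx (usubmx x + S *m dsubmx x) (dsubmx x).
Proof.
move=> sS; have [|x y|a Ga Ea] := @Sp_of_fun K n
    (fun x => col_mx (usubmx x + S *m dsubmx x) (dsubmx x)).
- move=> k x y; rewrite !linearP /=.
  by rewrite scale_col_mx add_col_mx; congr col_mx; rewrite scalerDr addrACA.
- rewrite !sp_formE !col_mxKu !col_mxKd [(_ + _)^T]raddfD /= !trmx_mul sS.
  by rewrite mulmxDl mulmxDr -!mulmxA opprD addrACA subrr addr0.
exists a => //; apply/Sp_fixMP; split=> // i; rewrite Ea.
have /eqP E := etrans (esym (in_spanM _)) (u_spanM i).
by rewrite E mulmx0 addr0 -E vsubmxK.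
Qed.

(** * The Borel subgroup as the stabilizer of a flag *)

(** Vectors of the member of index k of the complete flag that is fixed by the Borel
subgroup; the index starts at 0. *)
Definition low (k : nat) x := [forall c, (x c 0 != 0) ==> (lvl c <= k)%N].

Lemma lowP k x : reflect (forall c, x c 0 != 0 -> (lvl c <= k)%N) (low k x).
Proof. by apply: (iffP forall_inP). Qed.

Lemma low0 k x c : low k x -> (k < lvl c)%N -> x c 0 = 0.
Proof. by move/lowP=> L; apply: contraTeq => /L; lia. Qed.

Lemma low_e b k : low k (e_ b) = (lvl b <= k)%N.
Proof.
apply/lowP/idP => [/(_ b)|L c]; first by rewrite e_E eqxx oner_eq0 => ->.
by rewrite e_E; have [->|] := eqVneq c b; rewrite ?eqxx.
Qed.

Lemma lowD k x y : low k x -> low k y -> low k (x + y).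
Proof.
move=> Lx Ly; apply/lowP=> c; rewrite mxE leqNgt.
by apply: contra => H; rewrite (low0 Lx H) (low0 Ly H) addr0.
Qed.
Lemma lowZ k a x : low k x -> low k (a *: x).
Proof.
by move=> Lx; apply/lowP=> c; rewrite mxE leqNgt; apply: contra => /(low0 Lx)->; rewrite mulr0.
Qed.
Lemma low_zero k : low k 0. Proof. by apply/lowP=> c; rewrite mxE eqxx. Qed.
Lemma low_le k l x : low k x -> (k <= l)%N -> low l x.
Proof. by move/lowP=> L kl; apply/lowP=> c /L /leq_trans; apply. Qed.

Lemma low_act_sum k g x : (forall b, (lvl b <= k)%N -> low k (sp_act g (e_ b))) ->
  low k x -> low k (sp_act g x).
Proof.
move=> L Lx; rewrite [x]sum_e sp_act_sum.
elim/big_ind: _ => [|y z|b _]; [exact: low_zero|exact: lowD|].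
rewrite sp_actZ; have [->|nz] := eqVneq (x b 0) 0; first by rewrite scale0r low_zero.
by apply/lowZ/L; move/lowP: Lx; apply.
Qed.

(** Fixing the totally isotropic half of the flag is enough, because the other half
consists of the orthogonals of these subspaces; see [borel_e]. *)
Definition borel_set : {set gT} := [set g in Sp | [forall i : 'I_N, low i (sp_act g (u_ i))]].

Lemma borel_setP g : reflect (g \in Sp /\ forall i, low i (sp_act g (u_ i))) (g \in borel_set).
Proof.
by apply: (iffP setIdP) => -[Gg /forallP L].
Qed.

Lemma lvl_ltN b k : (lvl b <= k)%N -> (k < N)%N -> exists2 i : 'I_N, b = lshift N i & (i <= k)%N.
Proof.
case: (split_ordP b) => i ->; rewrite ?(lvl_l, lvl_r) => L L'; first by exists i.
by have := ltn_ord i; lia.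
Qed.

Lemma borel_set_low k g x : g \in borel_set -> (k < N)%N -> low k x -> low k (sp_act g x).
Proof.
case/borel_setP=> _ L kN; apply: low_act_sum => b bk.
by have [i -> ik] := lvl_ltN bk kN; apply: low_le (L i) ik.
Qed.

Lemma borel_group_set : group_set borel_set.
Proof.
apply/group_setP; split=> [|g h Bg Bh].
  by apply/borel_setP; rewrite group1; split=> // i; rewrite sp_act1 -e_l low_e lvl_l.
apply/borel_setP; split=> [|i].
  by case/borel_setP: Bg => ? _; case/borel_setP: Bh => ? _; rewrite glM.
by rewrite sp_actM borel_set_low //; case/borel_setP: Bh => _; apply.
Qed.

Canonical borel := Group borel_group_set.

Lemma borelP g : reflect (g \in Sp /\ forall i, low i (sp_act g (u_ i))) (g \in borel).
Proof. exact: borel_setP. Qed.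

Lemma borel_Sp g : g \in borel -> g \in Sp. Proof. by case/borelP. Qed.

Lemma borel_e g b : g \in borel -> low (lvl b) (sp_act g (e_ b)).
Proof.
move=> Bg; have [Gg Lg] := borelP _ Bg.
case: (split_ordP b) => j ->; first by rewrite lvl_l e_l.
have [_ Lg'] := borelP _ (glVr Bg).
apply/lowP=> c; rewrite leqNgt; apply: contra => H.
rewrite coordE Sp_formV //.
case: (split_ordP c) H => i ->; rewrite ?(lvl_l, lvl_r).
  by have := ltn_ord i; have := ltn_ord j; lia.
rewrite dual_r e_l sp_form_e dual_r => ij.
rewrite (low0 (Lg' i)) ?mulr0 // lvl_l.
by have := ltn_ord i; have := ltn_ord j; lia.
Qed.

Lemma lvl_coord g b c : g \in borel -> (lvl b < lvl c)%N -> sp_act g (e_ b) c 0 = 0.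
Proof. by move=> Bg; apply: low0; apply: borel_e. Qed.

Lemma borel_diag g x b : g \in borel -> low (lvl b) x ->
  sp_act g x b 0 = x b 0 * sp_act g (e_ b) b 0.
Proof.
move=> Bg Lx; rewrite [x in LHS]sum_e sp_act_sum summxE (bigD1 b) //= big1 => [|c ne].
  by rewrite sp_actZ mxE addr0.
rewrite sp_actZ mxE; have [lt|gt] := ltnP (lvl c) (lvl b).
  by rewrite (lvl_coord Bg) ?mulr0.
rewrite (low0 Lx) ?mul0r // ltn_neqAle gt andbT.
by apply: contra ne => /eqP/lvl_inj->.
Qed.

Lemma borel_diag_neq0 g b : g \in borel -> sp_act g (e_ b) b 0 != 0.
Proof.
move=> Bg; have := borel_diag (b := b) (glVr Bg) (borel_e b Bg).
rewrite sp_actK e_E eqxx; apply: contra_eqN => /eqP->.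
by rewrite mul0r oner_eq0.
Qed.

Definition unip_set : {set gT} := [set g in borel | [forall i : 'I_N, sp_act g (u_ i) (lshift N i) 0 == 1]].

Lemma unip_group_set : group_set unip_set.
Proof.
apply/group_setP; split=> [|g h].
  apply/setIdP; split; first exact: group1.
  by apply/forallP=> i; rewrite sp_act1 -e_l e_E eqxx.
case/setIdP=> Bg /forallP Dg /setIdP[Bh /forallP Dh].
apply/setIdP; split; [exact: glM | apply/forallP=> i].
have Lh := borel_e (lshift N i) Bh.
by rewrite sp_actM borel_diag // ?Dh ?mulr1 // (eqP (Dh i)) (eqP (Dg i)) mul1r.
Qed.

Canonical unip := Group unip_group_set.

Lemma unip_borel g : g \in unip -> g \in borel.
Proof. by case/setIdP. Qed.

Lemma unip_diag g b : g \in unip -> sp_act g (e_ b) b 0 = 1.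
Proof.
move=> Ug; have Bg := unip_borel Ug.
case: (split_ordP b) => i ->.
  by case/setIdP: Ug => _ /forallP/(_ i)/eqP.
have /setIdP[_ /forallP/(_ i)/eqP E] := glVr Ug.
rewrite coordE (Sp_formV _ _ (borel_Sp Bg)) dual_r e_l sp_form_e dual_r.
by rewrite mulrA sgn_sq mul1r.
Qed.

(** An involution g of U would be the identity: if it fixes the earlier basis vectors,
then g e_b = e_b + z with z fixed by g, so that e_b = g^2 e_b = e_b + 2 z and z = 0. *)
Lemma odd_unip : (2%:R : K) != 0 -> odd #|unip|.
Proof.
move=> two; apply: contraT => ev.
have [//||g Ug og] := @Cauchy gT 2 unip; first by rewrite dvdn2.
have g2 : (g * g = 1)%g by rewrite -(expg_order g) og.
suff g1 : g = 1%g by rewrite g1 order1 in og.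
have Bg := unip_borel Ug.
apply: sp_act_eqP => b; rewrite sp_act1.
have [k] := ubnP (lvl b); elim: k b => // k IH b; rewrite ltnS => bk.
pose z := sp_act g (e_ b) - e_ b.
have gz : sp_act g z = z.
  rewrite [z]sum_e sp_act_sum; apply: eq_bigr => c _; rewrite sp_actZ.
  have [->|nz] := eqVneq (z c 0) 0; first by rewrite !scale0r.
  rewrite IH // (leq_trans _ bk) // ltn_neqAle; apply/andP; split.
    apply: contra nz => /eqP/lvl_inj->.
    by rewrite /z mxE (unip_diag b Ug) mxE e_E eqxx subrr.
  have: low (lvl b) z.
    by rewrite /z -scaleN1r lowD ?borel_e // lowZ // low_e.
  by move/lowP; apply.
have: sp_act g (sp_act g (e_ b)) = e_ b by rewrite -sp_actM g2 sp_act1.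
have -> : sp_act g (e_ b) = e_ b + z by rewrite /z addrC subrK.
rewrite sp_actD gz -[sp_act g (e_ b)](subrK (e_ b)) -/z => E.
have: z *+ 2 = 0 by rewrite mulr2n -[RHS](subrr (e_ b)) -{1}E; apply/colP=> c; rewrite !mxE; ring.
move/eqP; rewrite -scaler_nat scaler_eq0 (negPf two) /= => /eqP->.
by rewrite addr0.
Qed.

End Borel.


Section Weyl.

Variables (K : finFieldType) (n : nat).
Local Notation N := n.+1.
Local Notation gT := {'GL_(n.+1 + n.+1)[K]}.
Local Notation V := 'cV[K]_(n.+1 + n.+1).
Local Notation Sp := (Sp K n).
Local Notation e_ := (@e_ K n).
Local Notation u_ := (@sp_u K n).
Local Notation borel := (borel K n).
Local Notation unip := (unip K n).
Implicit Types (x y : V) (g h w : gT) (b c : 'I_(N + N)) (i j : 'I_N).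

Lemma e_neq0 b : e_ b != 0.
Proof. by apply/eqP=> /colP/(_ b)/eqP; rewrite e_E eqxx mxE oner_eq0. Qed.

Lemma e_line_inj a a' b c : a *: e_ b = a' *: e_ c -> a != 0 -> b = c.
Proof.
move=> /colP/(_ b)/eqP E; apply: contraNeq => /negPf ne.
by move: E; rewrite !mxE !eqxx ne !andbT /= mulr1 mulr0.
Qed.

(** * Monomial elements, the torus and the Weyl group *)

Definition mono_set : {set gT} :=
  [set g in Sp | [forall b, [exists c, [exists a, sp_act g (e_ b) == a *: e_ c]]]].

Lemma mono_group_set : group_set mono_set.
Proof.
apply/group_setP; split=> [|g h].
  apply/setIdP; split=> //; apply/forallP=> b; apply/existsP; exists b.
  by apply/existsP; exists 1; rewrite sp_act1 scale1r.
case/setIdP=> Gg /forallP Mg /setIdP[Gh /forallP Mh].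
apply/setIdP; split; [exact: glM|apply/forallP=> b].
have /existsP[c /existsP[a /eqP Ec]] := Mh b.
have /existsP[c' /existsP[a' /eqP Ec']] := Mg c.
apply/existsP; exists c'; apply/existsP; exists (a * a').
by rewrite sp_actM Ec sp_actZ Ec' scalerA.
Qed.

Canonical mono := Group mono_group_set.

(** The permutation of the coordinate lines by a monomial element; the default value b
only occurs for elements that are not monomial. *)
Definition wp g b : 'I_(N + N) :=
  odflt b [pick c | [exists a, sp_act g (e_ b) == a *: e_ c]].

Lemma monoP g : g \in Sp -> (forall b, exists c a, sp_act g (e_ b) = a *: e_ c) ->
  g \in mono.
Proof.
move=> Gg E; apply/setIdP; split=> //; apply/forallP=> b.
by have [c [a /eqP Ec]] := E b; apply/existsP; exists c; apply/existsP; exists a.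
Qed.

Lemma mono_Sp g : g \in mono -> g \in Sp. Proof. by case/setIdP. Qed.

Lemma wpP g b : g \in mono ->
  exists2 a, a != 0 & sp_act g (e_ b) = a *: e_ (wp g b).
Proof.
case/setIdP=> Gg /forallP/(_ b)/existsP[c cP]; rewrite /wp; case: pickP => [c' /existsP[a /eqP Ea]|/(_ c)]; last by rewrite cP.
exists a => //=; apply: contraNneq (e_neq0 b) => a0.
by rewrite -(sp_actK g (e_ b)) Ea a0 scale0r sp_act0.
Qed.

Lemma wp_eq g b c a : g \in mono -> sp_act g (e_ b) = a *: e_ c -> wp g b = c.
Proof.
by move=> Mg E; have [a' nz E'] := wpP b Mg; apply: (@e_line_inj a' a); rewrite // -E' E.
Qed.

Lemma wpM g h b : g \in mono -> h \in mono -> wp (g * h) b = wp g (wp h b).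
Proof.
move=> Mg Mh; have [a nz Ea] := wpP b Mh; have [a' nz' Ea'] := wpP (wp h b) Mg.
by apply: (@wp_eq _ _ _ (a * a')); rewrite ?glM // sp_actM Ea sp_actZ Ea' scalerA.
Qed.

Lemma wp1 b : wp 1 b = b.
Proof. by apply: (@wp_eq _ _ _ 1); rewrite ?group1 // sp_act1 scale1r. Qed.

Lemma wp_inj g : g \in mono -> injective (wp g).
Proof.
move=> Mg; apply: (can_inj (g := wp g^-1)) => b.
by rewrite -wpM ?glV // mulVg wp1.
Qed.

Lemma wp_dual g b : g \in mono -> wp g (dual b) = dual (wp g b).
Proof.
move=> Mg; have [a nz Ea] := wpP b Mg; have [a' nz' Ea'] := wpP (dual b) Mg.
have := Sp_form (e_ b) (e_ (dual b)) (mono_Sp Mg).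
rewrite Ea Ea' sp_formZl sp_formZr !sp_form_e !e_E eqxx mulr1.
have [->//|_] := eqVneq (dual (wp g b)) _; rewrite !mulr0 => E.
by have := sgn_sq K b; rewrite -E mul0r => /eqP; rewrite eq_sym oner_eq0.
Qed.

Lemma in_H g : reflect (g \in Sp /\ forall b, exists a, sp_act g (e_ b) = a *: e_ b)
                 (g \in sp_H K n).
Proof.
apply: (iffP setIdP) => [[/stab_Sp Gg /andP[/forallP Hu /forallP Hv]]|[Gg E]].
  split=> // b; case: (split_ordP b) => i ->.
    by have /existsP[a /eqP] := Hu i; exists a.
  by have /existsP[a /eqP] := Hv i; exists a.
split; first (apply/Sp_stabMNP; split=> // i).
- by have [a] := E (lshift N i); rewrite e_l => ->; rewrite spanM_Z ?u_spanM.
- by have [a] := E (rshift N i); rewrite e_r => ->; rewrite spanN_Z ?v_spanN.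
apply/andP; split; apply/forallP=> i; apply/existsP.
  by have [a Ea] := E (lshift N i); exists a; rewrite -Ea.
by have [a Ea] := E (rshift N i); exists a; rewrite -Ea.
Qed.

Lemma H_group_set : group_set (sp_H K n).
Proof.
apply/group_setP; split=> [|g h /in_H[Gg Eg] /in_H[Gh Eh]]; apply/in_H.
  by split=> // b; exists 1; rewrite sp_act1 scale1r.
split=> [|b]; first exact: glM.
have [a Ea] := Eh b; have [a' Ea'] := Eg b.
by exists (a * a'); rewrite sp_actM Ea sp_actZ Ea' scalerA.
Qed.

Canonical sp_H_group := Group H_group_set.

Lemma H_mono g : g \in sp_H K n -> g \in mono.
Proof. by case/in_H=> Gg E; apply: monoP => // b; have [a] := E b; exists b, a. Qed.

Lemma mono_H g : g \in mono -> (forall b, wp g b = b) -> g \in sp_H K n.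
Proof.
move=> Mg E; apply/in_H; split=> [|b]; first exact: mono_Sp.
by have [a _] := wpP b Mg; rewrite E; exists a.
Qed.

Lemma wp_H g b : g \in sp_H K n -> wp g b = b.
Proof.
by move=> Hg; have [_ /(_ b)[a Ea]] := in_H _ Hg; apply: wp_eq Ea; apply: H_mono.
Qed.

Lemma H_borel g : g \in sp_H K n -> g \in borel.
Proof.
case/in_H=> Gg E; apply/borelP; split=> // i.
by have [a] := E (lshift N i); rewrite e_l => ->; apply: lowZ; rewrite -e_l low_e lvl_l.
Qed.

Lemma mono_borel g : g \in mono -> g \in borel -> g \in sp_H K n.
Proof.
move=> Mg Bg; apply: mono_H => // b; have [a nz Ea] := wpP b Mg.
have := borel_diag_neq0 b Bg; rewrite Ea mxE e_E.
by have [<-|] := eqVneq b (wp g b); rewrite // mulr0 eqxx.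
Qed.

Lemma mono_normH : mono \subset 'N(sp_H K n)%g.
Proof.
apply/subsetP=> g Mg; rewrite inE; apply/subsetP=> h'; rewrite mem_conjg.
move=> Hh; have -> : h' = ((h' ^ g^-1) ^ g)%g by rewrite -conjgM mulVg conjg1.
move: (h' ^ g^-1)%g Hh => h Hh; have Mh := H_mono Hh.
apply: mono_H => [|b]; first by rewrite conjgE !glM ?glV.
by rewrite conjgE !wpM ?glM ?glV // (wp_H _ Hh) -wpM ?glV // mulVg wp1.
Qed.

(** The action of a Borel element on M is that of an element of the Levi subgroup. This
gives the factorization of B through Sp_{M,N} and Sp^M. *)
Lemma borel_levi g : g \in borel -> exists2 a, a \in Sp_stabMN K n &
  forall i, sp_act a (u_ i) = sp_act g (u_ i).
Proof.
move=> Bg; pose A : 'M[K]_N := \matrix_(i, j) sp_act g (u_ j) (lshift N i) 0.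
have uA : A \in unitmx.
  rewrite unitmxE -det_tr det_trig.
    rewrite unitfE; apply/prodf_neq0 => i _; rewrite 2!mxE.
    exact: (borel_diag_neq0 (lshift N i) Bg).
  apply/is_trig_mxP=> i j ij; rewrite 2!mxE.
  by apply: (lvl_coord (b := lshift N i) (c := lshift N j)); rewrite ?lvl_l.
have [a Sa Ea] := sp_levi uA; exists a => // i; rewrite Ea.
have /eqP dsu0 := etrans (esym (in_spanM _)) (u_spanM K i).
rewrite dsu0 mulmx0; apply/colP=> c; case: (split_ordP c) => j ->.
  rewrite col_mxEu mxE (bigD1 i) //= big1 ?addr0 => [|k ne].
    by rewrite !mxE !eqxx mulr1.
  by rewrite !mxE (inj_eq (@lshift_inj _ _)) (negPf ne) mulr0.
rewrite col_mxEd [RHS](lvl_coord (b := lshift N i) (c := rshift N j)) ?mxE //.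
by rewrite lvl_l lvl_r; have := ltn_ord i; have := ltn_ord j; lia.
Qed.

Lemma borel_siegel g : g \in borel -> exists a s,
  [/\ a \in Sp_stabMN K n, s \in Sp_fixM K n & g = (a * s)%g].
Proof.
move=> Bg; have [a Sa Ea] := borel_levi Bg; exists a, (a^-1 * g)%g.
split; rewrite ?mulKVg //; apply/Sp_fixMP; split=> [|i].
  by rewrite glM ?glV ?(stab_Sp Sa) ?(borel_Sp Bg).
by rewrite sp_actM -Ea sp_actK.
Qed.

Lemma borel_torus g : g \in borel -> exists2 h, h \in sp_H K n &
  (g * h^-1)%g \in unip.
Proof.
move=> Bg; pose d : 'rV[K]_N := \row_i sp_act g (u_ i) (lshift N i) 0.
have d0 i : d 0 i != 0 by rewrite mxE; exact: (borel_diag_neq0 (lshift N i) Bg).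
have uD : diag_mx d \in unitmx.
  by rewrite unitmxE det_diag unitfE; apply/prodf_neq0 => i _.
have [h Sh Eh] := sp_levi uD.
have hu i : sp_act h (u_ i) = d 0 i *: u_ i.
  have /eqP dsu0 := etrans (esym (in_spanM _)) (u_spanM K i).
  rewrite Eh dsu0 mulmx0; apply/colP=> c; case: (split_ordP c) => j ->.
    rewrite col_mxEu mul_diag_mx !mxE !(inj_eq (@lshift_inj _ _)) !andbT.
    by case: (eqVneq j i) => [->|_]; rewrite ?mulr1 ?mulr0.
  by rewrite col_mxEd !mxE eq_rlshift mulr0.
have Hh : h \in sp_H K n.
  apply/in_H; split=> [|b]; first exact: (stab_Sp Sh).
  case: (split_ordP b) => i ->; first by exists (d 0 i); rewrite hu.
  exists (d 0 i)^-1; apply: sp_form_inj => c; rewrite sp_formZr.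
  have Gh := stab_Sp Sh.
  case: (split_ordP c) => j ->; rewrite ?e_r; last first.
    by rewrite !sp_form_NN ?mulr0 ?stab_N ?v_spanN.
  apply: (mulfI (d0 j)); rewrite -[LHS]sp_formZl e_l -hu.
  rewrite Sp_form // -e_l sp_form_e dual_l -e_r e_E sgn_l mul1r (inj_eq (@rshift_inj _ _)).
  by have [->|_] := eqVneq j i; rewrite ?mulr0 // mulrA divff ?mul1r.
exists h => //; apply/setIdP; split; first by rewrite glM ?glV // H_borel.
apply/forallP=> i; rewrite sp_actM.
have -> : sp_act h^-1 (u_ i) = (d 0 i)^-1 *: u_ i.
  by apply: (@sp_act_inj _ _ h); rewrite sp_actVK sp_actZ hu scalerA mulVf ?scale1r.
by rewrite sp_actZ mxE; apply/eqP; have := d0 i; rewrite mxE => ?; rewrite mulVf.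
Qed.

Lemma sp_B_borel : sp_B K n = borel.
Proof.
apply/setP=> g; apply/mulsgP/idP => [[u h /mulsgP[t s Tt Ss ->] Hh ->]|Bg].
  rewrite glM ?(H_borel Hh) // glM //; apply/borelP.
    split=> [|i]; first by case/setIdP: Tt => /stab_Sp.
    case/setIdP: Tt => St /'forall_forallP T; apply/lowP=> c.
    case: (split_ordP c) => j ->; rewrite ?lvl_l.
      rewrite leqNgt; apply: contra => ij.
      have := implyP (T j i) (ltnW ij) => /eqP->.
      by rewrite -val_eqE gtn_eqF.
    by rewrite (spanM_coord j) ?eqxx // stab_M ?u_spanM.
  case/Sp_fixMP: Ss => Gs Es; split=> // i.
  by rewrite Es -e_l low_e lvl_l.
have [h Hh Uu] := borel_torus Bg; exists (g * h^-1)%g h; rewrite ?mulgKV //.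
move: (g * h^-1)%g Uu => u Uu; have Bu := unip_borel Uu.
have [a Sa Ea] := borel_levi Bu; apply/mulsgP; exists a (a^-1 * u)%g; rewrite ?mulKVg //.
  apply/setIdP; split=> //; apply/'forall_forallP=> i j; apply/implyP=> ji.
  rewrite Ea; have [->|ne] := eqVneq i j; first by rewrite (unip_diag (lshift N j)).
  rewrite (@lvl_coord _ _ _ (lshift N j) (lshift N i)) // !lvl_l.
  by rewrite ltn_neqAle ji andbT eq_sym.
apply/Sp_fixMP; split=> [|i].
  by rewrite glM ?glV ?(stab_Sp Sa) ?(borel_Sp Bu).
by rewrite sp_actM -Ea sp_actK.
Qed.

End Weyl.


Section Bruhat.

Variables (K : finFieldType) (n : nat).
Local Notation N := n.+1.
Local Notation gT := {'GL_(n.+1 + n.+1)[K]}.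
Local Notation V := 'cV[K]_(n.+1 + n.+1).
Local Notation Sp := (Sp K n).
Local Notation e_ := (@e_ K n).
Local Notation u_ := (@sp_u K n).
Local Notation v_ := (@sp_v K n).
Local Notation borel := (borel K n).
Local Notation mono := (mono K n).
Local Notation W2 := (W2 K n).
Implicit Types (x y : V) (g h w : gT) (b c : 'I_(N + N)) (i j : 'I_N).

Lemma swapP g i j : reflect (g \in Sp /\ forall k,
    sp_act g (u_ k) = u_ (tperm i j k) /\ sp_act g (v_ k) = v_ (tperm i j k))
  (g \in swap_elt K i j).
Proof.
apply: (iffP setIdP) => -[Gg E]; split=> //.
  by move=> k; move/forallP: E => /(_ k) /andP[/eqP-> /eqP->].
by apply/forallP=> k; have [-> ->] := E k; rewrite !eqxx.
Qed.

Lemma c_eltP g j : reflect [/\ g \in Sp, sp_act g (u_ j) = v_ j, sp_act g (v_ j) = - u_ j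
    & forall k, k != j -> sp_act g (u_ k) = u_ k /\ sp_act g (v_ k) = v_ k]
  (g \in c_elt K j).
Proof.
apply: (iffP setIdP) => [[Gg /and3P[/eqP Eu /eqP Ev /forallP E]]|[Gg Eu Ev E]].
  by split=> // k /(implyP (E k)) /andP[/eqP-> /eqP->].
split=> //; rewrite Eu Ev !eqxx; apply/forallP=> k; apply/implyP=> /E[-> ->].
by rewrite !eqxx.
Qed.

Lemma sp_act_uv_inj g h : (forall i, sp_act g (u_ i) = sp_act h (u_ i)) ->
  (forall i, sp_act g (v_ i) = sp_act h (v_ i)) -> g = h.
Proof.
by move=> Eu Ev; apply: sp_act_eqP => b; case: (split_ordP b) => i ->; rewrite ?e_l ?e_r.
Qed.

Lemma swap_conj g h i j k l : g \in swap_elt K i j -> h \in swap_elt K k l ->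
  (h * g * h^-1)%g \in swap_elt K (tperm k l i) (tperm k l j).
Proof.
case/swapP=> Gg Eg /swapP[Gh Eh]; apply/swapP.
split=> [|m]; first by rewrite !glM ?glV.
have EV u : (forall m, sp_act h (u m) = u (tperm k l m)) ->
    forall m, sp_act h^-1 (u m) = u (tperm k l m) :> V.
  move=> E m'; apply: (@sp_act_inj _ _ h); rewrite sp_actVK E tpermK //.
have E : tperm k l (tperm i j (tperm k l m)) = tperm (tperm k l i) (tperm k l j) m.
  by rewrite -tpermJ conjgE !permM tpermV.
rewrite !sp_actM !EV => [|m'|m']; try by case: (Eh m').
by have [-> ->] := Eg (tperm k l m); have [-> ->] := Eh (tperm i j (tperm k l m)); rewrite E.
Qed.

Lemma swap_uniq g h i j : g \in swap_elt K i j -> h \in swap_elt K i j -> g = h.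
Proof.
case/swapP=> _ Eg /swapP[_ Eh]; apply: sp_act_uv_inj => k.
  by case: (Eg k) => -> _; case: (Eh k) => ->.
by case: (Eg k) => _ ->; case: (Eh k) => _ ->.
Qed.

Lemma swap_W2 g i j : g \in swap_elt K i j -> g \in W2.
Proof.
wlog ij : i j / (i <= j)%N => [th|].
  have [/th//|/ltnW/th {}th] := leqP i j.
  by rewrite /swap_elt; rewrite tpermC; exact: th.
move: ij; rewrite leq_eqVlt => /predU1P[/val_inj->|].
  case/swapP=> Gg E; have -> : g = 1%g.
    by apply: sp_act_uv_inj => k; have [] := E k; rewrite tperm1 perm1 sp_act1 => Eu Ev; rewrite ?Eu ?Ev.
  exact: group1.
have [m] := ubnP (val j); elim: m j g => // m IH j g; rewrite ltnS => jm ij Eg.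
have [im|im] := eqVneq (j : nat) i.+1.
  apply: mem_gen; rewrite inE; apply/orP; left.
  by apply/bigcupP; exists i => //; apply/bigcupP; exists j; rewrite // im.
have mN : (j.-1 < N)%N by have := ltn_ord j; lia.
pose j' := Ordinal mN.
have jj' : j = j'.+1 :> nat by rewrite /= prednK //; lia.
have ij' : (i < j')%N by rewrite /=; lia.
have [r Er] := set0Pn _ (swap_elt_neq0 K j' j).
have [s Es] := set0Pn _ (swap_elt_neq0 K i j').
have Wr : r \in W2.
  apply: mem_gen; rewrite inE; apply/orP; left.
  by apply/bigcupP; exists j' => //; apply/bigcupP; exists j; rewrite // -jj'.
have Ws : s \in W2 by apply: (IH j') => //; exact: leq_trans (eq_leq (esym jj')) jm.
have := swap_conj Es Er; rewrite tpermL tpermD => [||]; first last.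
- by rewrite -val_eqE /= gtn_eqF.
- by rewrite -val_eqE /= gtn_eqF.
by move/(swap_uniq Eg)->; rewrite !glM ?glV.
Qed.

Lemma c_W2 g j : g \in c_elt K j -> g \in W2.
Proof.
move=> Cg; apply: mem_gen; rewrite inE; apply/orP; right.
by apply/bigcupP; exists j.
Qed.

Lemma swap_mono g i j : g \in swap_elt K i j -> g \in mono.
Proof.
case/swapP=> Gg E; apply: monoP => // b.
case: (split_ordP b) => k ->; have [Eu Ev] := E k.
  by exists (lshift N (tperm i j k)), 1; rewrite scale1r e_l Eu.
by exists (rshift N (tperm i j k)), 1; rewrite scale1r e_r Ev.
Qed.

Lemma wp_swap_l g i j k : g \in swap_elt K i j ->
  wp g (lshift N k) = lshift N (tperm i j k).
Proof.
move=> Sg; have /swapP[_ /(_ k)[E _]] := Sg.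
by apply: (@wp_eq _ _ _ _ _ 1); rewrite ?(swap_mono Sg) // scale1r e_l E.
Qed.

Lemma wp_swap_r g i j k : g \in swap_elt K i j ->
  wp g (rshift N k) = rshift N (tperm i j k).
Proof.
by move=> Sg; rewrite -dual_l wp_dual ?(swap_mono Sg) // (wp_swap_l _ Sg) dual_l.
Qed.

Lemma c_mono g j : g \in c_elt K j -> g \in mono.
Proof.
case/c_eltP=> Gg Eu Ev E; apply: monoP => // b.
case: (split_ordP b) => k ->; have [->|/E[Eu' Ev']] := eqVneq k j.
- by exists (rshift N j), 1; rewrite scale1r.
- by exists (lshift N k), 1; rewrite scale1r.
- by exists (lshift N j), (-1); rewrite scaleN1r.
by exists (rshift N k), 1; rewrite scale1r.
Qed.

Lemma wp_c g j : g \in c_elt K j -> wp g (lshift N j) = rshift N j.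
Proof.
move=> Cg; have /c_eltP[_ E _ _] := Cg.
by apply: (@wp_eq _ _ _ _ _ 1); rewrite ?(c_mono Cg) // scale1r e_l E.
Qed.

Lemma wp_c_id g j k : g \in c_elt K j -> k != j -> wp g (lshift N k) = lshift N k.
Proof.
move=> Cg /[dup] kj; have /c_eltP[_ _ _ E] := Cg; case/E=> Ek _.
by apply: (@wp_eq _ _ _ _ _ 1); rewrite ?(c_mono Cg) // scale1r e_l Ek.
Qed.

Lemma W2_mono : W2 \subset mono.
Proof.
rewrite gen_subG; apply/subsetP=> g; rewrite inE => /orP[|] /bigcupP[i _].
  by case/bigcupP=> j _; apply: swap_mono.
exact: c_mono.
Qed.

Lemma W2_in_mono w : w \in W2 -> w \in mono.
Proof. by move/(subsetP W2_mono). Qed.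

Lemma W2_Sp w : w \in W2 -> w \in Sp.
Proof. by move/W2_in_mono/mono_Sp. Qed.

(** The number i of the hyperbolic plane of u_i and v_i that contains the basis vector. *)
Definition base b : 'I_N := match split b with inl i => i | inr i => i end.

Lemma base_dual b : base (dual b) = base b.
Proof. by rewrite /dual /base; case: (split b) => i; rewrite ?split_lshift ?split_rshift. Qed.

Lemma base_eq b c : base b = base c -> c = b \/ c = dual b.
Proof.
rewrite /base; case: (split_ordP b) => i ->; case: (split_ordP c) => j ->;
  rewrite ?split_lshift ?split_rshift ?dual_l ?dual_r => ->; by [left|right].
Qed.

(** In the elimination below, the coordinate lines found so far must stay in place while
the next one is moved to its final position. *)
Lemma W2_transport b c : exists w, [/\ w \in W2, wp w b = c &
  forall d, base d != base b -> base d != base c -> wp w d = d].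
Proof.
have flip : forall b, exists w, [/\ w \in W2, wp w b = dual b &
    forall d, base d != base b -> wp w d = d].
  move=> {b}b; have [g Cg] := set0Pn _ (c_elt_neq0 K (base b)).
  have Mg := c_mono Cg.
  have fixd d : base d != base b -> wp g d = d.
    case: (split_ordP d) => k ->; rewrite {1}/base ?split_lshift ?split_rshift => ne.
      exact: wp_c_id Cg ne.
    by rewrite -dual_l wp_dual // (wp_c_id Cg ne).
  case: (split_ordP b) Cg fixd => k ->; rewrite {1}/base ?split_lshift ?split_rshift => Cg fixd.
    by exists g; rewrite (c_W2 Cg) dual_l (wp_c Cg).
  by exists g; rewrite (c_W2 Cg) -dual_l wp_dual // (wp_c Cg) !dual_l.
have [g Sg] := set0Pn _ (swap_elt_neq0 K (base b) (base c)).
have Mg := swap_mono Sg.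
have gb : wp g b = c \/ wp g b = dual c.
  suff: base (wp g b) = base c by move/esym/base_eq.
  move: Sg; case: (split_ordP b) => k ->; rewrite {1}/base ?split_lshift ?split_rshift => Sg.
    by rewrite (wp_swap_l _ Sg) tpermL /base split_lshift.
  by rewrite (wp_swap_r _ Sg) tpermL /base split_rshift.
have gd d : base d != base b -> base d != base c -> wp g d = d.
  move: Sg; case: (split_ordP d) => k ->; rewrite /(base (lshift _ _)) /(base (rshift _ _)) ?split_lshift ?split_rshift => Sg n1 n2.
    by rewrite (wp_swap_l _ Sg) tpermD // eq_sym.
  by rewrite (wp_swap_r _ Sg) tpermD // eq_sym.
case: gb => gb; first by exists g; rewrite (swap_W2 Sg).
have [w [Ww wc wd]] := flip (dual c); rewrite base_dual dualK in wc wd.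
exists (w * g)%g; rewrite glM ?(swap_W2 Sg) //; split=> // [|d n1 n2].
  by rewrite wpM ?W2_in_mono ?(swap_W2 Sg) // gb.
by rewrite wpM ?W2_in_mono ?(swap_W2 Sg) // gd // wd.
Qed.

(** * Bruhat decomposition *)

(** If the pivot b is the last nonzero coordinate of y, the elementary operation sending
e_b to y is in the Borel subgroup. *)
Lemma elim_borel b y : y b 0 = 1 -> low (lvl b) y ->
  exists t, [/\ t \in borel, sp_act t (e_ b) = y &
    forall c, c != b -> sp_act t (e_ c) =
      e_ c + (sgn K b * sp_form (e_ c) (y - e_ b)) *: e_ (dual b)].
Proof.
move=> yb Ly; have [t [Gt tb tc]] := sp_elim yb; exists t; split=> //.
apply/borelP; split=> // i; rewrite -e_l.
have [Eb|ne] := eqVneq (lshift N i) b; first by rewrite Eb tb -(lvl_l i) Eb.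
rewrite tc // -{1}(lvl_l i) lowD ?low_e //; have [->|nz] := eqVneq (sp_form (e_ (lshift N i)) (y - e_ b)) 0.
  by rewrite mulr0 scale0r low_zero.
apply: lowZ; rewrite low_e; move: nz; rewrite sp_form_e mulf_eq0 negb_or => /andP[_].
have Lz : low (lvl b) (y - e_ b) by rewrite -scaleN1r lowD // lowZ // low_e.
move/(lowP _ _ Lz); have := lvl_dual b; have := lvl_dual (lshift N i); lia.
Qed.

(** Gaussian elimination. Suppose that u_0, ..., u_(k-1) go to coordinate lines. A
column operation (t1) clears the coordinates of the image of u_k at these lines;
orthogonality then clears those at their duals. So the pivot d, the last nonzero
coordinate left, is in a new hyperbolic plane, and a row operation (t2) with this pivot
reduces the image to the coordinate line d without disturbing the earlier ones. *)
Lemma bruhat_step (k : nat) g : (k <= N)%N -> g \in Sp ->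
  exists (b b' w : gT), [/\ b \in borel, b' \in borel, w \in W2 &
    forall j, (j < k)%N -> exists2 a, a != 0 &
      sp_act (b * g * b')%g (u_ j) = a *: e_ (wp w (lshift N j))].
Proof.
move=> kN Gg; elim: k kN => [|k IH] kN.
  by exists 1%g, 1%g, 1%g; split; rewrite ?group1.
have [b [b' [w [Bb Bb' Ww E]]]] := IH (ltnW kN).
pose i := Ordinal kN; set h := (b * g * b')%g in E.
have Mw := W2_in_mono Ww.
have Gh : h \in Sp by rewrite /h !glM ?(borel_Sp Bb) ?(borel_Sp Bb').
pose p j := wp w (lshift N j).
have p_inj : injective p by move=> j l /(wp_inj Mw)/(@lshift_inj N N).
have aE j : (j < k)%N -> sp_act h (u_ j) = sp_act h (u_ j) (p j) 0 *: e_ (p j)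
    /\ sp_act h (u_ j) (p j) 0 != 0.
  by case/E=> a nz Ea; rewrite /p Ea mxE e_E eqxx mulr1.
pose a j := sp_act h (u_ j) (p j) 0.
(* z is u_i corrected so that its image has coordinate 0 at the lines already reached. *)
pose r j := sp_act h (u_ i) (p j) 0 / a j.
pose z : V := u_ i - \sum_(j < N | (j < k)%N) r j *: u_ j.
have zM : z \in spanM K n.
  rewrite spanM_D ?u_spanM // spanM_N //.
  by elim/big_ind: _ => [|? ?|j _]; [rewrite in_spanM raddf0|exact: spanM_D|rewrite spanM_Z ?u_spanM].
have zi : z (lshift N i) 0 = 1.
  rewrite !mxE !eqxx summxE big1 ?subr0 // => j jk.
  by rewrite !mxE (inj_eq (@lshift_inj _ _)) -val_eqE /= gtn_eqF ?mulr0.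
have Lz : low (lvl (lshift N i)) z.
  rewrite /z -scaleN1r lowD -?e_l ?low_e //; apply: lowZ.
  elim/big_ind: _ => [|? ?|j jk]; [exact: low_zero|exact: lowD|].
  by apply: lowZ; rewrite -e_l low_e !lvl_l ltnW.
have [t1 [Bt1 t1i t1c]] := elim_borel zi Lz.
have t1u j : j != i -> sp_act t1 (u_ j) = u_ j.
  move=> ne; rewrite -e_l t1c ?(inj_eq (@lshift_inj _ _)) //.
  by rewrite sp_form_MM ?mulr0 ?scale0r ?addr0 ?u_spanM // spanM_D // spanM_N ?u_spanM.
pose y := sp_act h z.
have yp j : (j < k)%N -> y (p j) 0 = 0.
  move=> jk; rewrite /y sp_actD sp_actN sp_act_sum mxE [X in _ + X]mxE summxE (bigD1 j) //= big1.
    by rewrite addr0 sp_actZ [X in _ - X]mxE /r divfK ?subrr //; case: (aE j jk).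
  move=> l /andP[lk lj]; have [-> _] := aE l lk.
  by rewrite sp_actZ mxE (proj1 (aE l lk)) mxE e_E (inj_eq p_inj) eq_sym (negPf lj) !mulr0.
(* The image y of z is orthogonal to the images of the u_j. *)
have ydp j : (j < k)%N -> y (dual (p j)) 0 = 0.
  move=> jk; have [Ej nz] := aE j jk.
  have: sp_form (sp_act h (u_ j)) y = 0 by rewrite Sp_form // sp_form_MM ?u_spanM.
  rewrite Ej sp_formZl sp_form_e => /eqP; rewrite !mulf_eq0 (negPf nz) /=.
  by case/orP=> /eqP // s0; have := sgn_sq K (p j); rewrite s0 mul0r => /eqP; rewrite eq_sym oner_eq0.
have y_nz : y != 0.
  apply: contraTneq (oner_neq0 K) => y0; rewrite -zi.
  by rewrite -[z](sp_actK h) -/y y0 sp_act0 mxE eqxx.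
have [c0 yc0] : exists c, y c 0 != 0.
  apply/existsP; apply: contraNT y_nz => /existsPn y0; apply/eqP/colP=> c.
  by rewrite [RHS]mxE; apply/eqP; move: (y0 c); rewrite negbK.
pose d := [arg max_(c > c0 | y c 0 != 0) lvl c].
have [yd dmax] : y d 0 != 0 /\ forall c, y c 0 != 0 -> (lvl c <= lvl d)%N.
  by rewrite /d; case: arg_maxnP.
pose y' := (y d 0)^-1 *: y.
have y'd : y' d 0 = 1 by rewrite mxE mulVf.
have Ly' : low (lvl d) y' by apply/lowZ/lowP.
have [t2 [Bt2 t2d t2c]] := elim_borel y'd Ly'.
have base_ne j : (j < k)%N -> base (p j) != base d.
  move=> jk; apply/eqP=> /base_eq[dE|dE]; first by rewrite dE yp ?eqxx in yd.
  by rewrite dE ydp ?eqxx in yd.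
have t2p j : (j < k)%N -> sp_act t2 (e_ (p j)) = e_ (p j).
  move=> jk; rewrite t2c; last by apply: contraNneq (base_ne j jk) => ->.
  suff -> : sp_form (e_ (p j)) (y' - e_ d) = 0 by rewrite mulr0 scale0r addr0.
  rewrite sp_formDr sp_formNr sp_formZr !sp_form_e ydp // mulr0 mulr0 e_E.
  have [dE|_] := eqVneq; last by rewrite mulr0 subr0.
  by move: (base_ne j jk); rewrite -dE base_dual eqxx.
have [w2 [Ww2 w2i w2d]] := W2_transport (p i) d.
exists (t2^-1 * b)%g, (b' * t1)%g, (w2 * w)%g.
split; rewrite ?glM ?glV // => j; rewrite ltnS leq_eqVlt.
have -> : (t2^-1 * b * g * (b' * t1) = t2^-1 * h * t1)%g by rewrite /h !mulgA.
rewrite sp_actM (wpM _ (W2_in_mono Ww2) Mw) => /predU1P[jk|jk].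
  have {jk} -> : j = i by apply: val_inj.
  rewrite -e_l t1i sp_actM -/y -/(p i) w2i; exists (y d 0) => //.
  by apply: (@sp_act_inj _ _ t2); rewrite sp_actVK sp_actZ t2d scalerA divff ?scale1r.
have ji : j != i by rewrite -val_eqE /= ltn_eqF.
have [Ej nz] := aE j jk.
rewrite t1u // sp_actM Ej sp_actZ -/(p j) w2d ?base_ne //; last first.
  apply/eqP=> /base_eq[/p_inj/eqP|]; first by rewrite eq_sym (negPf ji).
  rewrite /p -wp_dual // => /(wp_inj Mw); rewrite dual_l => /eqP.
  by rewrite eq_lrshift.
by exists (a j) => //; congr (_ *: _); rewrite -{1}(t2p j jk) sp_actK.
Qed.

(** Once all the u_j go to coordinate lines, what is left is in the Borel subgroup,
which is defined by its action on the u_j alone. *)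
Lemma bruhat g : g \in Sp ->
  exists (b w b' : gT), [/\ b \in borel, w \in W2, b' \in borel & g = (b * w * b')%g].
Proof.
move=> Gg; have [b [b' [w [Bb Bb' Ww E]]]] := bruhat_step (leqnn N) Gg.
exists b^-1%g, w, (w^-1 * (b * g * b') * b'^-1)%g.
split; rewrite ?glV //; last by rewrite -!mulgA mulgV mulg1 mulKVg mulKg.
rewrite glM ?glV //; apply/borelP; split=> [|i].
  by rewrite !glM ?glV ?(W2_Sp Ww) ?(borel_Sp Bb) ?(borel_Sp Bb').
have [a _ Ea] := E i (ltn_ord i); have [a' nz Ea'] := wpP (lshift N i) (W2_in_mono Ww).
rewrite sp_actM Ea sp_actZ.
have -> : sp_act w^-1 (e_ (wp w (lshift N i))) = a'^-1 *: u_ i.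
  by apply: (@sp_act_inj _ _ w); rewrite sp_actVK sp_actZ -e_l Ea' scalerA mulVf ?scale1r.
by do 2!apply: lowZ; rewrite -e_l low_e lvl_l.
Qed.

End Bruhat.

(** * Panels of the flag complex *)

Section Panels.

Variables (K : finFieldType) (n : nat).
Local Notation N := n.+1.
Local Notation gT := {'GL_(n.+1 + n.+1)[K]}.
Local Notation V := 'cV[K]_(n.+1 + n.+1).
Local Notation Sp := (Sp K n).
Local Notation e_ := (@e_ K n).
Local Notation u_ := (@sp_u K n).
Local Notation borel := (borel K n).
Local Notation W2 := (W2 K n).
Implicit Types (x y : V) (g h w p : gT) (c : 'I_(N + N)) (i j : 'I_N).

(** The index following that of u_i in the order of the flag. *)
Definition nxt i : 'I_(N + N) :=
  if (i.+1 < N)%N then lshift N (inord i.+1) else rshift N i.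

Lemma lvl_nxt i : lvl (nxt i) = i.+1.
Proof.
rewrite /nxt; case: ifP => iN; first by rewrite lvl_l inordK.
by rewrite lvl_r; have := ltn_ord i; lia.
Qed.

Lemma nxt_neq i : nxt i != lshift N i.
Proof. by apply/eqP=> /(congr1 (@lvl n)); rewrite lvl_nxt lvl_l; lia. Qed.

(** The member of dimension k of the flag; unlike [low], it includes the zero space,
which is needed for the panels of the first type. *)
Definition below (k : nat) x := forall c, x c 0 != 0 -> (lvl c < k)%N.

Lemma low_below k x : low k x <-> below k.+1 x.
Proof. by split=> [/lowP|?] //; apply/lowP. Qed.

Lemma below_le k l x : below k x -> (k <= l)%N -> below l x.
Proof. by move=> b kl c /b lk; apply: leq_trans lk kl. Qed.

Lemma below0 k x c : below k x -> (k <= lvl c)%N -> x c 0 = 0.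
Proof. by move=> b kc; apply/eqP; apply: contraTT kc => /b; rewrite -ltnNge. Qed.

Lemma belowD k x y : below k x -> below k y -> below k (x + y).
Proof.
move=> bx bY c; apply: contraNT; rewrite -leqNgt => kc.
by rewrite mxE (below0 bx kc) (below0 bY kc) addr0.
Qed.

Lemma belowZ k a x : below k x -> below k (a *: x).
Proof.
by move=> bx c; apply: contraNT; rewrite -leqNgt => kc; rewrite mxE (below0 bx kc) mulr0.
Qed.

Lemma below_zero k : below k 0. Proof. by move=> c; rewrite mxE eqxx. Qed.

Lemma below_act k g x : (forall c, (lvl c < k)%N -> below k (sp_act g (e_ c))) ->
  below k x -> below k (sp_act g x).
Proof.
move=> L Lx; rewrite [x]sum_e sp_act_sum.
elim/big_ind: _ => [|y z|c _]; [exact: below_zero|exact: belowD|].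
rewrite sp_actZ; have [->|nz] := eqVneq (x c 0) 0; first by rewrite scale0r; apply: below_zero.
exact/belowZ/L/Lx.
Qed.

(** A minimal parabolic of type i may send u_i one step further than the Borel subgroup
does. *)
Definition panel_bound i j : nat := if j == i then i.+1 else j.

Definition moves_only i g : bool :=
  [forall j : 'I_N, low (panel_bound i j) (sp_act g (u_ j))].

(** The minimal parabolic subgroup of type i, which moves only the (i+1)-dimensional
member of the standard flag. *)
Definition parab_set i : {set gT} :=
  [set g in Sp | moves_only i g && moves_only i g^-1].

Lemma moves_only_below i k g x : g \in Sp -> moves_only i g -> moves_only i g^-1 ->
  k != i.+1 -> (k <= N.+1)%N -> (i.+1 < N -> k <= N)%N ->
  below k x -> below k (sp_act g x).
Proof.
move=> Gg /forallP Pg /forallP Pg' ki kN klast; apply: below_act => c ck.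
case: (split_ordP c) ck => j ->; rewrite ?lvl_l ?lvl_r => jk.
  rewrite e_l; apply: below_le (_ : (panel_bound i j).+1 <= k)%N.
    by apply/low_below.
  by rewrite /panel_bound; case: (eqVneq j i) => [ji|//]; move: jk ki; rewrite ji; lia.
have [jn iN kN1] : [/\ j = N.-1 :> nat, i = N.-1 :> nat & k = N.+1].
  by have := ltn_ord j; have := ltn_ord i; split; lia.
have {jn} ji : j = i by apply: val_inj; rewrite /= jn.
move=> d; rewrite kN1; apply: contraNT; rewrite -leqNgt => dN.
rewrite coordE Sp_formV //; case: (split_ordP d) dN => m ->; rewrite ?lvl_l ?lvl_r => mN.
  by have := ltn_ord m; lia.
have mi : m != i by apply/eqP=> E; move: mN; rewrite E; have := ltn_ord i; lia.
have /lowP Lm := Pg' m; rewrite dual_r e_l sp_form_e dual_r.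
have -> : sp_act g^-1 (u_ m) (lshift N j) 0 = 0; last by rewrite !mulr0.
apply/eqP; apply: contraT => /Lm; rewrite /panel_bound (negPf mi) lvl_l ji iN => im.
by case/eqP: mi; apply: val_inj; rewrite /= iN; have := ltn_ord m; lia.
Qed.

Lemma parabP i g : reflect [/\ g \in Sp, moves_only i g & moves_only i g^-1]
  (g \in parab_set i).
Proof. by apply: (iffP setIdP) => [[? /andP[]]|[? -> ->]]. Qed.

Lemma panel_boundP i j : [/\ (panel_bound i j).+1 != i.+1,
  ((panel_bound i j).+1 <= N.+1)%N & (i.+1 < N -> (panel_bound i j).+1 <= N)%N].
Proof.
rewrite /panel_bound; have := ltn_ord i; have := ltn_ord j.
case: (eqVneq j i) => [->|/eqP ne]; first by split; try apply/eqP; lia.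
have ne' : (j : nat) <> i by move=> E; apply: ne; apply: val_inj.
by split; try apply/eqP; lia.
Qed.

Lemma moves_onlyM i g h : g \in parab_set i -> moves_only i h -> moves_only i (g * h).
Proof.
case/parabP=> Gg Pg Pg' /forallP Ph; apply/forallP=> j; have [b1 b2 b3] := panel_boundP i j.
by apply/low_below; rewrite sp_actM; apply: (moves_only_below (i := i)) => //; apply/low_below.
Qed.

Lemma parab_group_set i : group_set (parab_set i).
Proof.
apply/group_setP; split=> [|g h Pg Ph].
  have P1 : moves_only i 1.
    apply/forallP=> j; rewrite sp_act1 -e_l low_e lvl_l /panel_bound.
    by case: eqP => // ->.
  by apply/parabP; rewrite invg1; split.
have [Gg Mg Mg'] := parabP _ _ Pg; have [Gh Mh Mh'] := parabP _ _ Ph.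
apply/parabP; split; [exact: glM|exact: moves_onlyM|].
by rewrite invMg; apply: moves_onlyM => //; apply/parabP; split; rewrite ?glV ?invgK.
Qed.

Canonical parab i := Group (parab_group_set i).

Lemma parab_Sp i g : g \in parab i -> g \in Sp. Proof. by case/parabP. Qed.

Lemma parab_below i g x : g \in parab i -> below i x -> below i (sp_act g x).
Proof.
case/parabP=> Gg Mg Mg'; have := ltn_ord i => lti.
by apply: (moves_only_below (i := i)) => //; try apply/eqP; lia.
Qed.

Lemma borel_parab i g : g \in borel -> g \in parab i.
Proof.
have B h : h \in borel -> moves_only i h.
  move=> /borelP[_ Lh]; apply/forallP=> j; apply: low_le (Lh j) _.
  by rewrite /panel_bound; case: eqP => // ->.
by move=> Bg; apply/parabP; rewrite (borel_Sp Bg) !B ?glV.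
Qed.

Lemma parab_borel i g : g \in parab i -> low i (sp_act g (u_ i)) -> g \in borel.
Proof.
case/parabP=> Gg /forallP Mg _ Li; apply/borelP; split=> // j.
by have := Mg j; rewrite /panel_bound; case: eqP => [->|].
Qed.

(** A representative of the simple reflection of type i, which exchanges the lines of
u_i and its successor. The two cases, i < n and i = n in the numbering from 0, come from
the elements w_i and c_n. *)
Definition is_refl i r := [/\ r \in W2, sp_act r (u_ i) = e_ (nxt i),
  wp r (nxt i) = lshift N i &
  forall j, j != i -> lshift N j != nxt i -> wp r (lshift N j) = lshift N j].

(** An element of parameter a of the root subgroup of type i. The long root moves only
the successor v_n of u_n; a short root also moves the dual of u_i, by a multiple left
unspecified. *)
Definition is_root i (a : K) t := [/\ t \in borel,
  sp_act t (e_ (nxt i)) = e_ (nxt i) + a *: u_ i &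
  forall c, c != nxt i -> exists2 k : K, sp_act t (e_ c) = e_ c + k *: e_ (dual (nxt i)) &
    c != dual (lshift N i) -> k = 0].

Lemma swap_refl i j r : j = i.+1 :> nat -> r \in swap_elt K i j -> is_refl i r.
Proof.
move=> ji Sr; have iN : (i.+1 < N)%N by rewrite -ji ltn_ord.
have En : nxt i = lshift N j by rewrite /nxt iN; congr lshift; apply: val_inj; rewrite /= inordK.
have /swapP[_ E] := Sr; split; rewrite ?(swap_W2 Sr) // ?En.
- by have [-> _] := E i; rewrite tpermL.
- by rewrite (wp_swap_l _ Sr) tpermR.
move=> k ki; rewrite (inj_eq (@lshift_inj _ _)) => kj.
by rewrite (wp_swap_l _ Sr) tpermD // eq_sym.
Qed.

Lemma c_refl i r : i = n :> nat -> r \in c_elt K i -> is_refl i r.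
Proof.
move=> iN Cr; have En : nxt i = rshift N i by rewrite /nxt iN ltnn.
have /c_eltP[_ E _ _] := Cr; split; rewrite ?(c_W2 Cr) // ?En //.
  by rewrite -dual_l wp_dual ?(c_mono Cr) // (wp_c Cr) dual_r.
by move=> j ji _; rewrite (wp_c_id Cr).
Qed.

Lemma refl_exists i : exists r, is_refl i r.
Proof.
have [iN|iN] := ltnP i.+1 N.
  have [r Sr] := set0Pn _ (swap_elt_neq0 K i (inord i.+1)).
  by exists r; apply: swap_refl Sr; rewrite inordK.
have [r Cr] := set0Pn _ (c_elt_neq0 K i).
by exists r; apply: c_refl Cr; have := ltn_ord i; lia.
Qed.

Lemma root_exists i : exists X : K -> gT, forall a, is_root i a (X a).
Proof.
apply: fin_all_exists => a.
have ya : (e_ (nxt i) + a *: u_ i) (nxt i) 0 = 1.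
  by rewrite mxE e_E eqxx mxE -e_l e_E (negPf (nxt_neq i)) mulr0 addr0.
have Ly : low (lvl (nxt i)) (e_ (nxt i) + a *: u_ i).
  by rewrite lowD ?lowZ -?e_l ?low_e // lvl_l lvl_nxt.
have [t [Bt tn tc]] := elim_borel ya Ly.
exists t; split=> // c /tc->; eexists; first by [].
rewrite addrC addKr sp_formZr -e_l sp_form_e e_E -(inj_eq (@dual_inj n)) dualK.
by move=> /negPf->; rewrite !mulr0.
Qed.

End Panels.


Section PanelSpace.

Variables (K : finFieldType) (n : nat) (F : fieldType).
Local Notation N := n.+1.
Local Notation gT := {'GL_(n.+1 + n.+1)[K]}.
Local Notation V := 'cV[K]_(n.+1 + n.+1).
Local Notation Sp := (Sp K n).
Local Notation e_ := (@e_ K n).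
Local Notation u_ := (@sp_u K n).
Local Notation borel := (borel K n).
Local Notation unip := (unip K n).
Local Notation mono := (mono K n).
Local Notation W2 := (W2 K n).
Local Notation parab := (@parab K n).
Implicit Types (x y : V) (g h w p r t : gT) (c : 'I_(N + N)) (i j : 'I_N).
Implicit Types (f : gT -> F).

(** Functions on the chambers whose sums over the panels vanish; the chambers of a panel
of type i are the cosets of the Borel subgroup in a translate of the minimal parabolic. *)
Definition panel_space f :=
  (forall g b, g \in Sp -> b \in borel -> f (g * b)%g = f g) /\
  (forall i g, g \in Sp ->
     \sum_(C in lcosets borel (parab i)) f (g * repr C)%g = 0).

Lemma refl_parab i r : is_refl i r -> r \in parab i.
Proof.
case=> Wr ri rn rj; have Mr := W2_in_mono Wr.
have wi : wp r (lshift N i) = nxt i.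
  by apply: (@wp_eq _ _ _ _ _ 1); rewrite // scale1r e_l ri.
have M h : h \in mono -> wp h (lshift N i) = nxt i -> wp h (nxt i) = lshift N i ->
    (forall j, j != i -> lshift N j != nxt i -> wp h (lshift N j) = lshift N j) ->
    moves_only i h.
  move=> Mh hi hn hj; apply/forallP=> j; rewrite /panel_bound -e_l.
  have [a _ ->] := wpP (lshift N j) Mh; apply: lowZ; rewrite low_e.
  case: (eqVneq j i) => [->|ji]; first by rewrite hi lvl_nxt.
  have [jn|jn] := eqVneq (lshift N j) (nxt i); last by rewrite hj // lvl_l.
  by rewrite jn hn lvl_l -(lvl_l j) jn lvl_nxt.
have rV b c : wp r b = c -> wp r^-1 c = b.
  by move=> <-; rewrite -wpM ?glV // mulVg wp1.
apply/parabP; split; [exact: mono_Sp|exact: M|apply: M; rewrite ?glV //].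
- exact: rV.
- exact: rV.
by move=> j ji jn; apply/rV/rj.
Qed.

Lemma root_parab i a t : is_root i a t -> t \in parab i.
Proof. by case=> Bt _ _; apply: borel_parab. Qed.

Section Panel.

Variables (i : 'I_N) (r : gT) (X : K -> gT).
Hypotheses (rP : is_refl i r) (XP : forall a, is_root i a (X a)).

Let Pr := refl_parab rP.
Let PX a := root_parab (XP a).

Lemma panel_act_u a : sp_act (X a * r)%g (u_ i) = e_ (nxt i) + a *: u_ i.
Proof. by case: rP => _ ri _ _; case: (XP a) => _ Xi _; rewrite sp_actM ri Xi. Qed.

Lemma below_low x : below i x -> low i x.
Proof. by move=> bx; apply/low_below; apply: below_le bx _. Qed.

Lemma panel_decomp x : low i.+1 x ->
  exists2 z, below i z & x = x (nxt i) 0 *: e_ (nxt i) + x (lshift N i) 0 *: u_ i + z.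
Proof.
move=> Lx; exists (x - (x (nxt i) 0 *: e_ (nxt i) + x (lshift N i) 0 *: u_ i)); last first.
  by rewrite addrC subrK.
move=> c; rewrite -e_l; apply: contraNT; rewrite -leqNgt => ic.
rewrite mxE [X in _ + X]mxE [X in _ - X]mxE [X in _ - (X + _)]mxE [X in _ - (_ + X)]mxE !e_E.
have [->|n1] := eqVneq c (nxt i).
  by rewrite (negPf (nxt_neq i)) mulr1 mulr0 addr0 subrr.
have [->|n2] := eqVneq c (lshift N i); first by rewrite mulr1 mulr0 add0r subrr.
rewrite !mulr0 addr0 subr0 (low0 Lx) // ltn_neqAle; apply/andP; split.
  by apply: contra n1 => /eqP E; apply/eqP/lvl_inj; rewrite lvl_nxt.
rewrite ltn_neqAle ic andbT.
by apply: contra n2 => /eqP E; apply/eqP/lvl_inj; rewrite lvl_l.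
Qed.

Lemma panel_act_low p : p \in parab i -> low i.+1 (sp_act p (u_ i)).
Proof. by case/parabP=> _ /forallP/(_ i) + _; rewrite /panel_bound eqxx. Qed.

Lemma panel_mem a : (X a * r)%g \in parab i.
Proof. exact: glM. Qed.

(** The q + 1 chambers of a panel: an element of the parabolic either fixes the flag, or
its image of u_i has a nonzero coordinate at the successor of u_i, and then this image
modulo earlier vectors and scalars is e_(nxt i) + a u_i. *)
Lemma panel_cosets p : p \in parab i ->
  p \in borel \/ exists a, ((X a * r)^-1 * p)%g \in borel.
Proof.
move=> Pp; have [z bz] := panel_decomp (panel_act_low Pp).
set y := sp_act p (u_ i) => yE; have [y0|nz] := eqVneq (y (nxt i) 0) 0.
  left; apply: parab_borel Pp _; rewrite -/y yE y0 scale0r add0r.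
  by apply: lowD; [rewrite lowZ // -e_l low_e lvl_l | apply: below_low].
right; exists (y (lshift N i) 0 / y (nxt i) 0).
set a := _ / _; apply: (@parab_borel _ _ i); first by rewrite glM ?glV ?panel_mem.
have -> : sp_act ((X a * r)^-1 * p)%g (u_ i) =
    y (nxt i) 0 *: u_ i + sp_act (X a * r)^-1 z.
  rewrite sp_actM -/y; apply: (@sp_act_inj _ _ (X a * r)%g).
  rewrite sp_actVK sp_actD sp_actZ panel_act_u sp_actVK scalerDr scalerA /a.
  by rewrite mulrC divfK.
apply: lowD; first by rewrite lowZ // -e_l low_e lvl_l.
by apply: below_low; apply: (@parab_below _ _ i); rewrite ?glV ?panel_mem.
Qed.

Lemma panel_u_coord p b : p \in parab i -> b \in borel ->
  exists2 k, k != 0 & exists2 z, below i z &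
    sp_act (p * b)%g (u_ i) = k *: sp_act p (u_ i) + z.
Proof.
move=> Pp Bb; exists (sp_act b (u_ i) (lshift N i) 0).
  exact: (borel_diag_neq0 (lshift N i) Bb).
have Lb : low i.+1 (sp_act b (u_ i)).
  by apply: panel_act_low; apply: borel_parab.
have [z bz E] := panel_decomp Lb; exists (sp_act p z); first exact: (parab_below Pp).
rewrite sp_actM {1}E (lvl_coord (b := lshift N i) (c := nxt i) Bb) ?lvl_l ?lvl_nxt //.
by rewrite scale0r add0r sp_actD sp_actZ.
Qed.

Lemma panel_cosets_inj a a' b : b \in borel -> (X a * r * b)%g = (X a' * r)%g -> a = a'.
Proof.
move=> Bb E; have [k _ [z bz]] := panel_u_coord (panel_mem a) Bb.
rewrite E !panel_act_u => /colP Ez.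
have z1 : z (nxt i) 0 = 0 by rewrite (below0 bz) // lvl_nxt.
have z2 : z (lshift N i) 0 = 0 by rewrite (below0 bz) // lvl_l.
have := Ez (nxt i); have := Ez (lshift N i).
rewrite -!e_l !coordD z1 z2 !coordZ !coordD !coordZ !e_E.
rewrite !eqxx ![lshift N i == _]eq_sym (negPf (nxt_neq i)) !mulr0 !addr0 !mulr1 !add0r.
by move=> -> <-; rewrite mul1r.
Qed.

Lemma panel_notin_borel a : (X a * r)%g \notin borel.
Proof.
apply/negP=> B; have := lvl_coord (b := lshift N i) (c := nxt i) B.
rewrite lvl_l lvl_nxt => /(_ (leqnn _)) /eqP; rewrite e_l panel_act_u.
by rewrite mxE e_E eqxx mxE -e_l e_E (negPf (nxt_neq i)) mulr0 addr0 oner_eq0.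
Qed.

Lemma panel_lcosets : lcosets borel (parab i) =
  (borel : {set gT}) |: [set ((X a * r)%g *: borel)%g | a : K].
Proof.
apply/setP=> C; rewrite in_setU1; apply/lcosetsP/orP => [[p Pp ->]|[/eqP->|/imsetP[a _ ->]]].
- case: (panel_cosets Pp) => [Bp|[a Ba]]; [left|right].
    by rewrite lcoset_id.
  by apply/imsetP; exists a => //; apply: lcoset_eqP; rewrite mem_lcoset.
- by exists 1%g; rewrite ?group1 // mul1g.
by exists (X a * r)%g; rewrite ?panel_mem.
Qed.

Lemma panel_sum f g : (forall g b, g \in Sp -> b \in borel -> f (g * b)%g = f g) ->
  g \in Sp ->
  \sum_(C in lcosets borel (parab i)) f (g * repr C)%g = f g + \sum_a f (g * (X a * r))%g.
Proof.
move=> fB Gg; have fr p : p \in parab i -> f (g * repr (p *: borel)%g)%g = f (g * p)%g.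
  move=> Pp; rewrite -[repr _](gl_mulKV p) mulgA; apply: fB (gl_repr_lcoset _ _).
  exact: glM (parab_Sp Pp).
rewrite panel_lcosets big_setU1 /=; last first.
  apply/imsetP=> -[a _ E]; apply: (elimN idP (panel_notin_borel a)).
  change ((X a * r)%g \in borel_set K n); rewrite E; exact: lcoset_refl.
congr (_ + _).
  have -> : (borel : {set gT}) = (1 *: borel)%g by rewrite mul1g.
  by rewrite fr ?group1 // mulg1.
rewrite big_imset /=; last first.
  move=> a a' _ _ E; apply: (@panel_cosets_inj _ _ ((X a * r)^-1 * (X a' * r))%g).
    exact: gl_lcoset_eq.
  exact: gl_mulKV.
by apply: eq_big => [a|a _]; rewrite ?inE // fr ?panel_mem.
Qed.

End Panel.

(** * Functions on the flag complex that vanish on the big cell *)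

(** A substitute for the length function: it grows when an ascent of w is exchanged, so
that an element of maximal weight has no ascent. The larger factor N - j sits on the
earlier index. *)
Definition cell_weight w := (\sum_(j < N) (N - j) * lvl (wp w (lshift N j)))%N.

Lemma cell_weight_refl i r w : w \in W2 -> is_refl i r ->
  (lvl (wp w (lshift N i)) < lvl (wp w (nxt i)))%N ->
  (cell_weight w < cell_weight (w * r))%N.
Proof.
move=> Ww rP lt; have [Wr ri rn rj] := rP.
have Mw := W2_in_mono Ww; have Mr := W2_in_mono Wr.
have wi : wp r (lshift N i) = nxt i.
  by apply: (@wp_eq _ _ _ _ _ 1); rewrite // scale1r e_l ri.
rewrite /cell_weight; under [X in (_ < X)%N]eq_bigr do rewrite wpM //.
have [iN|iN] := ltnP i.+1 N; last first.
  rewrite (bigD1 i) // [X in (_ < X)%N](bigD1 i) //= wi.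
  rewrite -addSn leq_add //; first by rewrite ltn_pmul2l // subn_gt0.
  apply: leq_sum => j ji; rewrite rj // /nxt ltnNge iN /=.
  by rewrite eq_lrshift.
have En : nxt i = lshift N (inord i.+1) by rewrite /nxt iN.
set i1 : 'I_N := inord i.+1 in En.
have i1E : i1 = i.+1 :> nat by rewrite inordK.
have i1i : i1 != i by rewrite -val_eqE /= i1E; apply/eqP; lia.
rewrite (bigD1 i) // (bigD1 i1) //= [X in (_ < X)%N](bigD1 i) // [X in (_ < _ + X)%N](bigD1 i1) //=.
rewrite wi -En rn !addnA -addSn leq_add //.
  rewrite i1E En in lt *; move: (lvl _) (lvl _) lt => a b ab.
  have -> : (N - i = (N - i.+1).+1)%N by lia.
  by rewrite !mulSn; lia.
apply: leq_sum => j /andP[ji ji1]; rewrite rj // En.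
by rewrite (inj_eq (@lshift_inj _ _)).
Qed.

(** The longest element of the Weyl group is -1: it exchanges M and N. *)
Definition longest w := w \in W2 /\ forall i, wp w (lshift N i) = rshift N i.

Lemma longest_exists : exists w, longest w.
Proof.
suff /(_ N (leqnn N)) [w Ww E] : forall M, (M <= N)%N -> exists2 w, w \in W2 &
    forall i, wp w (lshift N i) = if (i < M)%N then rshift N i else lshift N i.
  by exists w; split=> // i; rewrite E ltn_ord.
elim=> [|M IH] MN; first by exists 1%g => [|i]; rewrite ?group1 ?wp1.
have [w Ww E] := IH (ltnW MN); pose j := Ordinal MN.
have [g Cg] := set0Pn _ (c_elt_neq0 K j).
exists (w * g)%g => [|i]; first exact: glM Ww (c_W2 Cg).
rewrite (wpM _ (W2_in_mono Ww) (c_mono Cg)); have [->|ij] := eqVneq i j.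
  by rewrite (wp_c Cg) -dual_l (wp_dual _ (W2_in_mono Ww)) E ltnn ltnSn.
rewrite (wp_c_id Cg ij) E; have -> // : (i < M.+1)%N = (i < M)%N.
have iM : (i : nat) != M by rewrite -val_eqE in ij.
by rewrite ltnS leq_eqVlt (negPf iM).
Qed.

(** Without ascents, the levels of the images of u_0, ..., u_n and of the successor v_n
of u_n decrease strictly. The first gives an upper bound for all of them, and v_n, as
the dual of u_n, a lower bound; together they leave only one possibility. *)
Lemma no_ascent w : w \in W2 ->
  (forall i, (lvl (wp w (nxt i)) <= lvl (wp w (lshift N i)))%N) -> longest w.
Proof.
move=> Ww noasc; have Mw := W2_in_mono Ww; split=> // i.
have lt j : (lvl (wp w (nxt j)) < lvl (wp w (lshift N j)))%N.
  rewrite ltn_neqAle noasc andbT; apply/eqP=> /lvl_inj/(wp_inj Mw)/eqP.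
  by rewrite (negPf (nxt_neq j)).
pose L j := lvl (wp w (lshift N j)).
have up : forall j, (L j + j <= (N + N).-1)%N.
  move=> j; have [m] := ubnP (j : nat); elim: m j => // m IH j; rewrite ltnS => jm.
  have [j0|j0] := posnP j; first by rewrite j0 addn0 /L; have := lvl_lt (wp w (lshift N j)); lia.
  have jN : (j.-1 < N)%N by have := ltn_ord j; lia.
  have jE : (Ordinal jN).+1 = j :> nat by rewrite /= prednK.
  have En : nxt (Ordinal jN) = lshift N j by apply: lvl_inj; rewrite lvl_nxt lvl_l.
  have := lt (Ordinal jN); rewrite En -/(L _) -/(L _) => h1.
  have := IH (Ordinal jN); rewrite jE => h2; have h3 := h2 jm.
  have {}h3 : (L (Ordinal jN) + j.-1 <= (N + N).-1)%N by exact: h3.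
  by move: (L _) (L j) h1 h3 => a a' h1 h3; lia.
have down : forall j, ((N + N).-1 <= L j + j)%N.
  move=> j; have [m] := ubnP (N - j); elim: m j => // m IH j; rewrite ltnS => jm.
  have := lt j; have [jN|jN] := ltnP j.+1 N.
    have -> : nxt j = lshift N (Ordinal jN) by apply: lvl_inj; rewrite lvl_nxt lvl_l.
    rewrite -/(L _) -/(L _) => h1; have := IH (Ordinal jN) => /= h2.
    have h3 : (N - j.+1 < m)%N by lia.
    by have := h2 h3; lia.
  have -> : nxt j = rshift N j by rewrite /nxt ltnNge jN.
  rewrite -dual_l wp_dual // -/(L _); have := lvl_dual (wp w (lshift N j)).
  by rewrite -/(L _); have := ltn_ord j; lia.
apply: lvl_inj; rewrite lvl_r -/(L i); have := up i; have := down i; have := ltn_ord i; lia.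
Qed.

(** Among the cells b w B on which f does not vanish, take one of maximal weight. If w
had an ascent at i, the panel of type i of b w would consist of this chamber and of
chambers of the heavier cell of w r, so that f would vanish at b w after all. Hence w is
the longest element, and the cell is the opposite one, where f is 0. *)
Lemma cell_vanish f w0 : panel_space f -> longest w0 ->
  (forall u, u \in unip -> f (u * w0)%g = 0) -> forall g, g \in Sp -> f g = 0.
Proof.
move=> [fB fP] [Ww0 w0E] f0 g Gg; apply/eqP; apply: contraT => nz.
pose good w := (w \in W2) && [exists b in borel, f (b * w)%g != 0].
have [w1 gw1] : exists w, good w.
  have [b [w [b' [Bb Ww Bb' gE]]]] := bruhat Gg; exists w; rewrite /good Ww /=.
  apply/exists_inP; exists b => //; rewrite -(fB _ b') -?gE //.
  by apply: glM (borel_Sp Bb) (W2_Sp Ww).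
pose w := [arg max_(w > w1 | good w) cell_weight w].
have [/andP[Ww /exists_inP[b Bb fbw]] wmax] : good w /\
    forall w', good w' -> (cell_weight w' <= cell_weight w)%N.
  by rewrite /w; case: arg_maxnP.
have Mw := W2_in_mono Ww; have Mw0 := W2_in_mono Ww0.
have Gbw : (b * w)%g \in Sp by apply: glM (borel_Sp Bb) (W2_Sp Ww).
have [_ wE] : longest w.
  apply: no_ascent => // i; rewrite leqNgt; apply/negP=> asc.
  have [r rP] := refl_exists K i; have [X XP] := root_exists K i.
  have Wr : r \in W2 by case: rP.
  have := cell_weight_refl Ww rP asc; rewrite ltnNge => /negP; apply; apply: wmax.
  rewrite /good glM //=; move/eqP: (fP i _ Gbw).
  rewrite (panel_sum rP XP) //; apply: contraLR => /exists_inPn nogood.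
  rewrite big1 ?addr0 // => a _; apply/eqP; rewrite -[_ == _]negbK.
  (* The conjugate of a positive root element by w is in B, as w has an ascent at i. *)
  have -> : (b * w * (X a * r) = b * (w * X a * w^-1) * (w * r))%g.
    by rewrite !mulgA mulgKV.
  apply: nogood; apply: glM => //; have [BX Xn Xc] := XP a.
  have wVk c : exists2 d, wp w d = c & exists k, sp_act w^-1 (e_ c) = k *: e_ d.
    have [d' nz' Ed'] := wpP c (glVr Mw).
    by exists (wp w^-1 c); [rewrite -wpM ?glV // mulgV wp1|exists d'].
  apply/borelP; split=> [|j].
    by apply: glM (glVr (W2_Sp Ww)); apply: glM (W2_Sp Ww) (borel_Sp BX).
  have [d wd [k Ek]] := wVk (lshift N j).
  rewrite !sp_actM -e_l Ek !sp_actZ; apply: lowZ.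
  have lowd : low j (sp_act w (e_ d)).
    by have [k' _ ->] := wpP d Mw; rewrite wd lowZ // low_e lvl_l.
  have [dn|dn] := eqVneq d (nxt i).
    rewrite dn Xn sp_actD sp_actZ lowD -?dn //; apply: lowZ.
    have [k' _ ->] := wpP (lshift N i) Mw; rewrite lowZ // low_e.
    by move: asc; rewrite -dn wd lvl_l; apply: ltnW.
  have [k' -> k0] := Xc d dn; rewrite sp_actD sp_actZ lowD //.
  have [dd|/k0->] := eqVneq d (dual (lshift N i)); last by rewrite scale0r low_zero.
  apply: lowZ; have [k'' _ ->] := wpP (dual (nxt i)) Mw.
  rewrite lowZ // low_e (wp_dual _ Mw).
  have := lvl_dual (wp w (nxt i)); have := lvl_dual (wp w (lshift N i)).
  have -> : dual (wp w (lshift N i)) = lshift N j by rewrite -(wp_dual _ Mw) -dd wd.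
  rewrite lvl_l; move: asc; clear.
  by move: (lvl _) (lvl _) (lvl _) => l1 l2 l3; lia.
have H : (w0^-1 * w)%g \in sp_H K n.
  apply: mono_H => [|c]; first by apply: glM (glVr Mw0) Mw.
  have w0w : wp w c = wp w0 c.
    case: (split_ordP c) => j ->; first by rewrite wE w0E.
    by rewrite -dual_l !wp_dual // wE w0E.
  by rewrite wpM ?glV // w0w -wpM ?glV // mulVg wp1.
have [h Hh Uh] := borel_torus Bb.
move: fbw; have -> : (b * w = (b * h^-1) * w0 * ((h ^ w0) * (w0^-1 * w)))%g.
  by rewrite conjgE -!mulgA !mulKVg mulKg.
rewrite fB ?f0 ?eqxx //.
  by apply: glM (W2_Sp Ww0); apply: borel_Sp; apply: unip_borel.
apply: glM; last exact: H_borel.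
by apply: H_borel; rewrite memJ_norm //; apply: (subsetP (mono_normH K n)).
Qed.

End PanelSpace.

(** * The standard apartment *)

Section Apartment.

Variables (K : finFieldType) (n : nat) (F : fieldType).
Local Notation N := n.+1.
Local Notation gT := {'GL_(n.+1 + n.+1)[K]}.
Local Notation V := 'cV[K]_(n.+1 + n.+1).
Local Notation Sp := (Sp K n).
Local Notation e_ := (@e_ K n).
Local Notation u_ := (@sp_u K n).
Local Notation borel := (borel K n).
Local Notation unip := (unip K n).
Local Notation mono := (mono K n).
Local Notation W2 := (W2 K n).
Local Notation parab := (@parab K n).
Local Notation panel_space := (@panel_space K n F).
Implicit Types (x y : V) (g h w p r t : gT) (c : 'I_(N + N)) (i j : 'I_N).
Implicit Types (f : gT -> F).

Lemma panel_translate f i g q : (forall g b, g \in Sp -> b \in borel -> f (g * b)%g = f g) ->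
  g \in Sp -> q \in parab i ->
  \sum_(C in lcosets borel (parab i)) f (g * q * repr C)%g =
  \sum_(C in lcosets borel (parab i)) f (g * repr C)%g.
Proof.
move=> fB Gg Pq.
rewrite [RHS](reindex_onto (fun C : {set gT} => q *: C)%g (fun C => q^-1 *: C)%g) /=; last first.
  by move=> C _; rewrite -lcosetM mulgV mul1g.
apply: eq_big => [C|C /lcosetsP[p Pp ->]].
  rewrite -lcosetM mulVg mul1g eqxx andbT.
  apply/lcosetsP/lcosetsP => -[p Pp E].
    by exists (q * p)%g; rewrite ?glM // E lcosetM.
  by exists (q^-1 * p)%g; rewrite ?glM ?glV // lcosetM -E -lcosetM mulVg mul1g.
have rB p' : p' \in parab i -> f (g * repr (p' *: borel)%g)%g = f (g * p')%g.
  move=> Pp'; rewrite -[repr _](gl_mulKV p') mulgA; apply: fB (gl_repr_lcoset _ _).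
  exact: glM (parab_Sp Pp').
have rB' : f (g * q * repr (p *: borel)%g)%g = f (g * q * p)%g.
  rewrite -[repr _](gl_mulKV p) mulgA; apply: fB (gl_repr_lcoset _ _).
  exact: glM (glM Gg (parab_Sp Pq)) (parab_Sp Pp).
by rewrite rB' -lcosetM rB ?mulgA // glM.
Qed.

(** The indicator function of the standard apartment. *)
Definition apart g : F := (g \in (W2 * borel)%g)%:R.

Lemma apart_mem w b : w \in W2 -> b \in borel -> (w * b)%g \in (W2 * borel)%g.
Proof. exact: mem_mulg. Qed.

Lemma apart_right g b : b \in borel -> apart (g * b)%g = apart g.
Proof.
move=> Bb; congr (nat_of_bool _)%:R; apply/idP/idP.
  case/mulsgP=> w b' Ww Bb' E; have -> : g = (w * (b' * b^-1))%g by rewrite mulgA -E mulgK.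
  by apply: apart_mem => //; rewrite glM ?glV.
by case/mulsgP=> w b' Ww Bb' ->; rewrite -mulgA; apply: apart_mem; rewrite ?glM.
Qed.

(** A panel of the standard apartment contains exactly two of its chambers. *)
Lemma apart_panel_mem i r X a w : is_refl i r -> (forall a, is_root i a (X a)) ->
  w \in W2 -> ((w * (X a * r))%g \in (W2 * borel)%g) = (a == 0).
Proof.
move=> rP XP Ww; apply/idP/eqP => [/mulsgP[w' b Ww' Bb E]|->].
  have E' : (w^-1 * w' = X a * r * b^-1)%g.
    by rewrite -(mulgK b w') -E !mulgA mulVg mul1g.
  have Mw : (X a * r * b^-1)%g \in mono.
    rewrite -E'; exact: glM (glVr (W2_in_mono Ww)) (W2_in_mono Ww').
  have [k nz [z bz]] := panel_u_coord (panel_mem rP XP a) (glVr Bb).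
  have [k' nz' ->] := wpP (lshift N i) Mw.
  rewrite (panel_act_u rP XP) => /colP Ez.
  have z1 : z (nxt i) 0 = 0 by rewrite (below0 bz) // lvl_nxt.
  have z2 : z (lshift N i) 0 = 0 by rewrite (below0 bz) // lvl_l.
  have := Ez (nxt i); have := Ez (lshift N i).
  rewrite -!e_l !coordD !coordZ z1 z2 !coordD !coordZ !e_E !eqxx.
  rewrite ![lshift N i == nxt i]eq_sym (negPf (nxt_neq i)) !mulr0 !addr0 !mulr1 add0r.
  have [<-|_] := eqVneq (lshift N i) (wp _ _); last first.
    by rewrite mulr0 => /esym/eqP; rewrite mulf_eq0 (negPf nz) /= => /eqP.
  by rewrite (negPf (nxt_neq i)) mulr0 => _ /esym/eqP; rewrite (negPf nz).
have Pr := refl_parab rP; have PX := root_parab (XP 0).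
have [Wr ri _ _] := rP; have [_ Xn _] := XP 0.
have -> : (w * (X 0 * r) = w * r * (r^-1 * X 0 * r))%g by rewrite !mulgA mulgK.
apply: apart_mem; first exact: glM.
apply: (@parab_borel _ _ i); first by rewrite !glM ?glV.
rewrite !sp_actM ri Xn scale0r addr0 -ri sp_actK -e_l low_e lvl_l //.
Qed.

(** The chamber u w0 B is in the standard apartment only for u = 1. If u w0 b^-1 permutes
the coordinate lines, comparing the coordinates of the images of the u_i shows by
induction that u preserves the line of each v_i; being unipotent, it fixes v_i, and by
duality u_i. *)
Lemma apart_cell u w0 : u \in unip -> longest w0 -> apart (u * w0)%g = (u == 1%g)%:R.
Proof.
move=> Uu [Ww0 w0E]; congr (nat_of_bool _)%:R; apply/idP/eqP => [/mulsgP[w b Ww Bb E]|->]; last first.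
  by rewrite mul1g -[w0]mulg1 apart_mem.
have Bu := unip_borel Uu; have Mw := W2_in_mono Ww; have Mw0 := W2_in_mono Ww0.
have wE x : sp_act w x = sp_act u (sp_act w0 (sp_act b^-1 x)).
  by rewrite -!sp_actM E mulgK.
have uv : forall i, sp_act u (e_ (rshift N i)) = e_ (rshift N i).
  move=> i; have [m] := ubnP (i : nat); elim: m i => // m IH i; rewrite ltnS => im.
  pose y := sp_act b^-1 (u_ i).
  have yi : y (lshift N i) 0 != 0 by apply: (borel_diag_neq0 (lshift N i)); rewrite glV.
  have y0 d : (i < lvl d)%N -> y d 0 = 0.
    by move=> id; apply: (@lvl_coord _ _ b^-1%g (lshift N i) d); rewrite ?glV ?lvl_l.
  have [s sP] : exists s : 'I_N -> K, forall j, s j != 0 /\ sp_act w0 (u_ j) = s j *: e_ (rshift N j).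
    apply: (fin_all_exists (P := fun j k => k != 0 /\ sp_act w0 (u_ j) = k *: e_ (rshift N j))) => j.
    have [a nz] := wpP (lshift N j) Mw0.
    by rewrite w0E e_l; exists a.
  have [k nz Ek] := wpP (lshift N i) Mw.
  have Ew : sp_act w (u_ i) = (y (lshift N i) 0 * s i) *: sp_act u (e_ (rshift N i)) +
      \sum_(j < N | (j < i)%N) (y (lshift N j) 0 * s j) *: e_ (rshift N j).
    rewrite wE -/y [y in LHS]sum_e !sp_act_sum big_split_ord /= [X in _ + X]big1 ?addr0; last first.
      move=> j _; rewrite y0 ?scale0r ?sp_act0 // lvl_r.
      by have := ltn_ord i; have := ltn_ord j; clear; lia.
    rewrite (bigD1 i) //= !sp_actZ e_l (proj2 (sP i)) sp_actZ scalerA; congr (_ + _).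
    rewrite (bigID (fun j : 'I_N => (j < i)%N)) /= [X in _ + X]big1 ?addr0; last first.
      move=> j /andP[ji]; rewrite -leqNgt => ij; rewrite y0 ?scale0r ?sp_act0 // lvl_l.
      by rewrite ltn_neqAle ij andbT eq_sym.
    apply: eq_big => [j|j /andP[ji jlt]]; first by rewrite -val_eqE neq_ltn; case: ltngtP.
    by rewrite !sp_actZ e_l (proj2 (sP j)) sp_actZ scalerA IH // (leq_trans jlt).
  have coef d : sp_act w (u_ i) d 0 = k * (d == wp w (lshift N i))%:R.
    by rewrite -e_l Ek coordZ e_E.
  have sumc d : (\sum_(j < N | (j < i)%N) (y (lshift N j) 0 * s j) *: e_ (rshift N j)) d 0 =
      \sum_(j < N | (j < i)%N) (y (lshift N j) 0 * s j) * (d == rshift N j)%:R.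
    by rewrite summxE; apply: eq_bigr => j _; rewrite coordZ e_E.
  have wi : wp w (lshift N i) = rshift N i.
    apply/esym/eqP; have := coef (rshift N i).
    rewrite Ew coordD coordZ (unip_diag (rshift N i) Uu) mulr1 sumc big1 ?addr0.
      by case: eqP => // _ /eqP; rewrite mulr0 mulf_eq0 (negPf yi) (negPf (proj1 (sP i))).
    by move=> j ji; rewrite (inj_eq (@rshift_inj _ _)) -val_eqE /= gtn_eqF ?mulr0.
  have yj0 j : (j < i)%N -> y (lshift N j) 0 * s j = 0.
    move=> ji; have := coef (rshift N j); rewrite wi (inj_eq (@rshift_inj _ _)) -val_eqE ltn_eqF // mulr0.
    rewrite Ew coordD coordZ (lvl_coord (b := rshift N i) (c := rshift N j) Bu) ?mulr0 ?add0r; last first.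
      by rewrite !lvl_r; have := ltn_ord i; move: ji; clear; lia.
    rewrite sumc (bigD1 j) //= eqxx mulr1 big1 ?addr0 // => l /andP[_ lj].
    by rewrite (inj_eq (@rshift_inj _ _)) eq_sym (negPf lj) mulr0.
  move: Ew; rewrite big1 ?addr0 => [|j ji]; last by rewrite yj0 ?scale0r.
  rewrite -e_l Ek wi => Eu; have nz' : y (lshift N i) 0 * s i != 0 by rewrite mulf_neq0 ?(proj1 (sP i)).
  have Eu' : sp_act u (e_ (rshift N i)) = ((y (lshift N i) 0 * s i)^-1 * k) *: e_ (rshift N i).
    by rewrite -scalerA Eu scalerA mulVf ?scale1r.
  have := unip_diag (rshift N i) Uu; rewrite Eu' coordZ e_E eqxx mulr1 => ->.
  by rewrite scale1r.
apply: sp_act_eqP => d; rewrite sp_act1; case: (split_ordP d) => i -> //.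
apply/colP=> c; case: (split_ordP c) => j ->.
  rewrite !coordE dual_l; congr (_ * _); rewrite -[in LHS]uv Sp_form //.
  exact: borel_Sp.
rewrite e_E eq_rlshift; apply: (@lvl_coord _ _ u (lshift N i)) => //.
by rewrite lvl_l lvl_r; have := ltn_ord i; have := ltn_ord j; lia.
Qed.

Hypothesis F2 : 2%N \in [pchar F].

Lemma two0 : 1 + 1 = 0 :> F.
Proof. by rewrite -(pcharf0 F2) mulr2n. Qed.

(** A panel that meets the apartment contributes 1 + 1. *)
Lemma apart_panel : panel_space apart.
Proof.
split=> [g b _|i g Gg]; first exact: apart_right.
have [/exists_inP[p Pp /mulsgP[w b Ww Bb E]]|none] :=
  boolP [exists p in parab i, (g * p)%g \in (W2 * borel)%g]; last first.
  rewrite big1 // => C /lcosetsP[p Pp ->]; rewrite /apart.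
  have b := gl_repr_lcoset borel p; rewrite -[repr _](gl_mulKV p).
  by move/exists_inPn: none => /(_ _ (glM Pp (borel_parab _ b)))/negPf->.
have Pq : (b * p^-1)%g \in parab i by exact: glM (borel_parab _ Bb) (glVr Pp).
have -> : g = (w * (b * p^-1))%g by rewrite mulgA -E mulgK.
have fB g' b' : g' \in Sp -> b' \in borel -> apart (g' * b')%g = apart g'.
  by move=> _; apply: apart_right.
rewrite panel_translate ?(W2_Sp Ww) //.
have [r rP] := refl_exists K i; have [X XP] := root_exists K i.
rewrite (panel_sum rP XP) ?(W2_Sp Ww) //.
rewrite (bigD1 0) //= big1 => [|a a0]; last by rewrite /apart (apart_panel_mem _ rP XP) // (negPf a0).
by rewrite addr0 /apart (apart_panel_mem _ rP XP) // eqxx -[w]mulg1 apart_mem // two0.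
Qed.

End Apartment.

(** * The Steinberg module as a space of functions on chambers *)

Section Steinberg.

Variables (K : finFieldType) (n : nat) (F : fieldType).
Hypotheses (F2 : 2%N \in [pchar F]) (oddK : odd #|K|) (K2 : (2%:R : K) != 0).
Local Notation gT := {'GL_(n.+1 + n.+1)[K]}.
Local Notation Sp := (Sp K n).
Local Notation borel := (borel K n).
Local Notation unip := (unip K n).
Local Notation panel_space := (@panel_space K n F).
Variables (nw : coset_of (sp_H K n) -> gT) (nwP : Weyl_lift nw).
Implicit Types (g h p r t : gT) (f : gT -> F) (x y z : 'rV[F]_#|Sp|).
Local Notation lreg := (lreg_repr F Sp).
Local Notation St := (steinberg_mx F nw).

(** The value at g of an element of the group algebra seen as a function on the group. *)
Definition fn x g : F := x 0 (gring_index Sp g).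

Lemma fn_inj x y : (forall g, g \in Sp -> fn x g = fn y g) -> x = y.
Proof.
by move=> E; apply/rowP=> i; have := E _ (enum_valP i); rewrite /fn gring_valK.
Qed.

Lemma fn_gelt g h : g \in Sp -> h \in Sp -> fn (gelt F Sp g) h = (h == g)%:R.
Proof.
by move=> Gg Gh; rewrite /fn mxE eqxx (inj_in_eq (can_in_inj (@gring_indexK _ Sp))).
Qed.

Lemma fn_lreg x g h : g \in Sp -> h \in Sp -> fn (x *m lreg g) h = fn x (g * h)%g.
Proof.
move=> Gg Gh; rewrite /fn mxE (bigD1 (gring_index Sp (g * h))) //= big1 => [|i ne].
  rewrite addr0 mxE gring_indexK ?glM // mulKg.
  by rewrite [gelt _ _ _ _ _](fn_gelt Gh Gh) eqxx mulr1.
rewrite mxE [gelt _ _ _ _ _]fn_gelt ?(glM (glVr Gg) (enum_valP i)) //.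
case: eqP => [E|]; last by rewrite mulr0.
by case/eqP: ne; rewrite E mulKVg gring_valK.
Qed.

Lemma fnZ a x g : fn (a *: x) g = a * fn x g. Proof. exact: mxE. Qed.
Lemma fn_sum (I : finType) (P : pred I) (X : I -> 'rV[F]_#|Sp|) g :
  fn (\sum_(i | P i) X i) g = \sum_(i | P i) fn (X i) g.
Proof. exact: summxE. Qed.

Lemma oppr1_2 : -1 = 1 :> F.
Proof. by apply/eqP; rewrite eq_sym -subr_eq0 opprK two0. Qed.

(** The cosets n_w B are pairwise different, and their union is W_2 B. *)
Lemma fn_steinberg_e g : g \in Sp -> fn (steinberg_e F nw) g = apart F g.
Proof.
move=> Gg; have WSp w (b : gT) : w \in Weyl K n -> b \in sp_B K n -> (nw w * b)%g \in Sp.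
  by rewrite sp_B_borel => /nwP[/W2_Sp Gw _] /borel_Sp; apply: glM.
have inner w : w \in Weyl K n ->
    fn (\sum_(b in sp_B K n) (-1) ^+ Weyl_length w *: gelt F Sp (nw w * b)%g) g =
    (((nw w)^-1 * g)%g \in borel)%:R.
  move=> Ww; rewrite fn_sum.
  rewrite (eq_bigr (fun b => ((nw w)^-1 * g == b)%g%:R)) => [|b Bb]; last first.
    rewrite fnZ oppr1_2 expr1n mul1r fn_gelt ?WSp //.
    by congr (nat_of_bool _)%:R; apply/eqP/eqP => [->|<-]; rewrite ?mulKg ?mulKVg.
  have [Bg|nBg] := boolP (_ \in borel).
    rewrite (bigD1 ((nw w)^-1 * g)%g) ?sp_B_borel //= eqxx big1 ?addr0 // => b /andP[_ ne].
    by rewrite eq_sym (negPf ne).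
  rewrite big1 // => b Bb; case: eqP => // E; move: nBg; rewrite E.
  by rewrite -[gval borel]sp_B_borel Bb.
rewrite /steinberg_e fn_sum (eq_bigr _ inner) /apart.
have [/gl_mulsg[y [b [Wy Bb E]]]|none] := boolP (g \in _); last first.
  rewrite big1 // => w Ww; case: (boolP (_ \in borel)) => // Bg; case/negP: none.
  have -> : g = (nw w * ((nw w)^-1 * g))%g by rewrite mulKVg.
  by apply: apart_mem => //; case: (nwP Ww).
have Ny : y \in ('N(sp_H K n))%g by apply: (subsetP (mono_normH K n)); apply: W2_in_mono.
have coset_borel w : w \in Weyl K n -> (((nw w)^-1 * g)%g \in borel) = (w == coset (sp_H K n) y).
  move=> Ww; have [Wnw cw] := nwP Ww.
  have Nw : nw w \in ('N(sp_H K n))%g.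
    by apply: (subsetP (mono_normH K n)); apply: W2_in_mono.
  apply/idP/eqP => [Bg|Ew].
    have H : ((nw w)^-1 * y)%g \in sp_H K n.
      apply: mono_borel; first exact: glM (glVr (W2_in_mono Wnw)) (W2_in_mono Wy).
      have -> : ((nw w)^-1 * y = (nw w)^-1 * g * b^-1)%g by rewrite E mulgA mulgK.
      exact: glM Bg (glVr Bb).
    rewrite -cw -(coset_kerr (nw w) H); congr (coset _ _); exact: gl_mulKV.
  have Hh : ((nw w)^-1 * y)%g \in sp_H K n by apply: gl_coset_eq; rewrite ?cw.
  by rewrite E mulgA; apply: glM (H_borel Hh) Bb.
have cW : coset (sp_H K n) y \in Weyl K n by apply: mem_quotient.
rewrite (bigD1 (coset (sp_H K n) y)) //= coset_borel // eqxx big1 ?addr0 // => w /andP[Ww ne].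
by rewrite coset_borel // (negPf ne).
Qed.

Lemma panel_space_eq f f' : (forall g, g \in Sp -> f g = f' g) ->
  panel_space f -> panel_space f'.
Proof.
move=> E [fB fP]; split=> [g b Gg Bb|i g Gg].
  by have Gb := glM Gg (borel_Sp Bb); rewrite -(E _ Gb) -(E _ Gg) fB.
rewrite -[RHS](fP i g Gg); apply: eq_bigr => C /lcosetsP[p Pp ->].
rewrite E // -[repr _](gl_mulKV p); apply: glM Gg _; apply: glM; first exact: parab_Sp Pp.
exact: borel_Sp (gl_repr_lcoset _ _).
Qed.

Lemma panel_space_lin a f f' : panel_space f -> panel_space f' ->
  panel_space (fun g => a * f g + f' g).
Proof.
move=> [fB fP] [fB' fP']; split=> [g b Gg Bb|i g Gg]; first by rewrite fB ?fB'.
by rewrite big_split -mulr_sumr /= fP // fP' // mulr0 addr0.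
Qed.

Lemma panel_space_trans h f : h \in Sp -> panel_space f -> panel_space (fun g => f (h * g)%g).
Proof.
move=> Gh [fB fP]; split=> [g b Gg Bb|i g Gg]; first by rewrite mulgA (fB _ _ (glM Gh Gg) Bb).
by rewrite -[RHS](fP i _ (glM Gh Gg)); apply: eq_bigr => C _; rewrite mulgA.
Qed.

Lemma panel_space0 : panel_space (fun=> 0).
Proof. by split=> // i g _; rewrite big1. Qed.

Lemma panel_space_sum (I : finType) (P : pred I) (a : I -> F) (f : I -> gT -> F) :
  (forall i, P i -> panel_space (f i)) ->
  panel_space (fun g => \sum_(i | P i) a i * f i g).
Proof.
move=> fP; have [s sE] : exists s : seq I, perm_eq s (enum P) by exists (enum P).
suff H : forall s : seq I, all P s -> panel_space (fun g => \sum_(i <- s) a i * f i g).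
  apply: (panel_space_eq (f := fun g => \sum_(i <- enum P) a i * f i g)).
    by move=> g _; rewrite big_enum.
  by apply: H; apply/allP=> i; rewrite mem_enum.
elim=> [|i t IH] /=; first by move=> _; apply: (panel_space_eq _ panel_space0) => g _; rewrite big_nil.
move=> /andP[Pi Pt]; apply: (panel_space_eq _ (panel_space_lin (a i) (fP i Pi) (IH Pt))) => g _.
by rewrite big_cons.
Qed.

(** The indicator function of the apartment has vanishing panel sums, and generates I. *)
Lemma panel_space_fn x : (x <= St)%MS -> panel_space (fn x).
Proof.
case/cyclic_mxP=> A /envelop_mxP[a ->] ->.
have := panel_space_sum a (P := mem Sp) (f := fun h g => apart F (h * g)%g)
  (fun h Gh => panel_space_trans Gh (apart_panel K n F2)).
apply: panel_space_eq => g Gg.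
rewrite mulmx_sumr fn_sum; apply: eq_bigr => h Gh.
by rewrite -scalemxAr fnZ fn_lreg // fn_steinberg_e // glM.
Qed.

(** A function with vanishing panel sums is determined by its values on the chambers
opposite to the standard one, and exactly one translate of the standard apartment by an
element of the unipotent group contains a given opposite chamber. So the function is the
combination of these translates with its own opposite values as coefficients. *)
Lemma panel_space_steinberg x : panel_space (fn x) -> (x <= St)%MS.
Proof.
move=> px; have [w0 Lw0] := longest_exists K n.
have Gw0 : w0 \in Sp by case: Lw0 => /W2_Sp.
pose y := \sum_(u in unip) fn x (u * w0)%g *: (steinberg_e F nw *m lreg u^-1%g).
have yS : (y <= St)%MS.
  apply: summx_sub => u Uu; apply: scalemx_sub.
  have := mxmoduleP (cyclic_mx_module lreg (steinberg_e F nw)) u^-1%g.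
  move=> /(_ (glVr (borel_Sp (unip_borel Uu)))); apply: submx_trans.
  by apply: submxMr; apply: cyclic_mx_id.
suff -> : x = y by [].
apply: fn_inj => g Gg; apply/eqP; rewrite -subr_eq0; apply/eqP.
have p0 := panel_space_lin (-1) (panel_space_fn yS) px.
have := cell_vanish p0 Lw0 _ Gg; rewrite mulN1r addrC; apply=> u Uu.
have Gu u' : u' \in unip -> u' \in Sp by move/unip_borel/borel_Sp.
rewrite /y fn_sum (bigD1 u) //= fnZ fn_lreg ?(glM (Gu _ Uu) Gw0) ?(glVr (Gu _ Uu)) //.
rewrite fn_steinberg_e ?mulKg // -{2}[w0]mul1g (apart_cell _ (group1 _) Lw0) // eqxx mulr1.
rewrite big1 ?addr0 ?mulN1r ?addNr // => u' /andP[Uu' ne].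
rewrite fnZ fn_lreg ?(glM (Gu _ Uu) Gw0) ?(glVr (Gu _ Uu')) //.
have Uv := glM (glVr Uu') Uu; rewrite fn_steinberg_e; last first.
  by apply: glM (glVr (Gu _ Uu')) (glM (Gu _ Uu) Gw0).
rewrite mulgA (apart_cell _ Uv Lw0).
have [E|_] := eqVneq (u'^-1 * u)%g 1%g; last by rewrite mulr0.
by move: ne; rewrite -[u](gl_mulKV u') E mulg1 eqxx.
Qed.

Definition ones : 'rV[F]_#|Sp| := const_mx 1.

Lemma fn_ones g : fn ones g = 1. Proof. by rewrite /fn mxE. Qed.

Lemma odd_natr m : odd m -> m%:R = 1 :> F.
Proof.
move=> om; rewrite -(odd_double_half m) om -muln2 natrD natrM (pcharf0 F2) mulr0 addr0 //.
Qed.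

(** A panel has q + 1 chambers, an even number. *)
Lemma ones_steinberg : (ones <= St)%MS.
Proof.
apply: panel_space_steinberg; split=> [g b _ _|i g Gg]; first by rewrite !fn_ones.
have [r rP] := refl_exists K i; have [X XP] := root_exists K i.
rewrite (panel_sum rP XP) // => [|g' b _ _]; last by rewrite !fn_ones.
rewrite fn_ones (eq_bigr (fun=> 1)) => [|a _]; last by rewrite fn_ones.
by rewrite sumr_const (odd_natr oddK) two0.
Qed.

(** Let a function be nonzero on the standard chamber. So is its sum over the unipotent
group, whose order is odd, and this sum is constant on the opposite chambers, which
form one orbit. Hence it is a nonzero multiple of the constant function 1. *)
Lemma ones_sub_module m (U : 'M[F]_(m, #|Sp|)) : mxmodule lreg U -> (U <= St)%MS -> U != 0 ->
  (ones <= U)%MS.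
Proof.
move=> modU US /rowV0Pn[x xU x0].
have [g Gg xg] : exists2 g, g \in Sp & fn x g != 0.
  apply/exists_inP; apply: contraNT x0 => /exists_inPn xz; apply/eqP/fn_inj => g Gg.
  by have := xz g Gg; rewrite negbK => /eqP->; rewrite /fn mxE.
have GSp u : u \in unip -> u \in Sp by move/unip_borel/borel_Sp.
pose x' := x *m lreg g.
have x'U : (x' <= U)%MS by apply: submx_trans (mxmoduleP modU g Gg); apply: submxMr.
pose y := \sum_(u in unip) x' *m lreg u.
have yU : (y <= U)%MS.
  apply: summx_sub => u Uu; apply: submx_trans (mxmoduleP modU u (GSp _ Uu)).
  exact: submxMr.
have px' := panel_space_fn (submx_trans x'U US).
have py := panel_space_fn (submx_trans yU US).
have fy h : h \in Sp -> fn y h = \sum_(u in unip) fn x' (u * h)%g.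
  by move=> Gh; rewrite /y fn_sum; apply: eq_bigr => u Uu; rewrite (fn_lreg _ (GSp _ Uu) Gh).
have y1 : fn y 1%g != 0.
  rewrite fy // (eq_bigr (fun=> fn x' 1%g)) => [|u Uu]; last first.
    by rewrite mulg1 -[u]mul1g; case: px' => -> //; apply: unip_borel.
  by rewrite sumr_const -mulr_natl (odd_natr (odd_unip _ K2)) mul1r /x' fn_lreg ?group1 ?mulg1.
have [w0 Lw0] := longest_exists K n.
have Gw0 : w0 \in Sp by case: Lw0 => /W2_Sp.
pose c := fn y w0.
have yc : y = c *: ones.
  apply: fn_inj => h Gh; rewrite fnZ fn_ones mulr1; apply/eqP; rewrite -subr_eq0; apply/eqP.
  have p1 := panel_space_fn ones_steinberg.
  have := cell_vanish (panel_space_lin (- c) p1 py) Lw0 _ Gh.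
  rewrite fn_ones mulr1 addrC; apply=> v Uv; rewrite fn_ones mulr1 addrC.
  apply/eqP; rewrite subr_eq0; apply/eqP; rewrite /c !fy ?(glM (GSp _ Uv) Gw0) //.
  rewrite [RHS](reindex_inj (mulIg v)) /=; apply: eq_big => u; last by rewrite mulgA.
  by rewrite groupMr.
have c0 : c != 0 by apply: contraNneq y1 => c0; rewrite yc c0 scale0r /fn mxE.
have -> : ones = c^-1 *: y by rewrite yc scalerA mulVf // scale1r.
exact: scalemx_sub.
Qed.

End Steinberg.

(** * Additive characters and squares of a finite field *)

Section Characters.

Variables (K : finFieldType) (F : fieldType).

(** A nonzero coordinate form of K over the prime field, followed by i |-> z^i. *)
Lemma char_exists (p k : nat) (z : F) : prime p -> #|K| = (p ^ k)%N -> p.-primitive_root z ->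
  exists lam : K -> F, nontrivial_char lam.
Proof.
move=> pr_p cK pz; have ch : p \in [pchar K] := card_finPcharP cK pr_p.
pose L : vectType 'F_p := pPrimeCharType ch.
pose X := vbasis {: L}.
have d0 : (0 < \dim {: L})%N.
  rewrite lt0n dimv_eq0; apply/eqP=> E; have := memvf (1 : pPrimeCharType ch).
  by rewrite E memv0 oner_eq0.
pose i0 := Ordinal d0.
pose c (a : L) : 'F_p := coord X i0 a.
have expD (x y : 'F_p) : z ^+ (x + y)%R = z ^+ x * z ^+ y.
  rewrite -exprD /= -[in RHS](expr_mod _ (prim_expr_order pz)); congr (_ ^+ _).
  exact: (congr1 (modn (x + y)%N) (Fp_cast pr_p)).
exists (fun a => z ^+ c a); split.
- by rewrite /c linear0 expr0.
- by move=> a b; rewrite /c -expD; congr (z ^+ _); congr (nat_of_ord _); exact: linearD.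
exists (X`_i0); rewrite /c (coord_free _ _ (basis_free (vbasisP _))) eqxx.
have -> : nat_of_ord (true%:R : 'F_p) = 1%N by [].
by rewrite -(prim_order_dvd pz 1) dvdn1 neq_ltn prime_gt1 ?orbT.
Qed.

Lemma char_twist_nontriv (lam : K -> F) (k : K) : nontrivial_char lam -> k != 0 ->
  nontrivial_char (fun a => lam (k * a)).
Proof.
move=> [l0 lD [b nb]] k0; split; first by rewrite mulr0.
  by move=> a a'; rewrite mulrDr lD.
by exists (k^-1 * b); rewrite mulrA divff // mul1r.
Qed.

Lemma sum_char0 (chi : K -> F) (b : K) : {morph chi : x y / x + y >-> x * y} -> chi b != 1 ->
  \sum_a chi a = 0.
Proof.
move=> chiD nb; set S := \sum_a _; have SE : S = chi b * S.
  rewrite {1}/S (reindex_inj (addrI b)) /= mulr_sumr; apply: eq_bigr => c _.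
  by rewrite chiD.
apply/eqP; move/eqP: SE; rewrite -subr_eq0 -{1}[S]mul1r -mulrBl mulf_eq0 subr_eq0.
by rewrite eq_sym (negPf nb).
Qed.

(** Every character is a twist of a given nontrivial one: otherwise it would be
orthogonal to all of them, and so to the sum of the twists, which is supported at 0. *)
Lemma char_is_twist (lam lam0 : K -> F) : (#|K|%:R : F) != 0 ->
  nontrivial_char lam -> nontrivial_char lam0 ->
  exists2 k, k != 0 & forall a, lam a = lam0 (k * a).
Proof.
move=> q0 [l0 lD [b nb]] lamP0; have [m0 mD [c nc]] := lamP0.
have lN (mu : K -> F) a : mu 0 = 1 -> {morph mu : x y / x + y >-> x * y} -> mu (- a) * mu a = 1.
  by move=> mu0 muD; rewrite -muD addNr.
have [/existsP[k /forallP E]|none] := boolP [exists k, [forall a, lam a == lam0 (k * a)]].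
  exists k => [|a]; last exact/eqP/E.
  apply: contraNneq nb => k0; rewrite (eqP (E b)) k0 mul0r m0 //.
have S0 k : \sum_a lam a * lam0 (- (k * a)) = 0.
  have [b' nb'] : exists b', lam b' * lam0 (- (k * b')) != 1.
    have := none; rewrite negb_exists => /forallP/(_ k); rewrite negb_forall => /existsP[b' ne].
    exists b'; apply: contra ne => /eqP E; apply/eqP.
    have := lN _ (k * b') m0 mD; move/(congr1 ( *%R (lam b'))); rewrite mulrA E mul1r mulr1 //.
  apply: (sum_char0 _ nb') => x y; rewrite mulrDr opprD lD mD.
  by rewrite mulrACA.
have : \sum_k \sum_a lam a * lam0 (- (k * a)) = #|K|%:R.
  rewrite exchange_big /= (bigD1 0) //= [X in _ + X]big1 ?addr0.
    rewrite (eq_bigr (fun=> 1)) => [|k _]; first by rewrite sumr_const.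
    by rewrite mulr0 oppr0 l0 m0 mulr1.
  move=> a a0; rewrite -mulr_sumr (sum_char0 (b := - (c / a))) ?mulr0 // => [x y|].
    by rewrite mulrDl opprD mD.
  by rewrite mulNr opprK divfK.
by rewrite big1 => [/eqP|k _]; rewrite ?S0 // eq_sym (negPf q0).
Qed.

Hypothesis K2 : (2%:R : K) != 0.

Lemma opp_neq (x : K) : x != 0 -> - x != x.
Proof.
apply: contraNneq => E; have : 2%:R * x = 0 by rewrite mulr_natl mulr2n -{1}E addNr.
by move/eqP; rewrite mulf_eq0 (negPf K2).
Qed.

Definition squares : {set K} := [set x ^+ 2 | x in [set~ 0]].

Lemma card_squares : (#|squares| * 2 = #|K|.-1)%N.
Proof.
have cK : #|[set~ (0 : K)]| = #|K|.-1 by rewrite cardsC1.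
rewrite -cK -[RHS]sum1_card (partition_big_imset (fun x => x ^+ 2)) /= -sum_nat_const.
apply: eq_bigr => y /imsetP[x]; rewrite !inE => x0 ->.
rewrite (bigD1 x) /=; last by rewrite !inE x0 eqxx.
rewrite (bigD1 (- x)) /=; last by rewrite !inE oppr_eq0 x0 sqrrN eqxx opp_neq.
rewrite big1 // => t /andP[/andP[/andP[_]]]; rewrite eqf_sqr.
by case/orP=> ->.
Qed.

Lemma nonsquare_exists : exists2 k : K, k != 0 & forall c, k != c ^+ 2.
Proof.
have [k kn ks] : exists2 k : K, k != 0 & k \notin squares.
  apply/exists_inP; apply: contraT => /exists_inPn all.
  have /subset_leq_card : [set~ (0 : K)] \subset squares.
    by apply/subsetP=> x; rewrite !inE => /all; rewrite negbK.
  rewrite cardsC1; have := card_squares; have : (0 < #|K|.-1)%N.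
    by rewrite -ltnS prednK ?finNzRing_gt1 // ltnW // finNzRing_gt1.
  by move: #|squares| #|K|.-1 => a b; lia.
exists k => // c; apply: contraNneq ks => E; rewrite E; apply: imset_f; rewrite !inE.
by apply: contraNneq kn => c0; rewrite E c0 expr0n.
Qed.

(** The squares and their translate by a nonsquare exhaust the nonzero elements, as each
of the two classes contains half of them. *)
Lemma nonsquare_ratio (k l : K) : k != 0 -> (forall c, k != c ^+ 2) ->
  l != 0 -> (forall c, l != c ^+ 2) -> exists2 c, c != 0 & l = c ^+ 2 * k.
Proof.
move=> k0 kn l0 ln; pose T := [set k * x | x in squares].
have cT : #|T| = #|squares| by rewrite card_imset //; apply: mulfI.
have sq0 x : x \in squares -> x != 0.
  by case/imsetP=> y; rewrite !inE => y0 ->; rewrite expf_neq0.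
have dis : [disjoint squares & T].
  apply/pred0P=> x /=; apply/negP=> /andP[/imsetP[a]]; rewrite !inE => a0 -> /imsetP[y /imsetP[b]].
  rewrite !inE => b0 -> E; have := kn (a / b); rewrite expr_div_n E mulfK ?eqxx //.
  by rewrite expf_neq0.
have : l \in squares :|: T.
  have /eqP<- : [set~ (0 : K)] == squares :|: T.
    rewrite eq_sym eqEcard; apply/andP; split.
      apply/subsetP=> x; rewrite !inE => /orP[/sq0 //|/imsetP[y /sq0 y0 ->]].
      by rewrite mulf_neq0.
    rewrite cardsU cT (disjoint_setI0 dis) cards0 subn0 cardsC1 -card_squares.
    by rewrite muln2 addnn.
  by rewrite !inE.
rewrite inE => /orP[/imsetP[c _ lc]|/imsetP[y /imsetP[c]]].
  by case/eqP: (ln c).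
by rewrite !inE => c0 -> ->; exists c; rewrite // mulrC.
Qed.

End Characters.

(** * Construction of the Weil representation in characteristic 2 *)

(** In characteristic 2 a sum over a set with an involution only sees the fixed points.
This is what makes Gauss sums, and hence all the normalizing factors of the Weil
representation, equal to 1. *)
Lemma sum_involution (T : finType) (W : zmodType) (A : pred T) (s : T -> T) (x0 : T) (f : T -> W) :
  (forall w : W, w + w = 0) -> involutive s -> A x0 -> s x0 = x0 ->
  (forall x, A x -> A (s x)) -> (forall x, A x -> s x = x -> x = x0) ->
  (forall x, A x -> f (s x) = f x) -> \sum_(x | A x) f x = f x0.
Proof.
move=> W2 sK A0 s0 As fixs fs; rewrite (bigD1 x0) //= -[RHS]addr0; congr (_ + _).
pose r (x : T) := (enum_rank x : nat); rewrite (bigID (fun x => (r x < r (s x))%N)) /=.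
rewrite [X in _ + X](reindex_inj (inv_inj sK)) /=.
set S := (X in X + _); suff -> : (\sum_(x | (A (s x) && (s x != x0)) && ~~ (r (s x) < r (s (s x)))%N) f (s x)) = S.
  exact: W2.
apply: eq_big => [x|x /andP[/andP[Ax _] _]]; last by rewrite -fs // sK.
rewrite sK; have -> : A (s x) = A x by apply/idP/idP => [/As|]; rewrite ?sK //; apply: As.
have -> : (s x != x0) = (x != x0) by rewrite -{1}s0 (inj_eq (inv_inj sK)).
case Ax: (A x) => //=; case xx0: (x != x0) => //=; rewrite -leqNgt ltn_neqAle.
case: eqP => // /ord_inj/enum_rank_inj/esym/(fixs _ Ax) xE; by rewrite xE eqxx in xx0.
Qed.

Section WeilExistence.

Variables (K : finFieldType) (n : nat) (F : fieldType).
Hypotheses (F2 : 2%N \in [pchar F]) (K2 : (2%:R : K) != 0).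
Local Notation N := n.+1.
Local Notation gT := {'GL_(n.+1 + n.+1)[K]}.
Local Notation V := 'cV[K]_(n.+1 + n.+1).
Local Notation Sp := (Sp K n).
Local Notation spanM := (spanM K n).
Local Notation spanN := (spanN K n).
Local Notation d := #|spanN|.
Local Notation eps := (@eps K n F).
Local Notation u_ := (@sp_u K n).
Local Notation v_ := (@sp_v K n).
Implicit Types (x v m l : V) (g h s a r : gT) (y z : 'rV[F]_d).

Lemma F2_add (w : F) : w + w = 0.
Proof. by rewrite -mulr2n -mulr_natr (pcharf0 F2) mulr0. Qed.

Lemma F2_addv k (w : 'rV[F]_k) : w + w = 0.
Proof. by apply/rowP=> i; rewrite !mxE F2_add. Qed.

Lemma F2_addm k k' (w : 'M[F]_(k, k')) : w + w = 0.
Proof. by apply/matrixP=> i j; rewrite !mxE F2_add. Qed.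

Lemma F2_opp (w : F) : - w = w.
Proof. by apply/eqP; rewrite -subr_eq0 -opprD F2_add oppr0. Qed.

Lemma oppr_fix (U : lmodType K) (x : U) : - x = x -> x = 0.
Proof.
move=> E; have : 2%:R *: x = 0 by rewrite scaler_nat mulr2n -{1}E addNr.
by move/eqP; rewrite scaler_eq0 (negPf K2) => /eqP.
Qed.

Lemma sum_even (W : zmodType) (A : pred V) (f : V -> W) :
  (forall w : W, w + w = 0) -> A 0 -> (forall x, A x -> A (- x)) ->
  (forall x, A x -> f (- x) = f x) -> \sum_(x | A x) f x = f 0.
Proof.
move=> W2 A0 AN fN; apply: (sum_involution W2 opprK) => //; first exact: oppr0.
by move=> x _; apply: oppr_fix.
Qed.

Lemma spanM0 : 0 \in spanM. Proof. by rewrite in_spanM raddf0. Qed.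

(** Meaningful only for x in N, like the basis vector [eps x]. *)
Definition co y x : F := y 0 (enum_rank_in (spanN0 K n) x).

Lemma co_eps x x' : x \in spanN -> x' \in spanN -> co (eps x) x' = (x' == x)%:R.
Proof.
move=> Nx Nx'; rewrite /co mxE eqxx (inj_in_eq (can_in_inj (enum_rankK_in (spanN0 K n)))) //.
Qed.

Lemma coD y z x : co (y + z) x = co y x + co z x. Proof. exact: mxE. Qed.
Lemma coZ c y x : co (c *: y) x = c * co y x. Proof. exact: mxE. Qed.
Lemma co_sum (I : finType) (P : pred I) (Y : I -> 'rV[F]_d) x :
  co (\sum_(i | P i) Y i) x = \sum_(i | P i) co (Y i) x.
Proof. exact: summxE. Qed.

Lemma eps_val (i : 'I_d) : eps (enum_val i) = delta_mx 0 i.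
Proof. by rewrite /Defs.eps enum_valK_in. Qed.

Lemma sum_eps y : y = \sum_(x in spanN) co y x *: eps x.
Proof.
rewrite [LHS]row_sum_delta (reindex_onto (enum_rank_in (spanN0 K n)) enum_val) /=; last first.
  by move=> i _; rewrite enum_valK_in.
apply: eq_bigl => x; apply/eqP/idP => [<-|Nx]; first exact: enum_valP.
exact: enum_rankK_in.
Qed.

Lemma eps_mx_inj k (A B : 'M[F]_(d, k)) :
  (forall x, x \in spanN -> eps x *m A = eps x *m B) -> A = B.
Proof.
by move=> E; apply/row_matrixP=> i; rewrite !rowE -eps_val E // enum_valP.
Qed.

Lemma co_inj y z : (forall x, x \in spanN -> co y x = co z x) -> y = z.
Proof.
by move=> E; rewrite [y]sum_eps [z]sum_eps; apply: eq_bigr => x /E->.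
Qed.

Definition mx_of k (f : V -> 'rV[F]_k) : 'M[F]_(d, k) := \matrix_(i < d) f (enum_val i).

Lemma eps_mx_of k (f : V -> 'rV[F]_k) x : x \in spanN -> eps x *m mx_of f = f x.
Proof.
by move=> Nx; rewrite /Defs.eps -rowE rowK enum_rankK_in.
Qed.

(** The projection to N along M. *)
Definition pN x : V := col_mx 0 (dsubmx x).

Lemma pN_N x : pN x \in spanN. Proof. by rewrite in_spanN col_mxKu. Qed.
Lemma pN_id x : x \in spanN -> pN x = x.
Proof. by rewrite in_spanN => /eqP E; rewrite /pN -E vsubmxK. Qed.
Lemma pN_M x : x \in spanM -> pN x = 0.
Proof. by rewrite in_spanM => /eqP E; rewrite /pN E col_mx0. Qed.
Lemma pND x x' : pN (x + x') = pN x + pN x'.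
Proof. by rewrite /pN raddfD /= add_col_mx addr0. Qed.
Lemma pNN x : pN (- x) = - pN x.
Proof. by rewrite /pN raddfN /= opp_col_mx oppr0. Qed.
Lemma pN_dec x : x - pN x \in spanM.
Proof. by rewrite in_spanM raddfB /= col_mxKd subrr. Qed.

Lemma sp_form_pN x x' : sp_form x (pN x') + sp_form (pN x) x' = sp_form x x'.
Proof.
by rewrite !sp_formE /pN !col_mxKu !col_mxKd trmx0 mul0mx mulmx0 subr0 sub0r [RHS]mxE.
Qed.

Lemma spanM_addl m x : m \in spanM -> (m + x \in spanM) = (x \in spanM).
Proof.
move=> Mm; apply/idP/idP => Mx; last exact: spanM_D.
by rewrite -[x](addKr m) spanM_D ?spanM_N.
Qed.

Lemma spanM_opp x : (- x \in spanM) = (x \in spanM).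
Proof. by apply/idP/idP => /spanM_N //; rewrite opprK. Qed.

Lemma spanM_orth x : (forall i, sp_form (u_ i) x = 0) -> x \in spanM.
Proof.
move=> E; rewrite in_spanM; apply/eqP/colP=> i; rewrite !mxE -[RHS](E i).
by rewrite sp_form_u.
Qed.

Variable lam : K -> F.
Hypothesis lamP : nontrivial_char lam.

Lemma lam0 : lam 0 = 1. Proof. by case: lamP. Qed.
Lemma lamD (a b : K) : lam (a + b) = lam a * lam b. Proof. by case: lamP. Qed.
(** The sum needs no division by |M|, which is odd. *)
Lemma sum_lam_M x : \sum_(l in spanM) lam (2%:R * sp_form l x) = (x \in spanM)%:R.
Proof.
have [Mx|nMx] := boolP (x \in spanM).
  rewrite (eq_bigr (fun=> 1)) => [|l Ml]; last by rewrite sp_form_MM // mulr0 lam0.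
  rewrite (sum_even F2_add) // ?spanM0 // => l Ml; exact: spanM_N.
have [i nz] : exists i, sp_form (u_ i) x != 0.
  by apply/existsP; apply: contraNT nMx => /existsPn E; apply: spanM_orth => i; apply/eqP; rewrite -[_ == _]negbK E.
have [_ _ [b nb]] := lamP.
pose l0 : V := (b / (2%:R * sp_form (u_ i) x)) *: u_ i.
have Ml0 : l0 \in spanM by rewrite spanM_Z ?u_spanM.
have El0 : 2%:R * sp_form l0 x = b by rewrite sp_formZl mulrCA divfK // mulf_neq0.
set S := \sum_(l in _) _; have SE : S = lam b * S.
  rewrite {1}/S (reindex_inj (addrI l0)) /= mulr_sumr; apply: eq_big => l.
    by rewrite spanM_addl.
  by rewrite sp_formDl mulrDr El0 lamD.
apply/eqP; move/eqP: SE; rewrite -subr_eq0 -{1}[S]mul1r -mulrBl mulf_eq0 subr_eq0.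
by rewrite eq_sym (negPf nb).
Qed.

(** The Schroedinger representation of the Heisenberg group of V on Y. The factor in
front is chosen so that the cocycle in [heisM] is the form itself, which is invariant
under Sp. *)
Definition heis x : 'M[F]_d :=
  mx_of (fun v => lam (sp_form x (pN x) + 2%:R * sp_form x v) *: eps (v + pN x)).

Lemma eps_heis v x : v \in spanN ->
  eps v *m heis x = lam (sp_form x (pN x) + 2%:R * sp_form x v) *: eps (v + pN x).
Proof. exact: eps_mx_of. Qed.

Lemma heisM x x' : heis x' *m heis x = lam (sp_form x x') *: heis (x + x').
Proof.
apply: eps_mx_inj => v Nv; rewrite mulmxA eps_heis // -scalemxAl eps_heis; last first.
  by rewrite spanN_D ?pN_N.
rewrite -scalemxAr eps_heis // !scalerA -!lamD.
have -> : v + pN (x + x') = v + pN x' + pN x by rewrite pND (addrC (pN x)) addrA.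
congr (lam _ *: _); rewrite pND !(sp_formDl, sp_formDr) -(sp_form_pN x x') (sp_formC x' (pN x)); ring.
Qed.

Lemma heis_M v m : v \in spanN -> m \in spanM ->
  eps v *m heis m = lam (2%:R * sp_form m v) *: eps v.
Proof. by move=> Nv Mm; rewrite eps_heis // pN_M // sp_form0r add0r addr0. Qed.

Lemma heis0 : heis 0 = 1%:M.
Proof.
apply: eps_mx_inj => v Nv; rewrite heis_M ?spanM0 // sp_form0l mulr0 lam0.
by rewrite scale1r mulmx1.
Qed.

Lemma heis_swap x x' : heis x' *m heis x = lam (2%:R * sp_form x x') *: (heis x *m heis x').
Proof.
rewrite !heisM scalerA -lamD [x' + x]addrC (sp_formC x x'); congr (lam _ *: _); ring.
Qed.

(** An operator that intertwines the Heisenberg representation with its twist by g must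
send eps_0, which is fixed by M, to a vector fixed by gM; the sum over gM of the
translates of eps_0 is such a vector. The image of the other basis vectors is then
determined, because eps_v is the translate of eps_0 by v. *)
Definition weil_op g : 'M[F]_d :=
  mx_of (fun v => \sum_(m in spanM) eps 0 *m heis (sp_act g m) *m heis (sp_act g v)).

Lemma eps_weil g v : v \in spanN -> eps v *m weil_op g =
  (\sum_(m in spanM) eps 0 *m heis (sp_act g m)) *m heis (sp_act g v).
Proof. by move=> Nv; rewrite eps_mx_of // mulmx_suml. Qed.

Lemma weil_heis g x : g \in Sp ->
  heis x *m weil_op g = weil_op g *m heis (sp_act g x).
Proof.
move=> Gg; apply: eps_mx_inj => v Nv; rewrite !mulmxA eps_heis // -scalemxAl.
have Nv' : v + pN x \in spanN by rewrite spanN_D ?pN_N.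
rewrite !eps_weil // -mulmxA heisM Sp_form // -sp_actD -scalemxAr.
have -> : x + v = (x - pN x) + (v + pN x) by rewrite [v + _]addrC addrA subrK.
have E : heis (sp_act g (x - pN x + (v + pN x))) =
    lam (sp_form x (v + pN x)) *: (heis (sp_act g (x - pN x)) *m heis (sp_act g (v + pN x))).
  rewrite heisM Sp_form // -sp_actD [_ + (x - _)]addrC scalerA -lamD.
  rewrite [sp_form (v + _) _]sp_formC sp_formDl sp_formNl.
  by rewrite (sp_form_NN (pN_N x) Nv') oppr0 addr0 subrr lam0 scale1r.
rewrite E -scalemxAr scalerA -lamD mulmxA.
have -> : (\sum_(m in spanM) eps 0 *m heis (sp_act g m)) *m heis (sp_act g (x - pN x)) =
    \sum_(m in spanM) eps 0 *m heis (sp_act g m).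
  rewrite mulmx_suml [RHS](reindex_inj (addrI (x - pN x))) /=.
  apply: eq_big => [m|m Mm].
    by rewrite spanM_addl ?pN_dec.
  by rewrite -mulmxA heisM Sp_form // sp_form_MM ?pN_dec // lam0 scale1r -sp_actD.
by congr (lam _ *: _); rewrite sp_formDr; ring.
Qed.

Definition iota_op : 'M[F]_d := mx_of (fun v => eps (- v)).

Lemma eps_iota v : v \in spanN -> eps v *m iota_op = eps (- v).
Proof. exact: eps_mx_of. Qed.

Lemma co_iota z x : x \in spanN -> co (z *m iota_op) x = co z (- x).
Proof.
move=> Nx; have Nx' := spanN_N Nx.
rewrite {1}[z]sum_eps mulmx_suml co_sum (bigD1 (- x)) //= -scalemxAl eps_iota // opprK.
rewrite coZ co_eps // eqxx mulr1 big1 ?addr0 // => x' /andP[Nx1 ne].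
rewrite -scalemxAl eps_iota // coZ co_eps ?spanN_N // -eqr_oppLR eq_sym (negPf ne).
by rewrite mulr0.
Qed.

Lemma heis_iota x : heis x *m iota_op = iota_op *m heis (- x).
Proof.
apply: eps_mx_inj => v Nv; rewrite !mulmxA eps_heis // -scalemxAl !eps_iota ?spanN_D ?pN_N //.
rewrite eps_heis ?spanN_N // pNN !(sp_formNl, sp_formNr) !opprK opprD; congr (lam _ *: _).
Qed.

Lemma weil_iota g : weil_op g *m iota_op = iota_op *m weil_op g.
Proof.
apply: eps_mx_inj => v Nv; rewrite !mulmxA eps_weil // -mulmxA heis_iota eps_iota //.
rewrite eps_weil ?spanN_N // !mulmxA mulmx_suml sp_actN; congr (_ *m _).
rewrite (reindex_inj oppr_inj) /=; apply: eq_big => [m|m Mm].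
  by rewrite spanM_opp.
by rewrite -mulmxA heis_iota mulmxA eps_iota ?spanN0 // oppr0 sp_actN opprK.
Qed.

(** This coordinate is the sum of 1 over the intersection of M and its preimage by g, a
vector space of odd cardinality. *)
Lemma co_weil0 g : co (eps 0 *m weil_op g) 0 = 1.
Proof.
rewrite eps_weil ?spanN0 // sp_act0 heis0 mulmx1 co_sum.
rewrite (sum_even F2_add (f := fun m => co (eps 0 *m heis (sp_act g m)) 0)) ?spanM0 //; first last.
- move=> m Mm; rewrite !eps_heis ?spanN0 // !coZ !add0r !sp_form0r !mulr0 !addr0.
  rewrite !co_eps ?pN_N ?spanN0 // sp_actN pNN sp_formNl sp_formNr opprK.
  by rewrite ![0 == _]eq_sym oppr_eq0.
- by move=> m; apply: spanM_N.
by rewrite sp_act0 heis0 mulmx1 co_eps ?spanN0 // eqxx.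
Qed.

(** The contributions of the indices x and -x to this coordinate cancel. *)
Lemma co_weil_sym g z : z *m iota_op = z -> co (z *m weil_op g) 0 = co z 0.
Proof.
move=> zI; rewrite [z in LHS]sum_eps mulmx_suml co_sum.
rewrite (sum_even F2_add (f := fun x => co (co z x *: eps x *m weil_op g) 0)) ?spanN0 //; first last.
- move=> x Nx; rewrite -!scalemxAl !coZ -eps_iota // -mulmxA -weil_iota mulmxA.
  by rewrite -[in RHS]zI !co_iota ?spanN0 // oppr0.
- by move=> x; apply: spanN_N.
by rewrite -scalemxAl coZ co_weil0 mulr1.
Qed.

(** The projection on the vectors fixed by kM, in the Heisenberg representation. *)
Definition proj_op k : 'M[F]_d := \sum_(m in spanM) heis (sp_act k m).

Lemma eps_proj1 v : v \in spanN -> eps v *m proj_op 1 = (v == 0)%:R *: eps v.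
Proof.
move=> Nv; rewrite /proj_op mulmx_sumr (eq_bigr (fun m => lam (2%:R * sp_form m v) *: eps v)).
  rewrite -scaler_suml sum_lam_M; congr (_%:R *: _); congr nat_of_bool.
  apply/idP/eqP => [|->]; last exact: spanM0.
  rewrite in_spanM => /eqP E; rewrite in_spanN in Nv; rewrite -[v]vsubmxK (eqP Nv) E col_mx0 //.
by move=> m Mm; rewrite sp_act1 heis_M.
Qed.

Lemma row_proj1 y : y *m proj_op 1 = co y 0 *: eps 0.
Proof.
rewrite [y in LHS]sum_eps mulmx_suml (bigD1 0) ?spanN0 //= -scalemxAl eps_proj1 ?spanN0 //.
rewrite eqxx scale1r big1 ?addr0 // => x /andP[Nx ne].
by rewrite -scalemxAl eps_proj1 // (negPf ne) scale0r scaler0.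
Qed.

Lemma proj_heis k m : k \in Sp -> m \in spanM -> proj_op k *m heis (sp_act k m) = proj_op k.
Proof.
move=> Gk Mm; rewrite /proj_op mulmx_suml [RHS](reindex_inj (addrI m)) /=.
apply: eq_big => [l|l Ml].
  by rewrite spanM_addl.
by rewrite heisM Sp_form // sp_form_MM // lam0 scale1r sp_actD.
Qed.

(** The projection on the line fixed by a Lagrangian kM factors through the line fixed
by M, whatever the relative position of M and kM. *)
Lemma proj_proj k : k \in Sp -> proj_op k *m proj_op 1 *m proj_op k = proj_op k.
Proof.
move=> Gk; have E m : m \in spanM ->
    proj_op k *m heis m *m proj_op k = (sp_act k^-1 m \in spanM)%:R *: (proj_op k *m heis m).
  move=> Mm; rewrite -[in LHS]mulmxA [heis m *m _]mulmx_sumr mulmx_sumr -sum_lam_M scaler_suml.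
  apply: eq_bigr => l Ml; rewrite heis_swap -scalemxAr mulmxA proj_heis //.
  by rewrite Sp_formV.
have -> : proj_op 1 = \sum_(m in spanM) heis m by apply: eq_bigr => m _; rewrite sp_act1.
rewrite [X in X *m _]mulmx_sumr [LHS]mulmx_suml.
rewrite (eq_bigr (fun m => if sp_act k^-1 m \in spanM then proj_op k else 0)); last first.
  move=> m Mm; rewrite E //; case: ifP => Mk; last by rewrite scale0r.
  by rewrite scale1r -[m](sp_actVK k) proj_heis.
rewrite -big_mkcondr /= (sum_even (@F2_addm _ _)) // => [|m /andP[Mm Mkm]].
  by rewrite sp_act0 spanM0.
by rewrite spanM_N //= sp_actN spanM_N.
Qed.

(** Both sides satisfy the same commutation rule with the Heisenberg group, so it is
enough to compare the images of eps_0. They are fixed by ghM, hence proportional, and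
the factor is a coordinate that [co_weil_sym] shows to be 1. *)
Lemma weil_opM g h : g \in Sp -> h \in Sp -> weil_op h *m weil_op g = weil_op (g * h).
Proof.
move=> Gg Gh; apply: eps_mx_inj => v Nv; have Ggh := glM Gg Gh.
rewrite mulmxA !eps_weil // -mulmxA weil_heis // mulmxA -sp_actM; congr (_ *m _).
have -> : (\sum_(m in spanM) eps 0 *m heis (sp_act h m)) *m weil_op g =
    eps 0 *m weil_op g *m proj_op (g * h).
  rewrite mulmx_suml mulmx_sumr; apply: eq_bigr => m Mm.
  by rewrite -mulmxA weil_heis // mulmxA sp_actM.
rewrite -[RHS]mulmx_sumr -/(proj_op _) -[in LHS](proj_proj Ggh) !mulmxA.
have -> : eps 0 *m weil_op g *m proj_op (g * h) = eps 0 *m weil_op h *m weil_op g.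
  rewrite [eps 0 *m weil_op h]eps_weil ?spanN0 // sp_act0 heis0 mulmx1 mulmx_suml mulmx_sumr.
  by apply: eq_bigr => m Mm; rewrite -!mulmxA weil_heis // sp_actM.
rewrite row_proj1 co_weil_sym ?co_weil0 ?scale1r //.
by rewrite -mulmxA weil_iota mulmxA eps_iota ?spanN0 // oppr0.
Qed.

Lemma weil_op1 : weil_op 1 = 1%:M.
Proof.
apply: eps_mx_inj => v Nv; rewrite eps_weil // sp_act1.
have -> : \sum_(m in spanM) eps 0 *m heis (sp_act 1 m) = eps 0.
  rewrite -mulmx_sumr row_proj1 co_eps ?spanN0 // eqxx scale1r //.
by rewrite eps_heis ?spanN0 // pN_id // sp_form_xx sp_form0r mulr0 addr0 lam0 scale1r add0r mulmx1.
Qed.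

Definition weil_mx g : 'M[F]_d := weil_op g^-1.

Lemma weil_mx_repr : mx_repr Sp weil_mx.
Proof.
split=> [|g h Gg Gh]; first by rewrite /weil_mx invg1 weil_op1.
by rewrite /weil_mx invMg weil_opM // glVr.
Qed.

Lemma lact_weil g y : lact (MxRepresentation weil_mx_repr) g y = y *m weil_op g.
Proof. by rewrite gl_lactE /= /weil_mx gl_invK. Qed.

Lemma theta1 a : theta F a = 1.
Proof. by rewrite /theta; case: ifP => // _; rewrite F2_opp. Qed.

Lemma fixM_pN s v : s \in Sp_fixM K n -> v \in spanN -> pN (sp_act s v) = v.
Proof.
move=> Ss Nv; have Gs := fixM_Sp Ss.
suff M : sp_act s v - v \in spanM.
  by rewrite -[sp_act s v](subrK v) pND (pN_M M) add0r pN_id.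
apply: spanM_orth => i; rewrite sp_formDr sp_formNr.
by rewrite -{1}(Sp_fixM_act Ss (u_spanM K i)) Sp_form // subrr.
Qed.

(** The coordinate takes each value q^n times, which is an odd number. *)
Lemma sum_spanM_last (W : zmodType) (f : K -> W) : (forall w : W, w + w = 0) ->
  \sum_(m in spanM) f (m (lshift N ord_max) 0) = \sum_c f c.
Proof.
move=> W2; rewrite (partition_big (fun m : V => m (lshift N ord_max) 0) xpredT) //=.
apply: eq_bigr => c _; rewrite (eq_bigr (fun=> f c)) => [|m /andP[_ /eqP->]] //.
rewrite (reindex_inj (addrI (c *: u_ ord_max))) /=.
rewrite (sum_even W2 (f := fun=> f c)) //.
- by rewrite addr0 spanM_Z ?u_spanM // coordZ -e_l e_E eqxx mulr1 eqxx.
move=> m; rewrite !coordD !coordZ -!e_l e_E eqxx mulr1 => /andP[Mm /eqP Em].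
have m0 : m (lshift N ord_max) 0 = 0 by apply: (addrI c); rewrite Em addr0.
rewrite spanM_addl ?spanM_Z ?u_spanM // in Mm.
by rewrite [(- m) _ _]mxE m0 oppr0 addr0 eqxx andbT spanM_addl ?spanM_Z ?u_spanM // spanM_opp.
Qed.

Lemma gauss_sum : \sum_(c : K) lam (c ^+ 2) = 1.
Proof.
rewrite (sum_involution (s := -%R) (x0 := 0) F2_add) ?expr0n ?lam0 //; first exact: opprK.
- exact: oppr0.
- by move=> c _; apply: (@oppr_fix K^o).
by move=> c _; rewrite sqrrN.
Qed.

Lemma weil_mx_weil : weil_repr lam (MxRepresentation weil_mx_repr).
Proof.
split=> [s a x Ss Sa Nx|r x Gr rP Nx]; rewrite lact_weil eps_weil //.
  have Nax := stab_N Sa Nx.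
  have E : \sum_(m in spanM) eps 0 *m heis (sp_act (s * a) m) = eps 0.
    rewrite (eq_bigr (fun=> eps 0)) => [|m Mm].
      by rewrite (sum_even (@F2_addv _)) ?spanM0 // => m; apply: spanM_N.
    rewrite sp_actM (Sp_fixM_act Ss) ?(stab_M Sa) // heis_M ?spanN0 ?(stab_M Sa) //.
    by rewrite sp_form0r mulr0 lam0 scale1r.
  rewrite E eps_heis ?spanN0 // theta1 expr1n mul1r sp_form0r mulr0 addr0 add0r.
  by rewrite sp_actM (fixM_pN Ss).
rewrite gauss_sum invr1 scale1r.
have rx : sp_act r x = x by rewrite rP sp_form_NN ?v_spanN // scale0r subr0.
rewrite rx mulmx_suml -(sum_spanM_last _ (@F2_addv _)); apply: eq_bigr => m Mm.
rewrite rP sp_form_v scaleNr opprK; set c := m _ _.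
have pc : pN (m + c *: v_ ord_max) = c *: v_ ord_max.
  by rewrite pND pN_M // add0r pN_id // spanN_Z ?v_spanN.
rewrite eps_heis ?spanN0 // pc sp_form0r mulr0 addr0 add0r -scalemxAl.
rewrite eps_heis ?spanN_Z ?v_spanN // pN_id // (sp_form_xx x) (sp_form_NN Nx (spanN_Z c (v_spanN K ord_max))).
rewrite mulr0 addr0 lam0 scale1r [c *: _ + x]addrC; congr (lam _ *: _).
rewrite sp_formDl sp_form_xx addr0 sp_formZr sp_formC sp_form_v opprK expr2 //.
Qed.

End WeilExistence.

(** * Generation by the Siegel parabolic subgroup and one transvection *)

Section Generation.

Variables (K : finFieldType) (n : nat).
Local Notation N := n.+1.
Local Notation gT := {'GL_(n.+1 + n.+1)[K]}.
Local Notation V := 'cV[K]_(n.+1 + n.+1).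
Local Notation Sp := (Sp K n).
Local Notation u_ := (@sp_u K n).
Local Notation v_ := (@sp_v K n).
Implicit Types (x y v : V) (g h s a r : gT) (i j k : 'I_N).

Lemma swap_stab g i j : g \in swap_elt K i j -> g \in Sp_stabMN K n.
Proof.
case/swapP=> Gg E; apply/Sp_stabMNP; split=> // k.
  by case: (E k) => -> _; apply: u_spanM.
by case: (E k) => _ ->; apply: v_spanN.
Qed.

Lemma c_uniq g h j : g \in c_elt K j -> h \in c_elt K j -> g = h.
Proof.
case/c_eltP=> _ gu gv gk /c_eltP[_ hu hv hk]; apply: sp_act_uv_inj => k.
  by have [->|/[dup]/gk[-> _]/hk[-> _]] := eqVneq k j; rewrite ?gu ?hu.
by have [->|/[dup]/gk[_ ->]/hk[_ ->]] := eqVneq k j; rewrite ?gv ?hv.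
Qed.

Lemma c_conj g h i j : g \in c_elt K i -> h \in swap_elt K i j ->
  (h * g * h^-1)%g \in c_elt K j.
Proof.
move=> Cg Sh; have [Gg gu gv gk] := c_eltP _ _ Cg; have [Gh E] := swapP _ _ _ Sh.
have hVu k : sp_act h^-1 (u_ k) = u_ (tperm i j k).
  by apply: (@sp_act_inj _ _ h); rewrite sp_actVK; case: (E (tperm i j k)) => -> _; rewrite tpermK.
have hVv k : sp_act h^-1 (v_ k) = v_ (tperm i j k).
  by apply: (@sp_act_inj _ _ h); rewrite sp_actVK; case: (E (tperm i j k)) => _ ->; rewrite tpermK.
have hu k : sp_act h (u_ k) = u_ (tperm i j k) by case: (E k).
have hv k : sp_act h (v_ k) = v_ (tperm i j k) by case: (E k).
apply/c_eltP; split.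
- exact: glM (glM Gh Gg) (glVr Gh).
- by rewrite !sp_actM hVu tpermR gu hv tpermL.
- by rewrite !sp_actM hVv tpermR gv sp_actN hu tpermL.
move=> k kj; have ki : tperm i j k != i.
  by rewrite -[X in _ != X](tpermR i j) (inj_eq perm_inj).
by rewrite !sp_actM hVu hVv !(proj1 (gk _ ki)) !(proj2 (gk _ ki)) hu hv tpermK.
Qed.

Definition siegel_last : 'M[K]_N := - delta_mx ord_max ord_max.

(** An element x of the Siegel radical with c_n = x rho x: this is the factorization of
a rotation of the hyperbolic plane of u_n and v_n into three transvections. *)
Lemma c_last_factor g r : g \in c_elt K ord_max -> rho_transvection r -> r \in Sp ->
  exists x : gT, [/\ x \in Sp_fixM K n, g = (x * r * x)%g &
    forall v, sp_act x v = v - v (rshift N ord_max) 0 *: u_ ord_max].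
Proof.
move=> Cg rP Gr.
have sS : siegel_last^T = siegel_last by rewrite /siegel_last raddfN /= trmx_delta.
have [x Sx Ex] := sp_siegel sS.
have xE v : sp_act x v = v - v (rshift N ord_max) 0 *: u_ ord_max.
  rewrite Ex -[v in RHS]vsubmxK; apply/colP=> c; case: (split_ordP c) => j ->.
    rewrite col_mxEu coordD coordN coordZ col_mxEu col_mxEd -e_l e_E.
    rewrite (inj_eq (@lshift_inj _ _)) mxE; congr (_ + _).
    rewrite /siegel_last mulNmx [LHS]mxE mxE (bigD1 ord_max) //= big1 => [|k ne].
      by rewrite !mxE eqxx andbT addr0 mulrC.
    by rewrite !mxE (negPf ne) andbF mul0r.
  by rewrite col_mxEd coordD coordN coordZ !col_mxEd -e_l e_E eq_rlshift mulr0 subr0.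
exists x; split=> //; have xu k : sp_act x (u_ k) = u_ k by apply: Sp_fixM_act Sx (u_spanM K k).
have xv k : k != ord_max -> sp_act x (v_ k) = v_ k.
  move=> ne; rewrite xE -e_r e_E (inj_eq (@rshift_inj _ _)) eq_sym (negPf ne).
  by rewrite scale0r subr0.
have xvm : sp_act x (v_ ord_max) = v_ ord_max - u_ ord_max.
  by rewrite xE -e_r e_E eqxx scale1r.
have ru k : k != ord_max -> sp_act r (u_ k) = u_ k.
  move=> ne; rewrite rP sp_form_v -e_l e_E (inj_eq (@lshift_inj _ _)) eq_sym (negPf ne).
  by rewrite oppr0 scale0r subr0.
have rum : sp_act r (u_ ord_max) = u_ ord_max + v_ ord_max.
  by rewrite rP sp_form_v -e_l e_E eqxx scaleN1r opprK.
have rv k : sp_act r (v_ k) = v_ k.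
  by rewrite rP sp_form_NN ?v_spanN // scale0r subr0.
have [_ gu gv gk] := c_eltP _ _ Cg; apply: sp_act_uv_inj => k; rewrite !sp_actM.
  have [->|ne] := eqVneq k ord_max; last by rewrite xu ru // xu; case: (gk k ne).
  by rewrite gu xu rum sp_actD xu xvm addrC subrK.
have [->|ne] := eqVneq k ord_max; last by rewrite xv // rv xv //; case: (gk k ne).
rewrite gv xvm sp_actD sp_actN rum rv opprD [- _ - _]addrC addrA subrr add0r.
by rewrite sp_actN xu.
Qed.

(** The Siegel parabolic subgroup and rho generate the symplectic group: they produce
the Borel subgroup and representatives of the Weyl group. *)
Lemma Sp_ind (Q : pred gT) :
  (forall s, s \in Sp_fixM K n -> Q s) -> (forall a, a \in Sp_stabMN K n -> Q a) ->
  (forall r, r \in Sp -> rho_transvection r -> Q r) ->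
  (forall g h, g \in Sp -> h \in Sp -> Q g -> Q h -> Q (g * h)%g) ->
  forall g, g \in Sp -> Q g.
Proof.
move=> Qs Qa Qr QM.
pose R : {set gT} := [set g in Sp | Q g].
have gR : group_set R.
  apply/group_setP; split=> [|g h /setIdP[Gg Qg] /setIdP[Gh Qh]]; apply/setIdP.
    by split; [exact: group1 | apply: Qs; exact: one_fixM].
  by split; [exact: glM | exact: QM].
pose RG := Group gR.
have aR a : a \in Sp_stabMN K n -> a \in RG.
  by move=> Sa; apply/setIdP; split; [exact: stab_Sp | exact: Qa].
have sR s : s \in Sp_fixM K n -> s \in RG.
  by move=> Ss; apply/setIdP; split; [exact: fixM_Sp | exact: Qs].
have [r Gr rP] := rho_transvection_exists K n.
have rR : r \in RG by apply/setIdP; split=> //; apply: Qr.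
have cmR g : g \in c_elt K ord_max -> g \in RG.
  by move=> Cg; have [x [Sx -> _]] := c_last_factor Cg rP Gr; apply: glM (glM (sR _ Sx) rR) (sR _ Sx).
have cR g j : g \in c_elt K j -> g \in RG.
  move=> Cg; have [c Cc] := set0Pn _ (c_elt_neq0 K (ord_max : 'I_N)).
  have [s Ss] := set0Pn _ (swap_elt_neq0 K (ord_max : 'I_N) j).
  rewrite (c_uniq Cg (c_conj Cc Ss)).
  have sRG := aR _ (swap_stab Ss).
  exact: glM (glM sRG (cmR _ Cc)) (glVr sRG).
have WR w : w \in W2 K n -> w \in RG.
  apply: subsetP; rewrite gen_subG; apply/subsetP=> g; rewrite inE => /orP[|] /bigcupP[i _].
    by case/bigcupP=> j _ /swap_stab/aR.
  exact: cR.
have BR b : b \in borel K n -> b \in RG.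
  by case/borel_siegel=> a [s [Sa Ss ->]]; apply: glM (aR _ Sa) (sR _ Ss).
move=> g /bruhat[b [w [b' [Bb Ww Bb' ->]]]].
have : (b * w * b')%g \in RG by apply: glM (glM (BR _ Bb) (WR _ Ww)) (BR _ Bb').
by case/setIdP.
Qed.

End Generation.

(** * The Weil module of degree (q^n - 1)/2 *)

Section WeilModule.

Variables (K : finFieldType) (n : nat) (F : fieldType).
Hypotheses (F2 : 2%N \in [pchar F]) (oddK : odd #|K|) (K2 : (2%:R : K) != 0).
Local Notation N := n.+1.
Local Notation gT := {'GL_(n.+1 + n.+1)[K]}.
Local Notation V := 'cV[K]_(n.+1 + n.+1).
Local Notation Sp := (Sp K n).
Local Notation spanN := (spanN K n).
Local Notation fixM := (Sp_fixM K n).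
Local Notation stabMN := (Sp_stabMN K n).
Local Notation d := #|spanN|.
Local Notation eps := (@eps K n F).
Local Notation v_ := (@sp_v K n).
Local Notation Y := (weil_minus K n F).
Local Notation iota := (iota_op K n F).
Local Notation spanN0 := (spanN0 K n).
Implicit Types (x v w : V) (g h s a r : gT) (y z : 'rV[F]_d).

Lemma F2_oppv k (w : 'rV[F]_k) : - w = w.
Proof. by apply/eqP; rewrite -subr_eq0 -opprD (F2_addv F2) oppr0. Qed.

Lemma co0 x : co (0 : 'rV[F]_d) x = 0. Proof. exact: mxE. Qed.

(** In characteristic 2 this is also 1 - iota, whose image is Y^-. *)
Definition diff_op : 'M[F]_d := 1%:M + iota.

Lemma eps_diff x : x \in spanN -> eps x *m diff_op = eps x + eps (- x).
Proof. by move=> Nx; rewrite mulmxDr mulmx1 eps_iota. Qed.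

Lemma iota_sq : iota *m iota = 1%:M.
Proof.
by apply: eps_mx_inj => x Nx; rewrite mulmxA !eps_iota ?spanN_N // opprK mulmx1.
Qed.

Lemma weil_minus_diff : (Y :=: diff_op)%MS.
Proof.
apply/eqmxP/andP; split.
  apply/sumsmx_subP=> x /andP[Nx _]; rewrite genmxE.
  have -> : eps x - eps (- x) = eps x *m diff_op.
    by rewrite eps_diff // F2_oppv.
  exact: submxMl.
apply/row_subP=> i; rewrite rowE -eps_val.
have := enum_valP i; move: (enum_val i) => x Nx; rewrite eps_diff //.
have [->|x0] := eqVneq x 0; first by rewrite oppr0 (F2_addv F2) sub0mx.
apply: (sumsmx_sup x); rewrite ?Nx // genmxE.
by rewrite F2_oppv.
Qed.

Lemma co_diff z : co (z *m diff_op) 0 = 0.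
Proof.
by rewrite mulmxDr mulmx1 coD co_iota ?spanN0 // oppr0 (F2_add F2).
Qed.

Lemma diff_sym z : (z <= diff_op)%MS -> z *m iota = z.
Proof.
case/submxP=> w ->; rewrite -mulmxA; congr (_ *m _).
by rewrite mulmxDl mul1mx iota_sq addrC.
Qed.

Lemma co_minus z : (z <= diff_op)%MS -> co z 0 = 0.
Proof. by case/submxP=> w ->; apply: co_diff. Qed.

Lemma sym_co z x : x \in spanN -> z *m iota = z -> co z (- x) = co z x.
Proof. by move=> Nx zI; rewrite -co_iota // zI. Qed.

(** Grouping the indices x and -x writes such a vector as a combination of vectors
eps_x + eps_(-x), up to its coordinate at the only fixed index 0. *)
Lemma sym_minus z : z *m iota = z -> (z - co z 0 *: eps 0 <= diff_op)%MS.
Proof.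
move=> zI; have -> : z - co z 0 *: eps 0 = \sum_(x in spanN | x != 0) co z x *: eps x.
  by rewrite {1}[z]sum_eps (bigD1 0) ?spanN0 //= [X in X - _]addrC addrK.
pose r x := (enum_rank x : nat); rewrite (bigID (fun x => (r x < r (- x))%N)) /=.
rewrite [X in _ + X](reindex_inj oppr_inj) /=.
have -> : \sum_(j | (- j \in spanN) && (- j != 0) && ~~ (r (- j) < r (- - j))%N) co z (- j) *: eps (- j) =
   \sum_(x in spanN | (x != 0) && (r x < r (- x))%N) co z x *: eps (- x).
  apply: eq_big => x.
    rewrite opprK oppr_eq0; have -> : (- x \in spanN) = (x \in spanN).
      by apply/idP/idP => /spanN_N //; rewrite opprK.
    case Nx: (x \in spanN) => //=; case x0: (x != 0) => //=; rewrite -leqNgt ltn_neqAle.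
    suff -> : r x != r (- x) by [].
    apply: contraTN x0 => /eqP/ord_inj/enum_rank_inj/esym/(oppr_fix K2)->.
    by rewrite eqxx.
  move=> /andP[/andP[Nx _] _]; congr (_ *: _).
  by rewrite sym_co // -[x]opprK spanN_N.
rewrite [X in X + _](eq_bigl (fun x => (x \in spanN) && ((x != 0) && (r x < r (- x))%N))); last first.
  by move=> x; rewrite andbA.
rewrite -big_split /=; apply: summx_sub => x /andP[Nx _].
by rewrite -scalerDr -eps_diff // scalemx_sub // submxMl.
Qed.

Lemma diff_op_sq : diff_op *m diff_op = 0.
Proof.
rewrite mulmxDl mul1mx mulmxDr mulmx1 iota_sq [iota + _]addrC; exact: F2_addm.
Qed.

Lemma ker_diff : (kermx diff_op :=: eps 0%R + diff_op)%MS.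
Proof.
apply/eqmxP/andP; split.
  apply/rV_subP=> z /sub_kermxP zD.
  have zI : z *m iota = z.
    apply/eqP; rewrite -subr_eq0; move/eqP: zD; rewrite mulmxDr mulmx1 addrC.
    by rewrite F2_oppv.
  rewrite -[z](subrK (co z 0 *: eps 0)) addrC.
  by apply: addmx_sub_adds; [exact: scalemx_sub | exact: sym_minus].
rewrite addsmx_sub; apply/andP; split; apply/sub_kermxP; last exact: diff_op_sq.
by rewrite eps_diff ?spanN0 // oppr0 (F2_addv F2).
Qed.

Lemma card_spanN : d = (#|K| ^ N)%N.
Proof.
have -> : spanN = [set col_mx 0 x | x : 'cV[K]_N] :> {set V}.
  apply/setP=> x; rewrite in_spanN; apply/eqP/imsetP => [x0|[y _ ->]]; last by rewrite col_mxKu.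
  by exists (dsubmx x); rewrite // -[LHS]vsubmxK x0.
rewrite card_imset; first by rewrite card_mx muln1.
by move=> x y /(congr1 dsubmx); rewrite !col_mxKd.
Qed.

Lemma rank_diff : ((\rank diff_op).*2.+1 = #|K| ^ N)%N.
Proof.
rewrite -card_spanN -addnn -addSn.
have : \rank (kermx diff_op) = (1 + \rank diff_op)%N.
  rewrite ker_diff mxrank_disjoint_sum.
    congr addn; apply/eqP; rewrite eqn_leq rank_leq_row lt0n mxrank_eq0.
    apply/eqP=> /(congr1 (fun z => co z 0)); rewrite co_eps ?spanN0 // eqxx /co mxE.
    by move/eqP; rewrite oner_eq0.
  apply/eqP; rewrite -submx0; apply/rV_subP=> z; rewrite sub_capmx => /andP[/sub_rVP[c ->]] /co_minus.
  by rewrite coZ co_eps ?spanN0 // eqxx mulr1 => ->; rewrite scale0r sub0mx.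
rewrite mxrank_ker add1n => <-; rewrite subnK //; exact: rank_leq_row.
Qed.

Lemma rank_weil_minus : \rank Y = ((#|K| ^ N).-1 %/ 2)%N.
Proof. by rewrite weil_minus_diff -rank_diff /= divn2 doubleK. Qed.

(** * Quadratic forms given by the Siegel radical *)

Lemma quad_delta (i j : 'I_N) (w : 'cV[K]_N) :
  ((delta_mx i j *m w)^T *m w) 0 0 = w i 0 * w j 0.
Proof.
rewrite mxE (bigD1 i) //= big1 ?addr0 => [|k ne].
  rewrite !mxE (bigD1 j) //= big1 ?addr0 => [|k ne].
    by rewrite mxE !eqxx mul1r mulrC.
  by rewrite mxE (negPf ne) andbF mul0r.
by rewrite !mxE big1 ?mul0r // => l _; rewrite mxE (negPf ne) mul0r.
Qed.

Lemma siegel_prod (i j : 'I_N) (t : K) : exists2 s, s \in fixM &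
  forall v, v \in spanN ->
    sp_form (sp_act s v) v = t * (v (rshift N i) 0 * v (rshift N j) 0).
Proof.
pose S : 'M[K]_N := (t / 2%:R) *: (delta_mx i j + delta_mx j i).
have sS : S^T = S by rewrite /S linearZ /= raddfD /= !trmx_delta addrC.
have [s Ss Es] := sp_siegel sS; exists s => // v Nv.
rewrite Es sp_formE !col_mxKu !col_mxKd; move: Nv; rewrite in_spanN => /eqP->.
rewrite mulmx0 subr0 add0r /S -scalemxAl linearZ /= -scalemxAl mulmxDl raddfD mulmxDl /=.
rewrite mxE [X in _ * X]mxE !quad_delta !mxE.
by field.
Qed.

(** A character of the Siegel radical determines the quadratic monomials in the
coordinates of the vector it comes from; the factor k allows for a twist of the additive
character. *)
Lemma siegel_char_inj (lam : K -> F) (k : K) v w : nontrivial_char lam ->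
  v \in spanN -> w \in spanN ->
  (forall s, s \in fixM ->
     lam (sp_form (sp_act s v) v) = lam (k * sp_form (sp_act s w) w)) ->
  forall i j : 'I_N,
    v (rshift N i) 0 * v (rshift N j) 0 = k * (w (rshift N i) 0 * w (rshift N j) 0).
Proof.
move=> [lam0 lamD [b nb]] Nv Nw E i j.
set x := (X in X = _); set y := (X in _ = X); apply/eqP; rewrite -subr_eq0.
apply: contraNT nb => nz; have [s Ss Es] := siegel_prod i j (b / (x - y)).
have := E s Ss; rewrite !Es // -/x (mulrCA k) -/y => El; apply/eqP.
by rewrite -[b](divfK nz) mulrBr lamD El -lamD subrr lam0.
Qed.

Lemma spanN_rshift_eq v w : v \in spanN -> w \in spanN ->
  (forall i : 'I_N, v (rshift N i) 0 = w (rshift N i) 0) -> v = w.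
Proof.
move=> Nv Nw E; apply/colP=> c; case: (split_ordP c) => i -> //.
by rewrite !(spanN_coord _ Nv, spanN_coord _ Nw).
Qed.

Lemma spanN_nz v : v \in spanN -> v != 0 -> exists i : 'I_N, v (rshift N i) 0 != 0.
Proof.
move=> Nv v0; apply/existsP; apply: contraNT v0 => /existsPn E; apply/eqP.
apply: spanN_rshift_eq => // [|i]; first by rewrite ?spanN0.
by rewrite mxE; apply/eqP; move: (E i); rewrite negbK.
Qed.

Lemma siegel_char_sep (lam : K -> F) v w : nontrivial_char lam -> v \in spanN -> w \in spanN ->
  v != 0 -> (forall s, s \in fixM -> lam (sp_form (sp_act s v) v) = lam (sp_form (sp_act s w) w)) ->
  w = v \/ w = - v.
Proof.
move=> lamP Nv Nw v0 E.
have E1 s : s \in fixM -> lam (sp_form (sp_act s v) v) = lam (1 * sp_form (sp_act s w) w).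
  by rewrite mul1r; apply: E.
have prod := siegel_char_inj lamP Nv Nw E1; have [i nz] := spanN_nz Nv v0.
have := prod i i; rewrite mul1r -!expr2 => /eqP; rewrite eqf_sqr => /orP[] /eqP Ei; [left|right].
  apply: spanN_rshift_eq => // j; apply: (mulfI nz).
  by rewrite (prod i j) mul1r -Ei.
apply: spanN_rshift_eq => // [|j]; first exact: spanN_N.
by apply: (mulfI nz); rewrite coordN mulrN (prod i j) mul1r Ei mulNr.
Qed.

(** The Levi subgroup acts on N as the full linear group. *)
Lemma levi_transitive v w : v \in spanN -> w \in spanN -> v != 0 -> w != 0 ->
  exists2 a, a \in stabMN & sp_act a v = w.
Proof.
move=> Nv Nw v0 w0; set v' := (dsubmx v)^T; set w' := (dsubmx w)^T.
have nz x : x \in spanN -> x != 0 -> (dsubmx x)^T != 0.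
  rewrite in_spanN => /eqP ux; apply: contraNneq => /(congr1 trmx); rewrite trmxK trmx0 => dx.
  by rewrite -[x]vsubmxK ux dx col_mx0.
have rk (x : 'rV[K]_N) : x != 0 -> \rank x = 1%N by move=> x0; rewrite rank_rV x0.
have v'w' : v' *m (pinvmx v' *m w') = w'.
  by rewrite mulmxA mulmxVp ?mul1mx // /row_free rk ?nz.
have [|B uB EB] := @complete_unitmx _ _ _ v' (pinvmx v' *m w').
  by rewrite v'w' !rk ?nz.
have uA : invmx B \in unitmx by rewrite unitmx_inv.
have [a Sa Ea] := sp_levi uA; exists a => //; rewrite Ea invmxK.
move: (Nv) (Nw); rewrite !in_spanN => /eqP uv /eqP uw.
rewrite uv mulmx0 -[RHS]vsubmxK uw; congr col_mx; apply: trmx_inj.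
by rewrite trmx_mul trmxK -/v' -EB v'w'.
Qed.

Lemma eps_diff_co v w : v \in spanN -> w \in spanN ->
  co (eps v *m diff_op) w = (w == v)%:R + (w == - v)%:R.
Proof. by move=> Nv Nw; rewrite eps_diff // coD !co_eps ?spanN_N. Qed.

(** * The Weil representation in characteristic 2 *)

Section Action.

Variables (lam : K -> F) (P : mx_representation F Sp d).
Hypotheses (lamP : nontrivial_char lam) (PW : weil_repr lam P).

Lemma weil_fixM s v : s \in fixM -> v \in spanN ->
  eps v *m P s^-1%g = lam (sp_form (sp_act s v) v) *: eps v.
Proof.
move=> Ss Nv; have [PW1 _] := PW; have := PW1 s 1%g v Ss (one_stab K n) Nv.
by rewrite mulg1 gl_lactE sp_act1 (theta1 F2) expr1n mul1r.
Qed.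

Lemma weil_stab a v : a \in stabMN -> v \in spanN -> eps v *m P a^-1%g = eps (sp_act a v).
Proof.
move=> Sa Nv; have [PW1 _] := PW; have := PW1 1%g a v (one_fixM K n) Sa Nv.
by rewrite mul1g gl_lactE sp_form_xx (lam0 lamP) (theta1 F2) expr1n mul1r scale1r.
Qed.

Lemma weil_rho r v : r \in Sp -> rho_transvection r -> v \in spanN ->
  eps v *m P r^-1%g = \sum_(c : K) lam (c ^+ 2) *: eps (v + c *: v_ ord_max).
Proof.
move=> Gr rP Nv; have [_ PW2] := PW; have := PW2 r v Gr rP Nv.
by rewrite gl_lactE (gauss_sum F2 K2 lamP) invr1 scale1r.
Qed.

Lemma weil_iotaC g : g \in Sp -> iota *m P g = P g *m iota.
Proof.
move=> Gg; have [|x y|m Gm Em] := @Sp_of_fun K n -%R.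
- by move=> k x y; rewrite opprD scalerN.
- by rewrite sp_formNl sp_formNr opprK.
have Sm : m \in stabMN.
  apply/Sp_stabMNP; split=> // i; rewrite Em; first by rewrite spanM_N ?u_spanM.
  by rewrite spanN_N ?v_spanN.
have -> : iota = P m^-1%g.
  by apply: eps_mx_inj => v Nv; rewrite eps_iota // weil_stab // Em.
rewrite -!repr_mxM ?(glVr Gm) //; congr (P _).
apply: gl_mulVg_comm; apply: sp_act_eqP => b.
by rewrite !sp_actM !Em sp_actN.
Qed.

Lemma weil_diffC g : g \in Sp -> diff_op *m P g = P g *m diff_op.
Proof.
by move=> Gg; rewrite mulmxDl mulmxDr mulmx1 mul1mx weil_iotaC.
Qed.

Lemma diff_module : mxmodule P diff_op.
Proof. by apply/mxmoduleP=> g Gg; rewrite weil_diffC // submxMl. Qed.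

Lemma weil_minus_module : mxmodule P Y.
Proof. by rewrite (eqmx_module _ weil_minus_diff) diff_module. Qed.

Lemma co_weil_fixM s y x : s \in fixM -> x \in spanN ->
  co (y *m P s^-1%g) x = lam (sp_form (sp_act s x) x) * co y x.
Proof.
move=> Ss Nx; rewrite [y in LHS]sum_eps mulmx_suml co_sum (bigD1 x) //= big1 ?addr0.
  by rewrite -scalemxAl weil_fixM // !coZ co_eps // eqxx mulr1 mulrC.
move=> x' /andP[Nx' ne']; rewrite -scalemxAl weil_fixM // !coZ co_eps // eq_sym.
by rewrite (negPf ne') !mulr0.
Qed.

(** Induction on the number of nonzero coordinates of y. If v and w are two indices of y
that do not differ by sign, some s of the Siegel radical has different eigenvalues
there, and replacing y by y s - q_w y kills the coordinate of w but not that of v. *)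
Lemma support_step (k : nat) (U : 'M[F]_d) y : mxmodule P U -> (U <= diff_op)%MS -> (y <= U)%MS ->
  y != 0 -> (#|[set x in spanN | co y x != 0%R]| <= k)%N ->
  exists v, [/\ v \in spanN, v != 0 & (eps v *m diff_op <= U)%MS].
Proof.
move=> modU UY; elim: k y => [|k IH] y yU y0 ck.
  move: ck; rewrite leqn0 cards_eq0 => /eqP E0; case/eqP: y0; apply: co_inj => x Nx.
  rewrite [RHS]mxE; apply/eqP; apply: contraT => nz.
  have: x \in [set x in spanN | co y x != 0] by apply/setIdP.
  by rewrite E0 inE.
have yI := diff_sym (submx_trans yU UY); have y00 := co_minus (submx_trans yU UY).
have [v /andP[Nv cv]] : exists v, (v \in spanN) && (co y v != 0).
  apply/existsP; apply: contraNT y0 => /existsPn E; apply/eqP/co_inj => x Nx.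
  by have := E x; rewrite Nx negbK => /eqP->; rewrite /co mxE.
have v0 : v != 0 by apply: contraNneq cv => ->; rewrite y00.
have [/exists_inP[w Nw /and3P[cw wv wNv]]|none] :=
  boolP [exists w in spanN, [&& co y w != 0, w != v & w != - v]]; last first.
  exists v; split=> //; suff -> : eps v *m diff_op = (co y v)^-1 *: y by apply: scalemx_sub.
  apply: co_inj => x Nx; rewrite eps_diff_co // coZ.
  have [->|xv] := eqVneq x v.
    have [vNv|_] := eqVneq v (- v); last by rewrite addr0 mulVf.
    by case/eqP: v0; apply: (oppr_fix K2).
  have [->|xNv] := eqVneq x (- v); first by rewrite add0r sym_co // mulVf.
  move/exists_inPn: none => /(_ x Nx); rewrite xv xNv !andbT negbK => /eqP->.
  by rewrite mulr0 addr0.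
have [/exists_inP[s Ss ne]|none] :=
  boolP [exists s in fixM, lam (sp_form (sp_act s v) v) != lam (sp_form (sp_act s w) w)]; last first.
  have E0 s : s \in fixM -> lam (sp_form (sp_act s v) v) = lam (sp_form (sp_act s w) w).
    by move=> Ss; move/exists_inPn: none => /(_ s Ss); rewrite negbK => /eqP.
  have [E|E] := siegel_char_sep lamP Nv Nw v0 E0; first by rewrite E eqxx in wv.
  by rewrite E eqxx in wNv.
have Gs := glVr (fixM_Sp Ss).
pose q x := lam (sp_form (sp_act s x) x).
pose y' := y *m P s^-1%g - q w *: y.
have cy' x : x \in spanN -> co y' x = (q x - q w) * co y x.
  move=> Nx; rewrite coD [co (- _) x]mxE -[(_ *: y) 0 _]/(co _ x) coZ mulrBl; congr (_ - _).
  exact: co_weil_fixM.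
apply: (IH y').
- rewrite addmx_sub ?eqmx_opp ?scalemx_sub //.
  exact: submx_trans (submxMr _ yU) (mxmoduleP modU _ Gs).
- apply: contraNneq cv => y'0; have := cy' v Nv; rewrite y'0 co0 => /esym/eqP.
  by rewrite mulf_eq0 subr_eq0 (negPf ne).
rewrite -ltnS; apply: leq_trans ck; apply: proper_card; apply/properP; split.
  apply/subsetP=> x /setIdP[Nx nz]; apply/setIdP; split=> //.
  by move: nz; rewrite cy' // mulf_eq0 negb_or => /andP[].
exists w; first by apply/setIdP.
by apply/negP=> /setIdP[_]; rewrite cy' // subrr mul0r eqxx.
Qed.

(** The Siegel radical acts on Y by distinct characters, up to sign of the index, and
the Levi subgroup permutes the nonzero indices transitively. *)
Lemma diff_simple : mxsimple P diff_op.
Proof.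
have v0 : v_ ord_max != 0 by rewrite -e_r e_neq0.
split; first exact: diff_module.
  apply: contraNneq v0 => D0; have := eps_diff_co (v_spanN K ord_max) (v_spanN K ord_max).
  rewrite D0 mulmx0 /co mxE eqxx; have [E|_] := eqVneq (v_ ord_max) (- v_ ord_max).
    by rewrite (oppr_fix K2 (esym E)) // eqxx.
  by move/eqP; rewrite addr0 eq_sym oner_eq0.
move=> U modU UY /rowV0Pn[y yU y0].
have [v [Nv vn0 vU]] := support_step modU UY yU y0 (leqnn _).
apply/row_subP=> i; rewrite rowE -eps_val.
have := enum_valP i; move: (enum_val i) => w Nw.
have [->|w0] := eqVneq w 0; first by rewrite eps_diff ?spanN0 // oppr0 (F2_addv F2) sub0mx.
have [a Sa <-] := levi_transitive Nv Nw vn0 w0.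
have Ga := glVr (stab_Sp Sa).
rewrite -weil_stab // -mulmxA -weil_diffC // mulmxA.
exact: submx_trans (submxMr _ vU) (mxmoduleP modU _ Ga).
Qed.

Lemma weil_minus_simple : mxsimple P Y.
Proof.
apply: (mx_iso_simple _ diff_simple); apply: eqmx_iso; apply: eqmx_sym; exact: weil_minus_diff.
Qed.

End Action.

End WeilModule.

(** * From the Weil representation to functions on chambers *)

Section Embedding.

Variables (K : finFieldType) (n : nat) (F : fieldType).
Hypotheses (F2 : 2%N \in [pchar F]) (oddK : odd #|K|) (K2 : (2%:R : K) != 0).
Local Notation N := n.+1.
Local Notation gT := {'GL_(n.+1 + n.+1)[K]}.
Local Notation V := 'cV[K]_(n.+1 + n.+1).
Local Notation Sp := (Sp K n).
Local Notation spanN := (spanN K n).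
Local Notation fixM := (Sp_fixM K n).
Local Notation stabMN := (Sp_stabMN K n).
Local Notation borel := (borel K n).
Local Notation d := #|spanN|.
Local Notation eps := (@eps K n F).
Local Notation u_ := (@sp_u K n).
Local Notation v_ := (@sp_v K n).
Local Notation iota := (iota_op K n F).
Local Notation spanN0 := (spanN0 K n).
Local Notation lreg := (lreg_repr F Sp).
Local Notation ones := (ones K n F).
Variables (lam : K -> F) (P : mx_representation F Sp d).
Hypotheses (lamP : nontrivial_char lam) (PW : weil_repr lam P).
Implicit Types (x v w : V) (g h s a r : gT) (y z : 'rV[F]_d).

Lemma co_unfixed z g : g \in Sp ->
  (forall z, co (z *m P g^-1%g) 0 = co z 0) -> co (z *m P g) 0 = co z 0.
Proof.
move=> Gg E; rewrite -[RHS](congr1 (fun z => co z 0) (mulmx1 z)).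
have -> : 1%:M = P g *m P g^-1%g by rewrite -gl_reprM ?(glVr Gg) // -(repr_mx1 P); congr (P _); rewrite mulgV.
by rewrite mulmxA E.
Qed.

Lemma co_mulmx z (M : 'M[F]_d) x : co (z *m M) x =
  \sum_(x' in spanN) co z x' * co (eps x' *m M) x.
Proof.
by rewrite {1}[z]sum_eps mulmx_suml co_sum; apply: eq_bigr => x' _; rewrite -scalemxAl coZ.
Qed.

Lemma co_fixM s z : s \in fixM -> co (z *m P s^-1%g) 0 = co z 0.
Proof.
move=> Ss; rewrite [z in LHS]sum_eps mulmx_suml co_sum (bigD1 0) ?spanN0 //= big1 ?addr0.
  rewrite -scalemxAl (weil_fixM F2 PW) ?spanN0 // sp_form0r (lam0 lamP) scale1r.
  by rewrite coZ co_eps ?spanN0 // eqxx mulr1.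
move=> x /andP[Nx x0]; rewrite -scalemxAl (weil_fixM F2 PW) // !coZ co_eps ?spanN0 //.
by rewrite eq_sym (negPf x0) !mulr0.
Qed.

Lemma co_stab a z : a \in stabMN -> co (z *m P a^-1%g) 0 = co z 0.
Proof.
move=> Sa; rewrite [z in LHS]sum_eps mulmx_suml co_sum (bigD1 0) ?spanN0 //= big1 ?addr0.
  rewrite -scalemxAl (weil_stab F2 lamP PW) ?spanN0 // sp_act0.
  by rewrite coZ co_eps ?spanN0 // eqxx mulr1.
move=> x /andP[Nx x0]; rewrite -scalemxAl (weil_stab F2 lamP PW) // !coZ co_eps ?spanN0 ?(stab_N Sa) //.
by rewrite -(sp_act0 a) (inj_eq (@sp_act_inj _ _ a)) eq_sym (negPf x0) !mulr0.
Qed.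

Lemma co_borel b z : b \in borel -> co (z *m P b) 0 = co z 0.
Proof.
move=> Bb; apply: co_unfixed => //; first exact: borel_Sp.
move=> {}z; have [a [s [Sa Ss ->]]] := borel_siegel Bb.
rewrite gl_invM gl_reprM ?(glVr (stab_Sp Sa)) ?(glVr (fixM_Sp Ss)) // mulmxA.
by rewrite co_stab // co_fixM.
Qed.

Lemma sum_lam k : k != 0 -> \sum_(c : K) lam (c * k) = 0.
Proof.
move=> k0; have [_ lamD [b nb]] := lamP.
by apply: (sum_char0 (b := b / k)) => [x y|]; rewrite ?mulrDl ?lamD ?divfK.
Qed.

(** The element c_n acts by a partial Fourier transform in the last coordinate. *)
Lemma co_c g v : g \in c_elt K ord_max -> v \in spanN ->
  co (eps v *m P g^-1%g) 0 = (v == v (rshift N ord_max) 0 *: v_ ord_max)%:R.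
Proof.
move=> Cg Nv; have [r Gr rP] := rho_transvection_exists K n.
have [x [Sx -> Ex]] := c_last_factor Cg rP Gr.
have Gx := fixM_Sp Sx.
rewrite !gl_invM !gl_reprM ?(glVr Gx) ?(glVr Gr) ?(glM (glVr Gr) (glVr Gx)) // !mulmxA.
rewrite co_fixM // (weil_fixM F2 PW) // -scalemxAl (weil_rho F2 K2 lamP PW) // coZ co_sum.
set b := v (rshift N ord_max) 0; have vb c : 0 == v + c *: v_ ord_max -> c = - b.
  move=> /eqP/colP/(_ (rshift N ord_max)); rewrite coordD coordZ -e_r e_E eqxx mulr1 mxE.
  by move/esym/eqP; rewrite addrC addr_eq0 => /eqP.
have coc c : co (lam (c ^+ 2) *: eps (v + c *: v_ ord_max)) 0 =
    lam (c ^+ 2) * (0 == v + c *: v_ ord_max)%:R.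
  by rewrite coZ co_eps ?spanN0 // spanN_D // spanN_Z ?v_spanN.
rewrite (bigD1 (- b)) //= big1 => [|c ne]; last first.
  by rewrite coc; case: eqP => [/eqP/vb E|_]; rewrite ?mulr0 // E eqxx in ne *.
rewrite addr0 coc scaleNr [0 == _]eq_sym subr_eq0 sqrrN mulrA -(lamD lamP) Ex -/b.
rewrite sp_formDl sp_formNl sp_formZl sp_form_xx sp_form_u -/b add0r -expr2 addNr.
by rewrite (lam0 lamP) mul1r.
Qed.

(** The orbit map of a vector: the function on the group giving the coordinate of index
0 of its translates. *)
Definition orbit_mx : 'M[F]_(d, #|Sp|) :=
  \matrix_(i, j) P (enum_val j) i (enum_rank_in spanN0 0).

Lemma fn_orbit z g : g \in Sp -> fn (z *m orbit_mx) g = co (z *m P g) 0.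
Proof.
move=> Gg; rewrite /fn /co !mxE; apply: eq_bigr => i _.
by rewrite mxE gring_indexK.
Qed.

Lemma orbit_mxJ g : g \in Sp -> P g *m orbit_mx = orbit_mx *m lreg g.
Proof.
move=> Gg; apply: eps_mx_inj => x Nx; apply: fn_inj => h Gh.
rewrite !mulmxA fn_lreg // !fn_orbit ?(glM Gg Gh) //.
by rewrite gl_reprM // mulmxA.
Qed.

(** For the long root, the panel condition says that averaging lambda over the root
subgroup kills all indices but 0, and that 0 is counted twice; for the short roots the q
+ 1 chambers of a panel lie over one Lagrangian, and q + 1 is even. *)
Lemma orbit_panel z : panel_space (fn (z *m orbit_mx)).
Proof.
split=> [g b Gg Bb|i g Gg].
  rewrite !fn_orbit ?(glM Gg (borel_Sp Bb)) // gl_reprM ?(borel_Sp Bb) //.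
  by rewrite mulmxA co_borel.
have fB g' b' : g' \in Sp -> b' \in borel -> fn (z *m orbit_mx) (g' * b')%g = fn (z *m orbit_mx) g'.
  move=> Gg' Bb; rewrite !fn_orbit ?(glM Gg' (borel_Sp Bb)) // gl_reprM ?(borel_Sp Bb) //.
  by rewrite mulmxA co_borel.
have [X XP] := root_exists K i.
have GX (a : K) : X a \in Sp by case: (XP a) => /borel_Sp.
have [iN|iN] := ltnP i n.
  have i1N : (i.+1 < N)%N by [].
  have [r Sr] := set0Pn _ (swap_elt_neq0 K i (Ordinal i1N)).
  have rP : is_refl i r by apply: swap_refl Sr.
  have Sar := swap_stab Sr; have Gr := stab_Sp Sar.
  rewrite (panel_sum rP XP) // fn_orbit // (eq_bigr (fun=> co (z *m P g) 0)) => [|a _].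
    by rewrite sumr_const -mulr_natl (odd_natr F2 oddK) mul1r (F2_add F2).
  rewrite fn_orbit ?(glM Gg (glM (GX a) Gr)) // gl_reprM ?(glM (GX a) Gr) //.
  rewrite gl_reprM // !mulmxA co_unfixed => [|//|z']; last exact: co_stab.
  by rewrite co_borel //; case: (XP a).
have im : i = ord_max by apply: val_inj; apply/eqP; rewrite eqn_leq iN -ltnS ltn_ord.
move: XP; rewrite im => XP.
have [r Cr] := set0Pn _ (c_elt_neq0 K (ord_max : 'I_N)).
have rP : is_refl ord_max r by apply: c_refl Cr.
rewrite (panel_sum rP XP) // fn_orbit //.
have [Gr ru rv rk] := c_eltP _ _ Cr.
have nxtE : nxt ord_max = rshift N ord_max :> 'I_(N + N) by rewrite /nxt ltnn.
have XE (a : K) v : sp_act (X a) v = v + (a * v (rshift N ord_max) 0) *: u_ ord_max.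
  have [_ Xn Xc] := XP a; rewrite nxtE in Xn Xc.
  rewrite [v in LHS]sum_e sp_act_sum (bigD1 (rshift N ord_max)) //= sp_actZ Xn scalerDr scalerA.
  rewrite [X in _ = X + _]sum_e [X in _ = X + _](bigD1 (rshift N ord_max)) //=.
  rewrite addrAC [a * _]mulrC; congr (_ + _ + _).
  apply: eq_bigr => c ne; rewrite sp_actZ; have [k -> k0] := Xc c ne.
  by rewrite k0 ?scale0r ?addr0 // dual_l.
(* In the coordinate b at v_n, X a acts on eps_v by lambda(- a b^2). *)
have SX (a : K) : (X a)^-1%g \in fixM.
  have Xu j : sp_act (X a) (u_ j) = u_ j.
    by rewrite XE -e_l e_E eq_rlshift mulr0 scale0r addr0.
  apply/Sp_fixMP; split=> [|j]; first exact: glVr.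
  by apply: (@sp_act_inj _ _ (X a)); rewrite sp_actVK Xu.
have SXE (a : K) v : v \in spanN -> sp_form (sp_act (X a)^-1 v) v = - (a * v (rshift N ord_max) 0 ^+ 2).
  move=> Nv; have -> : sp_act (X a)^-1 v = v - (a * v (rshift N ord_max) 0) *: u_ ord_max.
    apply: (@sp_act_inj _ _ (X a)); rewrite sp_actVK XE coordD coordN coordZ.
    by rewrite -!e_l e_E eq_rlshift mulr0 subr0 subrK.
  rewrite sp_formDl sp_form_xx sp_formNl sp_formZl sp_form_u add0r expr2 mulrA //.
have Srr : (r * r)%g \in stabMN.
  apply/Sp_stabMNP; split=> [|j|j]; first exact: glM.
    rewrite sp_actM; have [->|/rk[ruj _]] := eqVneq j ord_max; last by rewrite !ruj u_spanM.
    by rewrite ru rv spanM_N ?u_spanM.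
  rewrite sp_actM; have [->|/rk[_ rvj]] := eqVneq j ord_max; last by rewrite !rvj v_spanN.
  by rewrite rv sp_actN ru spanN_N ?v_spanN.
(* c_n and its inverse differ by an element of the Levi subgroup. *)
have rE z' : co (z' *m P r) 0 = co (z' *m P r^-1%g) 0.
  have -> : P r = P r^-1%g *m P (r * r)%g.
    by rewrite -gl_reprM ?(glVr Gr) ?(glM Gr Gr) //; congr (P _); rewrite mulKg.
  by rewrite mulmxA co_unfixed ?(glM Gr Gr) // => z2; apply: co_stab.
(* The panel sum is a linear form; it vanishes because it does so on the basis. *)
pose M : 'M[F]_d := 1%:M + \sum_(a : K) P (X a) *m P r^-1%g.
have -> : co (z *m P g) 0 + \sum_(a : K) fn (z *m orbit_mx) (g * (X a * r))%g = co (z *m P g *m M) 0.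
  rewrite mulmxDr mulmx1 coD; congr (_ + _); rewrite mulmx_sumr co_sum; apply: eq_bigr => a _.
  rewrite fn_orbit ?(glM Gg (glM (GX a) Gr)) // gl_reprM ?(glM (GX a) Gr) //.
  by rewrite gl_reprM // !mulmxA rE.
rewrite co_mulmx big1 // => v Nv; rewrite mulmxDr mulmx1 coD co_eps ?spanN0 // mulmx_sumr co_sum.
set b := v (rshift N ord_max) 0.
rewrite (eq_bigr (fun a : K => lam (a * - (b ^+ 2)) * (v == b *: v_ ord_max)%:R)); last first.
  move=> a _; rewrite mulmxA -[X a]gl_invK (weil_fixM F2 PW) // SXE // -scalemxAl coZ co_c //.
  by rewrite mulrN.
rewrite -mulr_suml; have [vb|nvb] := eqVneq v (b *: v_ ord_max); last first.
  rewrite mulr0 addr0; have [v0|_] := eqVneq 0 v; last by rewrite mulr0.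
  by case/eqP: nvb; rewrite /b -v0 mxE scale0r.
rewrite mulr1; have [b0|b0] := eqVneq b 0.
  rewrite vb b0 scale0r eqxx expr0n oppr0 (eq_bigr (fun=> 1)) => [|a _]; last by rewrite mulr0 (lam0 lamP).
  by rewrite sumr_const (odd_natr F2 oddK) (F2_add F2) mulr0.
rewrite sum_lam ?oppr_eq0 ?sqrf_eq0 // addr0; case: eqP => [v0|_]; last by rewrite mulr0.
by case/eqP: b0; rewrite /b -v0 mxE.
Qed.

(** By induction on generators: the operator of h sends eps_0 to a vector fixed by iota
with coordinate 1 at 0, so to eps_0 modulo Y^-, a submodule on which this coordinate is
0. *)
Lemma eps0_co g : g \in Sp -> co (eps 0 *m P g) 0 = 1.
Proof.
move=> Gg; rewrite -[g]gl_invK; move: g^-1%g (glVr Gg) => {g Gg}.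
suff H g : g \in Sp -> co (eps 0 *m P g^-1%g) 0 == 1 by move=> g /H/eqP.
move: g; apply: Sp_ind => [s Ss|a Sa|r Gr rP|g h Gg Gh /eqP Eg /eqP Eh].
- by rewrite co_fixM // co_eps ?spanN0 // eqxx.
- by rewrite co_stab // co_eps ?spanN0 // eqxx.
- rewrite (weil_rho F2 K2 lamP PW) ?spanN0 // co_sum (bigD1 0) //= big1 => [|c c0].
    by rewrite addr0 scale0r addr0 coZ co_eps ?spanN0 // eqxx expr0n (lam0 lamP) mulr1.
  rewrite add0r coZ co_eps ?spanN0 ?spanN_Z ?v_spanN // eq_sym scaler_eq0 (negPf c0) /=.
  by rewrite -e_r (negPf (e_neq0 K _)) mulr0.
rewrite gl_invM gl_reprM ?(glVr Gg) ?(glVr Gh) // mulmxA.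
set z := eps 0 *m P h^-1%g; have zI : z *m iota = z.
  by rewrite -mulmxA -(weil_iotaC F2 lamP PW) ?(glVr Gh) // mulmxA eps_iota ?spanN0 // oppr0.
have zD := sym_minus K2 zI; rewrite Eh scale1r in zD.
rewrite -[z](subrK (eps 0)) mulmxDl coD Eg -subr_eq0 addrK; apply/eqP; apply: (co_minus F2).
have Gg' := glVr Gg.
exact: submx_trans (submxMr _ zD) (mxmoduleP (diff_module F2 lamP PW) _ Gg').
Qed.

Lemma orbit_mx_sym z : z *m iota = z -> z *m orbit_mx = co z 0 *: ones.
Proof.
move=> zI; apply: fn_inj => g Gg; rewrite fn_orbit // fnZ fn_ones mulr1.
have zD := sym_minus K2 zI; rewrite -[z in LHS](subrK (co z 0 *: eps 0)) mulmxDl coD.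
rewrite -scalemxAl coZ eps0_co // mulr1 -[RHS]add0r; congr (_ + _); apply: (co_minus F2).
exact: submx_trans (submxMr _ zD) (mxmoduleP (diff_module F2 lamP PW) _ Gg).
Qed.

(** The orbit function of eps_(v_n) is 0 at the identity and 1 at c_n^-1. *)
Lemma orbit_not_ones : ~~ (eps (v_ ord_max) *m orbit_mx <= ones)%MS.
Proof.
have Nv := v_spanN K (ord_max : 'I_N).
have [g Cg] := set0Pn _ (c_elt_neq0 K (ord_max : 'I_N)).
have Gg : g \in Sp by case/c_eltP: Cg.
apply/sub_rVP=> -[c E]; have E1 := congr1 (fun f => fn f 1%g) E; have E2 := congr1 (fun f => fn f g^-1%g) E.
move: E1 E2; rewrite /= !fn_orbit ?group1 ?(glVr Gg) // !fnZ !fn_ones repr_mx1 mulmx1 => <-.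
rewrite co_c // co_eps ?spanN0 // -e_r e_E eqxx scale1r eqxx [0 == _]eq_sym.
by rewrite (negPf (e_neq0 K _)) => /eqP; rewrite oner_eq0.
Qed.

End Embedding.

(** * The socle and the embedding *)

Section SubmoduleHom.

Variables (F : fieldType) (gT : finGroupType) (G : {group gT}) (d1 d2 : nat).
Variables (r1 : mx_representation F G d1) (r2 : mx_representation F G d2).

Lemma hom_submod_rsim (U1 : 'M_d1) (U2 : 'M_d2) (modU1 : mxmodule r1 U1)
    (modU2 : mxmodule r2 U2) (Q : 'M_(d1, d2)) :
    (forall g, g \in G -> U1 *m (r1 g *m Q) = U1 *m (Q *m r2 g)) ->
    (U1 *m Q :=: U2)%MS -> \rank U1 = \rank U2 ->
  mx_rsim (submod_repr modU1) (submod_repr modU2).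
Proof.
move=> homQ defU2 eqr; pose v1 := val_submod (1%:M : 'M_(\rank U1)).
have v1U : (v1 <= U1)%MS by rewrite val_submod1.
have BU : (v1 *m Q :=: U2)%MS by apply: eqmx_trans (eqmxMr Q (val_submod1 U1)) defU2.
have sBU : (v1 *m Q <= U2)%MS by rewrite BU.
exists (in_submod U2 (v1 *m Q)); first exact: eqr.
  by rewrite /row_free mxrank_in_submod // BU eqr.
move=> g Gg; have E1 := in_submodJ modU2 g sBU.
have E2 : v1 *m Q *m r2 g = val_submod (submod_repr modU1 g) *m Q.
  have -> : submod_repr modU1 g = 1%:M *m submod_mx modU1 g by rewrite mul1mx.
  rewrite val_submodJ // -/v1; have [A ->] := submxP v1U.
  by rewrite -!mulmxA homQ.
rewrite -[RHS]E1 E2 [RHS]in_submodE [in_submod U2 _]in_submodE [LHS]mulmxA.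
by congr (_ *m _); rewrite [LHS]mulmxA -val_submodE.
Qed.

End SubmoduleHom.

Section SocleQuotient.

Variables (K : finFieldType) (n : nat) (F : fieldType).
Hypotheses (F2 : 2%N \in [pchar F]) (oddK : odd #|K|) (K2 : (2%:R : K) != 0).
Local Notation N := n.+1.
Local Notation gT := {'GL_(n.+1 + n.+1)[K]}.
Local Notation Sp := (Sp K n).
Local Notation spanN := (spanN K n).
Local Notation d := #|spanN|.
Local Notation Y := (weil_minus K n F).
Local Notation iota := (iota_op K n F).
Local Notation diff_op := (diff_op K n F).
Local Notation lreg := (lreg_repr F Sp).
Local Notation ones := (ones K n F).
Variables (nw : coset_of (sp_H K n) -> gT) (nwP : Weyl_lift nw).
Local Notation St := (steinberg_mx F nw).
Local Notation rI := (steinberg_repr F nw).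
Variable sI : socleType rI.
Local Notation S := (Socle sI).
Local Notation IS := (factmod_repr (Socle_module sI)).

Definition ones_sub : 'rV[F]_(\rank St) := in_submod St ones.

Lemma val_ones_sub : val_submod ones_sub = ones.
Proof. by rewrite in_submodK // (ones_steinberg F2 oddK nwP). Qed.

Lemma ones_neq0 : ones != 0.
Proof.
apply/eqP=> E; have := fn_ones F (1%g : gT); rewrite E /fn mxE => /eqP.
by rewrite eq_sym oner_eq0.
Qed.

Lemma ones_lreg g : g \in Sp -> ones *m lreg g = ones.
Proof.
by move=> Gg; apply: fn_inj => h Gh; rewrite fn_lreg // !fn_ones.
Qed.

Lemma ones_sub_fix g : g \in Sp -> ones_sub *m rI g = ones_sub.
Proof.
move=> Gg; rewrite -in_submodJ ?(ones_steinberg F2 oddK nwP) //.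
by rewrite ones_lreg.
Qed.

(** Hence the line of the constant functions is the only simple submodule. *)
Lemma ones_sub_min m (W : 'M[F]_(m, \rank St)) : mxmodule rI W -> W != 0 -> (ones_sub <= W)%MS.
Proof.
move=> modW W0; rewrite -val_submodS val_ones_sub.
apply: (ones_sub_module F2 oddK K2 nwP); last by rewrite val_submod_eq0.
  by rewrite (val_submod_module (cyclic_mx_module lreg (steinberg_e F nw))).
exact: val_submodP.
Qed.

Lemma ones_sub_neq0 : ones_sub != 0.
Proof. by rewrite -val_submod_eq0 val_ones_sub ones_neq0. Qed.

Lemma socle_ones : (S :=: ones_sub)%MS.
Proof.
have gen0 : <<ones_sub>>%MS != 0 by rewrite -mxrank_eq0 genmxE mxrank_eq0 ones_sub_neq0.
have mod1 : mxmodule rI <<ones_sub>>%MS.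
  rewrite (eqmx_module _ (genmxE _)); apply/mxmoduleP=> g Gg.
  by rewrite ones_sub_fix.
apply/eqmxP/andP; split.
  case: (Socle_semisimple sI) => I W /= simW defS _; rewrite -defS.
  apply/sumsmx_subP=> i _; case: (simW i) => modW W0 minW.
  rewrite -(genmxE ones_sub); apply: minW => //.
  by rewrite genmxE ones_sub_min.
rewrite -(genmxE ones_sub); apply: simple_Socle; split=> // U modU _ U0.
by rewrite genmxE ones_sub_min.
Qed.

Lemma rank_socle : \rank S = 1%N.
Proof. by rewrite socle_ones rank_rV ones_sub_neq0. Qed.

Lemma socle_fixed : (S <= rfix_mx rI Sp)%MS.
Proof.
by rewrite socle_ones; apply/rfix_mxP=> g Gg; apply: ones_sub_fix.
Qed.

Section Embed.

Variables (lam : K -> F) (P : mx_representation F Sp d).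
Hypotheses (lamP : nontrivial_char lam) (PW : weil_repr lam P).
Implicit Types (z : 'rV[F]_d).
Local Notation Phi := (orbit_mx P).

Lemma orbit_steinberg : (Phi <= St)%MS.
Proof.
apply/row_subP=> i; apply: (panel_space_steinberg F2 nwP).
rewrite rowE; exact: (orbit_panel F2 oddK K2 lamP PW).
Qed.

Definition orbit_quo : 'M[F]_(d, \rank (cokermx S)) := in_factmod S (in_submod St Phi).

Lemma orbit_quoE m (z : 'M[F]_(m, d)) : z *m orbit_quo = in_factmod S (in_submod St (z *m Phi)).
Proof.
by rewrite /orbit_quo in_factmodE in_submodE [in RHS]in_factmodE [in RHS]in_submodE !mulmxA.
Qed.

Lemma orbit_quoJ g : g \in Sp -> P g *m orbit_quo = orbit_quo *m IS g.
Proof.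
move=> Gg; have E1 := in_factmodJ (Socle_module sI) (in_submod St Phi) Gg.
have E2 : in_submod St (Phi *m lreg g) = in_submod St Phi *m rI g.
  exact: (in_submodJ (cyclic_mx_module lreg (steinberg_e F nw)) g orbit_steinberg).
rewrite orbit_quoE (orbit_mxJ P Gg) E2; exact: E1.
Qed.

Lemma orbit_quo_eq0 z : (z *m orbit_quo == 0) = (z *m Phi <= ones)%MS.
Proof.
rewrite orbit_quoE in_factmod_eq0 socle_ones -val_submodS val_ones_sub in_submodK //.
exact: submx_trans (submxMl _ _) orbit_steinberg.
Qed.

(** The vectors of Y fixed by -1 go to the socle, so that the map from Y to I/S factors
through 1 + (-1), whose image is simple. *)
Lemma ker_orbit_quo : (kermx orbit_quo :=: kermx diff_op)%MS.
Proof.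
have sub : (kermx diff_op <= kermx orbit_quo)%MS.
  apply/rV_subP=> z /sub_kermxP zD; apply/sub_kermxP/eqP; rewrite orbit_quo_eq0.
  have zI : z *m iota = z.
    apply/eqP; rewrite -subr_eq0; move/eqP: zD; rewrite mulmxDr mulmx1 addrC.
    by rewrite (F2_oppv F2).
  by rewrite (orbit_mx_sym F2 K2 lamP PW zI) scalemx_sub.
(* Otherwise the image of the kernel under 1 + iota is all of Y^-, and the kernel is Y. *)
have [D0|nz] := eqVneq (kermx orbit_quo *m diff_op) 0.
  by apply/eqmxP/andP; split=> //; apply/sub_kermxP.
have [_ _ minD] := diff_simple F2 K2 lamP PW.
pose U : 'M[F]_d := <<kermx orbit_quo *m diff_op>>%MS.
have modker : mxmodule P (kermx orbit_quo).
  apply/mxmoduleP=> g Gg; apply/sub_kermxP.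
  by rewrite -mulmxA orbit_quoJ // mulmxA mulmx_ker mul0mx.
have modU : mxmodule P U.
  rewrite (eqmx_module _ (genmxE _)); apply/mxmoduleP=> g Gg.
  rewrite -mulmxA (weil_diffC F2 lamP PW) // mulmxA; apply: submxMr.
  exact: (mxmoduleP modker).
have : (diff_op <= U)%MS.
  apply: minD => //; first by rewrite genmxE submxMl.
  by rewrite -mxrank_eq0 genmxE mxrank_eq0.
rewrite genmxE => /submxP[A EA].
have : (1%:M - A *m kermx orbit_quo <= kermx orbit_quo)%MS.
  apply: submx_trans sub; apply/sub_kermxP.
  by rewrite mulmxBl mul1mx -mulmxA -EA subrr.
move=> le1; have one : (1%:M <= kermx orbit_quo)%MS.
  by rewrite -[1%:M](subrK (A *m kermx orbit_quo)) addmx_sub // submxMl.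
case/negP: (orbit_not_ones F2 K2 lamP PW); rewrite -orbit_quo_eq0; apply/eqP.
by apply/sub_kermxP; apply: submx_trans one; rewrite submx1.
Qed.

(** The orbit map to I/S and 1 + iota have the same kernel, so that the image of the
first is isomorphic to that of the second, which is Y^-. *)
Lemma weil_minus_embed : exists X, mxsimple IS X /\ iso_submod IS X P Y.
Proof.
pose D := diff_op; pose Q := pinvmx D *m orbit_quo.
have DQ : D *m Q = orbit_quo.
  rewrite mulmxA; apply/eqP; rewrite -subr_eq0 -{2}[orbit_quo]mul1mx -mulmxBl.
  apply/eqP/sub_kermxP; rewrite ker_orbit_quo; apply/sub_kermxP.
  by rewrite mulmxBl mul1mx mulmxKpV // subrr.
pose X : 'M[F]_(\rank (cokermx S)) := <<orbit_quo>>%MS.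
have modX : mxmodule IS X.
  rewrite (eqmx_module _ (genmxE _)); apply/mxmoduleP=> g Gg.
  by rewrite -orbit_quoJ // submxMl.
have modY := weil_minus_module F2 lamP PW.
have rXY : \rank Y = \rank X.
  rewrite genmxE (weil_minus_diff K n F2).
  have E : \rank (kermx orbit_quo) = \rank (kermx diff_op) by rewrite ker_orbit_quo.
  move/(congr1 (subn d)): E; rewrite !mxrank_ker !subKn ?rank_leq_row //; exact: esym.
have homQ g : g \in Sp -> D *m (P g *m Q) = D *m (Q *m IS g).
  move=> Gg; rewrite [LHS]mulmxA {1}/D (weil_diffC F2 lamP PW) // -[LHS]mulmxA -/D DQ.
  rewrite [RHS]mulmxA DQ.
  exact: orbit_quoJ.
have simYX : mx_rsim (submod_repr modY) (submod_repr modX).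
  apply: (@hom_submod_rsim _ _ _ _ _ _ _ _ _ _ _ Q) => [g Gg||//].
    have /submxP[A ->] : (Y <= D)%MS by rewrite (weil_minus_diff K n F2).
    by rewrite -[LHS]mulmxA -[RHS]mulmxA homQ.
  apply: eqmx_trans (eqmxMr Q (weil_minus_diff K n F2)) _.
  by rewrite -/D DQ; apply: eqmx_sym; apply: genmxE.
exists X; split; last by exists modX, modY; apply: mx_rsim_sym.
apply/(submod_mx_irr modX); apply: mx_rsim_irr simYX _; apply/submod_mx_irr.
exact: (weil_minus_simple F2 K2 lamP PW).
Qed.

End Embed.

End SocleQuotient.

(** * The two isomorphism types *)

Section WeilTypes.

Variables (K : finFieldType) (n : nat) (F : fieldType).
Hypotheses (F2 : 2%N \in [pchar F]) (K2 : (2%:R : K) != 0).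
Local Notation N := n.+1.
Local Notation gT := {'GL_(n.+1 + n.+1)[K]}.
Local Notation V := 'cV[K]_(n.+1 + n.+1).
Local Notation Sp := (Sp K n).
Local Notation spanN := (spanN K n).
Local Notation d := #|spanN|.
Local Notation eps := (@eps K n F).
Local Notation v_ := (@sp_v K n).
Local Notation Y := (weil_minus K n F).
Local Notation diff_op := (diff_op K n F).
Implicit Types (v w : V) (g h s : gT) (k c : K).

(** The operator of the Levi element that is c^-1 on M and c on N: twisting lambda by a
square amounts to conjugating by an element of Sp. *)
Definition scale_op c : 'M[F]_d := mx_of (fun v : V => eps (c *: v)).

Lemma eps_scale c v : v \in spanN -> eps v *m scale_op c = eps (c *: v).
Proof. exact: eps_mx_of. Qed.

Lemma scale_op_unit c : c != 0 -> scale_op c \in unitmx.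
Proof.
move=> c0; suff E : scale_op c *m scale_op c^-1 = 1%:M by case/mulmx1_unit: E.
apply: eps_mx_inj => v Nv; rewrite mulmxA !eps_scale ?spanN_Z // scalerA mulVf //.
by rewrite scale1r mulmx1.
Qed.

Lemma scale_diffC c : diff_op *m scale_op c = scale_op c *m diff_op.
Proof.
apply: eps_mx_inj => v Nv; rewrite !mulmxA eps_diff // eps_scale // eps_diff ?spanN_Z //.
by rewrite mulmxDl !eps_scale ?spanN_N // scalerN.
Qed.

Lemma scale_weil (lam lam' : K -> F) (P P' : mx_representation F Sp d) c :
  nontrivial_char lam -> weil_repr lam P -> nontrivial_char lam' -> weil_repr lam' P' ->
  c != 0 -> (forall a, lam' a = lam (c ^+ 2 * a)) ->
  forall g, g \in Sp -> P' g *m scale_op c = scale_op c *m P g.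
Proof.
move=> lamP PW lamP' PW' c0 E g Gg; rewrite -[g]gl_invK; move: g^-1%g (glVr Gg) => {g Gg}.
suff H g : g \in Sp -> P' g^-1%g *m scale_op c == scale_op c *m P g^-1%g by move=> g /H/eqP.
move: g; apply: Sp_ind => [s Ss|a Sa|r Gr rP|g h Gg Gh /eqP Eg /eqP Eh].
- apply/eqP/eps_mx_inj => v Nv; rewrite !mulmxA (weil_fixM F2 PW') // -scalemxAl.
  rewrite !eps_scale // (weil_fixM F2 PW) ?spanN_Z // E; congr (lam _ *: _).
  by rewrite sp_actZ sp_formZl sp_formZr mulrA.
- apply/eqP/eps_mx_inj => v Nv; rewrite !mulmxA (weil_stab F2 lamP' PW') //.
  rewrite !eps_scale ?(stab_N Sa) // (weil_stab F2 lamP PW) ?spanN_Z //.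
  by rewrite sp_actZ.
- apply/eqP/eps_mx_inj => v Nv; rewrite !mulmxA (weil_rho F2 K2 lamP' PW') //.
  rewrite eps_scale // (weil_rho F2 K2 lamP PW) ?spanN_Z // mulmx_suml.
  rewrite [RHS](reindex_inj (mulfI c0)) /=; apply: eq_bigr => b _.
  rewrite -scalemxAl eps_scale ?spanN_D ?spanN_Z ?v_spanN // E.
  by rewrite exprMn scalerDr scalerA.
rewrite gl_invM !gl_reprM ?(glVr Gg) ?(glVr Gh) //.
by rewrite -mulmxA Eg mulmxA Eh mulmxA.
Qed.

Lemma weil_minus_iso (lam lam' : K -> F) (P P' : mx_representation F Sp d) c :
  nontrivial_char lam -> weil_repr lam P -> nontrivial_char lam' -> weil_repr lam' P' ->
  c != 0 -> (forall a, lam' a = lam (c ^+ 2 * a)) -> iso_submod P' Y P Y.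
Proof.
move=> lamP PW lamP' PW' c0 E.
exists (weil_minus_module F2 lamP' PW'), (weil_minus_module F2 lamP PW).
apply: (@hom_submod_rsim _ _ _ _ _ _ _ _ _ _ _ (scale_op c)) => [g Gg||//].
  by rewrite (scale_weil lamP PW lamP' PW' c0 E).
have CU := scale_op_unit c0.
apply: eqmx_trans (eqmxMr _ (weil_minus_diff K n F2)) _; rewrite scale_diffC.
apply: eqmx_trans (eqmx_sym (weil_minus_diff K n F2)).
by apply: eqmxMfull; rewrite row_full_unit.
Qed.

(** An isomorphism would send the vector eps_v + eps_(-v) to a vector with the same
weight for the Siegel radical. If w is an index of this image, the weights of v and w
are related by the factor k, which is then a quotient of squares of coordinates. *)
Lemma weil_minus_not_iso (lam : K -> F) (P P' : mx_representation F Sp d) k :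
  nontrivial_char lam -> weil_repr lam P -> weil_repr (fun a => lam (k * a)) P' ->
  (forall c, k != c ^+ 2) -> ~ iso_submod P Y P' Y.
Proof.
move=> lamP PW PW' kn [modU1 [modU2 [f _ ff homf]]].
have k0 : k != 0 by have := kn 0; rewrite expr0n.
have lamP' := char_twist_nontriv lamP k0.
pose v := v_ ord_max; have Nv : v \in spanN := v_spanN K ord_max.
have v0 : v != 0 by rewrite /v -e_r e_neq0.
pose b := eps v *m diff_op; have bY : (b <= Y)%MS.
  by rewrite (weil_minus_diff K n F2) submxMl.
pose y := val_submod (in_submod Y b *m f).
have b0 : b != 0.
  apply: contraNneq v0 => b0; have := eps_diff_co F Nv Nv; rewrite -/b b0 co0 eqxx.
  have [E|_] := eqVneq v (- v); first by rewrite (oppr_fix K2 (esym E)) eqxx.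
  by move/eqP; rewrite addr0 eq_sym oner_eq0.
have y0 : y != 0.
  rewrite val_submod_eq0; apply: contraNneq b0 => yf0; rewrite -(in_submodK bY).
  rewrite val_submod_eq0; apply/eqP; apply: (row_free_inj ff); rewrite yf0 mul0mx //.
have ys s : s \in Sp_fixM K n -> y *m P' s^-1%g = lam (sp_form (sp_act s v) v) *: y.
  move=> Ss; have Gs := glVr (fixM_Sp Ss).
  rewrite -val_submodJ // -[X in val_submod X]mulmxA -homf // mulmxA -in_submodJ //.
  have -> : b *m P s^-1%g = lam (sp_form (sp_act s v) v) *: b.
    by rewrite /b -mulmxA (weil_diffC F2 lamP PW) // mulmxA (weil_fixM F2 PW) // -scalemxAl.
  by rewrite linearZ /= -scalemxAl linearZ.
have yD : (y <= diff_op)%MS by rewrite -(weil_minus_diff K n F2) val_submodP.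
have [w /andP[Nw cw]] : exists w, (w \in spanN) && (co y w != 0).
  apply/existsP; apply: contraNT y0 => /existsPn E; apply/eqP/co_inj => x Nx.
  by have := E x; rewrite Nx negbK co0 => /eqP.
have E s : s \in Sp_fixM K n ->
    lam (sp_form (sp_act s v) v) = lam (k * sp_form (sp_act s w) w).
  move=> Ss; apply: (mulIf cw); rewrite -(co_weil_fixM F2 PW') // ys //.
  by rewrite coZ.
have := siegel_char_inj K2 lamP Nv Nw E ord_max ord_max.
rewrite /v -e_r e_E eqxx mul1r -expr2 => E1.
have w0 : w (rshift N ord_max) 0 != 0.
  by apply: contra_eq_neq E1 => ->; rewrite expr0n mulr0 oner_eq0.
case/eqP: (kn (w (rshift N ord_max) 0)^-1).
by rewrite exprVn -[LHS](mulfK (expf_neq0 2 w0)) -E1 mul1r.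
Qed.

End WeilTypes.

Theorem theorem6p7 (p k : nat) (hp : prime p) (odd_p : odd p) (hk : (0 < k)%N)
    (K : finFieldType) (hK : #|K| = (p ^ k)%N) (n : nat)
    (F : fieldType) (hF : 2%N \in [pchar F])
    (z : F) (hz : p.-primitive_root z)
    (nw : coset_of (sp_H K n) -> {'GL_(n.+1 + n.+1)[K]}) (hnw : Weyl_lift nw)
    (sI : socleType (steinberg_repr F nw)) :
  let S := Socle sI in
  let IS := factmod_repr (Socle_module sI) in
  let Y := weil_minus K n F in
  [/\ \rank S = 1%N /\ (S <= rfix_mx (steinberg_repr F nw) (Sp K n))%MS,
      forall lam : K -> F, nontrivial_char lam ->
        exists P : mx_representation F (Sp K n) #|spanN K n|, weil_repr lam P,
      forall (lam : K -> F) (P : mx_representation F (Sp K n) #|spanN K n|),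
        nontrivial_char lam -> weil_repr lam P ->
        [/\ \rank Y = ((#|K| ^ n.+1).-1 %/ 2)%N,
            mxsimple P Y
          & exists X, mxsimple IS X /\ iso_submod IS X P Y]
    & exists lam1 lam2 : K -> F,
      exists P1 P2 : mx_representation F (Sp K n) #|spanN K n|,
      [/\ nontrivial_char lam1 /\ weil_repr lam1 P1,
          nontrivial_char lam2 /\ weil_repr lam2 P2,
          ~ iso_submod P1 Y P2 Y
        & forall (lam : K -> F) (P : mx_representation F (Sp K n) #|spanN K n|),
            nontrivial_char lam -> weil_repr lam P ->
            iso_submod P Y P1 Y \/ iso_submod P Y P2 Y]].
Proof.
have oddK : odd #|K| by rewrite hK oddX odd_p orbT.
have K2 : (2%:R : K) != 0.
  rewrite -(dvdn_pcharf (card_finPcharP hK hp)) gtnNdvd //.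
  by rewrite ltn_neqAle prime_gt1 // andbT; apply: contraTneq odd_p => <-.
have qF : (#|K|%:R : F) != 0 by rewrite (odd_natr hF oddK) oner_neq0.
split.
- by split; [exact: rank_socle | exact: socle_fixed].
- by move=> lam lamP; exists (MxRepresentation (weil_mx_repr n hF K2 lamP)); apply: weil_mx_weil.
- move=> lam P lamP PW; split; first exact: rank_weil_minus.
    exact: weil_minus_simple lamP PW.
  exact: weil_minus_embed lamP PW.
have [lam1 lamP1] := char_exists hp hK hz.
have [k0 kn0 kns] := nonsquare_exists K2.
pose lam2 a := lam1 (k0 * a); have lamP2 : nontrivial_char lam2 := char_twist_nontriv lamP1 kn0.
have PW1 := weil_mx_weil n hF K2 lamP1; have PW2 := weil_mx_weil n hF K2 lamP2.
exists lam1, lam2, (MxRepresentation (weil_mx_repr n hF K2 lamP1)),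
  (MxRepresentation (weil_mx_repr n hF K2 lamP2)).
split=> //; first exact: weil_minus_not_iso lamP1 PW1 PW2 kns.
move=> lam P lamP PW; have [l l0 lE] := char_is_twist qF lamP lamP1.
have [/existsP[c /eqP lc]|nsq] := boolP [exists c, l == c ^+ 2].
  left; apply: (weil_minus_iso hF K2 lamP1 PW1 lamP PW (c := c)).
    by apply: contraNneq l0 => c0; rewrite lc c0 expr0n.
  by move=> a; rewrite lE lc.
right; have [c c0 lc] := nonsquare_ratio K2 kn0 kns l0 (fun c => existsPn nsq c).
by apply: (weil_minus_iso hF K2 lamP2 PW2 lamP PW c0) => a; rewrite lE lc /lam2 mulrCA mulrA.
Qed.
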